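(* Let $p=(p_i)_{i\in\mathbb{N}}$ be a probability distribution over $\mathbb{N}$, let $X^n$ be a sample of $n\ge 2$ independent observations from $p$, and let $\hat p=\hat p(X^n)$ be the MLE of $p$. Let $\delta_1,\delta_2\in(0,1)$ and let $m$ be a positive even integer. Then, with probability at least $1-\delta_1-\delta_2$, $$\|p-\hat p\|_\infty\le\frac1n\left(\frac{1}{\delta_1}\,\frac{n}{n-1}\left(\sum_{i\in\mathbb{N}}\sum_{k=1}^{m/2}k^{m-k}n^k\big(\hat p_i(1-\hat p_i)\big)^k+\epsilon\right)\right)^{1/m},$$ where $$\epsilon=\sqrt{\frac n2\log(1/\delta_2)}\cdot\sum_{k=1}^{m/2}k^{m-k}n^k\left(\frac{k}{n\,4^{k-1}}+\frac{3k^3}{n^3\,2^{2k-5}}\right).$$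
   Context: $\mathbb{N}=\{1,2,\dots\}$. The support of $p$ may be finite or infinite. For a sample $X^n=(X_1,\dots,X_n)$ of i.i.d. draws from $p$, $c_i(X^n)$ is the number of appearances of symbol $i$ and the maximum likelihood estimator (MLE) is $\hat p_i(X^n)=c_i(X^n)/n$, $i\in\mathbb{N}$. $\|p-\hat p\|_\infty=\sup_{i\in\mathbb{N}}|p_i-\hat p_i(X^n)|$. $\log$ is the natural logarithm. *)

(* Defs.v *)
From HB Require Import structures.
From mathcomp Require Import all_boot all_order all_algebra.
From mathcomp Require Import all_classical all_reals all_analysis.

Set Implicit Arguments.
Unset Strict Implicit.
Unset Printing Implicit Defensive.

Import Order.TTheory GRing.Theory Num.Theory.
Import numFieldNormedType.Exports.

Local Open Scope classical_set_scope.
Local Open Scope ring_scope.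

(* The countable alphabet {1, 2, ...} is represented by nat: symbols are mere
   labels, and a distribution on {1, 2, ...} is one on nat with p 0 = 0. *)
Definition prob_dist (R : realType) (p : nat -> R) : Prop :=
  (forall i, 0 <= p i) /\ series p @ \oo --> (1 : R).

Definition mutually_independent d d' (T : measurableType d)
    (T' : measurableType d') (R : realType) (P : probability T R)
    (I : finType) (X : I -> {RV P >-> T'}) : Prop :=
  forall (J : {set I}) (A : I -> set T'), (forall j, measurable (A j)) ->
    P (\bigcap_(j in [set` J]) (X j @^-1` A j))
      = (\prod_(j in J) P (X j @^-1` A j))%E.

Arguments mutually_independent {d d' T T' R} P {I} X.

Definition iid_sample d (T : measurableType d) (R : realType)
    (P : probability T R) (n : nat) (p : nat -> R)
    (X : 'I_n -> {RV P >-> nat}) : Prop :=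
  (forall j i, distribution P (X j) [set i] = (p i)%:E)
  /\ mutually_independent P X.

Arguments iid_sample {d T R} P {n} p X.

Definition appearances (n : nat) (x : 'I_n -> nat) (i : nat) : nat :=
  #|[pred j : 'I_n | x j == i]|.

Definition mle (R : realType) (n : nat) (x : 'I_n -> nat) (i : nat) : R :=
  (appearances x i)%:R / n%:R.

(* For probability vectors p and q the set below is nonempty and bounded by 1,
   so the real supremum is the genuine one. *)
Definition linf_dist (R : realType) (p q : nat -> R) : R :=
  sup (range (fun i => `|p i - q i|)).

(* The outer series has at most n nonzero terms when q is an empirical
   distribution of n observations (the inner sum starts at k = 1), hence it
   converges and limn is the genuine sum. *)
Definition moment_sum (R : realType) (n m : nat) (q : nat -> R) : R :=
  limn (series (fun i =>
    \sum_(1 <= k < (m %/ 2).+1)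
      k%:R ^+ (m - k) * n%:R ^+ k * (q i * (1 - q i)) ^+ k)).

(* The exponent 2k - 5 is an integer, negative for k = 1, 2. *)
Definition epsilon (R : realType) (n m : nat) (delta : R) : R :=
  Num.sqrt (n%:R / 2 * ln (1 / delta)) *
  \sum_(1 <= k < (m %/ 2).+1)
    k%:R ^+ (m - k) * n%:R ^+ k *
    (k%:R / (n%:R * 4 ^+ (k - 1))
     + 3 * k%:R ^+ 3 / (n%:R ^+ 3 * 2 ^ (2 * k%:Z - 5))).

(* Main.v *)
From Stdlib Require Import NArith.
Require Import Defs.
From HB Require Import structures.
From mathcomp Require Import all_boot all_order all_algebra all_fingroup.
From mathcomp Require Import all_classical all_reals all_analysis.
From mathcomp Require Import ring lra zify.

Set Implicit Arguments.
Unset Strict Implicit.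
Unset Printing Implicit Defensive.

Import Order.TTheory GRing.Theory Num.Theory.
Import numFieldNormedType.Exports.

Local Open Scope classical_set_scope.
Local Open Scope ring_scope.

(** Let c_i be the counts, x_i = c_i - n p_i the deviations, r = n / (n - 1),
    L = log (1 / delta2), A the double sum of the statement evaluated at the
    sample, and C the sum that multiplies the square root in epsilon, so that
    epsilon = b sqrt L with b = sqrt (n / 2) C. The claim is that
    max_i x_i^m <= (r / delta1) (A + epsilon) fails with probability at most
    delta1 + delta2. Two different arguments prove it for m >= 4 and for m = 2.

    For m = 2 M >= 4, changing one observation changes A by at most C
    ([emp_bounded_diff]), so that McDiarmid's inequality gives
    A > E A - epsilon outside an event of probability delta2. On the other hand
    E sum_i x_i^m <= r max (E A, b) ([sum_moment_le]). If E A >= b, Markov's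
    inequality concludes. If E A < b, already epsilon is large enough: Markov's
    inequality bounds the failure by delta1 / sqrt L, and this is at most
    delta1 + delta2 because L >= 1 - delta2.

    The moment inequality is proved for each symbol ([bin_moment_le_mix]). For a
    binomial count c with parameters n and p, the central moment of order 2 M is
    at most r times a convex combination, with weights that do not depend on p,
    of M^M E (c (n - c) / n)^M, the contribution of the symbol to
    the term k = M of E A, and of p (1 - p) b, whose sum over the symbols is at
    most b. For small M both moments are expanded in the products
    n ^_ j (p (1 - p))^j; the coefficients count partitions, and the comparison
    is a finite computation with integers together with monotonicity in n. For
    large M exponential moments suffice.

    For m = 2 the bounded-difference constant of A is about 2, while C is close
    to 1. But r A is a U-statistic, the number of ordered pairs of distinct
    observations divided by n - 1, with mean W = n (1 - sum_i p_i^2), and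
    Hoeffding's averaging over disjoint pairs gives a lower tail that matches
    epsilon ([discordance_tail]). If n <= 8, Markov's inequality for
    S = sum_i x_i^2, whose mean is W, concludes. If n >= 9, the fourth moments
    of the deviations suffice unless delta1 >= 3 / 10. In that remaining range
    the two sources of failure are not separated: A = W - 2 Lam - S / n with
    Lam = sum_i p_i x_i, failure makes a quadratic function of the deviations
    large, and Markov's inequality for this function leads to an inequality in
    the single variable L ([far2_covariance], [quartic_ge]).

    Probabilities are computed for a finite alphabet, where expectations are
    finite sums. The countable alphabet is reached by merging all symbols from
    K on into one symbol; the probability that it appears among n observations
    tends to 0 as K grows ([typical_prob_ge]). *)

(** * Independent draws from a finite alphabet and binomial moments *)

Section IidMean.
Context {R : realFieldType} {I : finType} (w : I -> R).
Implicit Types (f g : seq I -> R) (A B : seq I -> bool).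

(** The expectation of a function of n independent draws from the
    distribution w on a finite alphabet, as a recursion on n: the inductive
    proofs below condition on the first draw. *)
Fixpoint iid_mean n f : R :=
  if n is n'.+1 then \sum_i w i * iid_mean n' (fun s => f (i :: s)) else f [::].

Definition iid_prob n A : R := iid_mean n (fun s => (A s)%:R).

Lemma iid_mean_ext n f g :
  (forall s, size s = n -> f s = g s) -> iid_mean n f = iid_mean n g.
Proof.
elim: n f g => [|n IH] f g fg /=; first exact: fg.
by apply: eq_bigr => i _; congr (_ * _); apply: IH => s hs; apply: fg; rewrite /= hs.
Qed.

Lemma iid_meanD n f g :
  iid_mean n (fun s => f s + g s) = iid_mean n f + iid_mean n g.
Proof.
elim: n f g => [|n IH] f g //=; rewrite -big_split; apply: eq_bigr => i _ /=.
by rewrite IH mulrDr.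
Qed.

Lemma iid_meanZ n a f : iid_mean n (fun s => a * f s) = a * iid_mean n f.
Proof.
elim: n f => [|n IH] f //=; rewrite mulr_sumr; apply: eq_bigr => i _.
by rewrite IH mulrCA.
Qed.

Lemma iid_mean_sum n (J : Type) (r : seq J) (P : pred J) (f : J -> seq I -> R) :
  iid_mean n (fun s => \sum_(j <- r | P j) f j s) =
  \sum_(j <- r | P j) iid_mean n (f j).
Proof.
elim: r => [|j r IH].
  under iid_mean_ext do rewrite big_nil -(mul0r 0).
  by rewrite iid_meanZ mul0r big_nil.
rewrite big_cons -IH; case: ifP => hP; rewrite -?iid_meanD;
  by apply: iid_mean_ext => s _; rewrite big_cons hP.
Qed.

Hypothesis w_ge0 : forall i, 0 <= w i.
Hypothesis w_sum1 : \sum_i w i = 1.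

Lemma iid_mean_cst n a : iid_mean n (fun=> a) = a.
Proof. by elim: n => [|n IH] //=; rewrite IH -mulr_suml w_sum1 mul1r. Qed.

Lemma iid_mean_le n f g :
  (forall s, size s = n -> f s <= g s) -> iid_mean n f <= iid_mean n g.
Proof.
elim: n f g => [|n IH] f g fg /=; first exact: fg.
by apply: ler_sum => i _; apply: ler_wpM2l => //; apply: IH => s hs; apply: fg; rewrite /= hs.
Qed.

Lemma iid_mean_ge0 n f : (forall s, size s = n -> 0 <= f s) -> 0 <= iid_mean n f.
Proof. by move=> f0; rewrite -(iid_mean_cst n 0); exact: iid_mean_le. Qed.

Lemma iid_prob_le n A B :
  (forall s, size s = n -> A s -> B s) -> iid_prob n A <= iid_prob n B.
Proof.
by move=> AB; apply: iid_mean_le => s hs; case: (A s) (AB s hs) => [->|_].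
Qed.

Lemma iid_probU n A B :
  iid_prob n (fun s => A s || B s) <= iid_prob n A + iid_prob n B.
Proof.
rewrite /iid_prob -iid_meanD; apply: iid_mean_le => s _.
by case: (A s); case: (B s); rewrite /= ?mulr1n ?mulr0n; lra.
Qed.

Lemma iid_prob_le1 n A : iid_prob n A <= 1.
Proof. by rewrite -(iid_mean_cst n 1); apply: iid_mean_le => s _; case: (A s). Qed.

Lemma iid_prob_ge0 n A : 0 <= iid_prob n A.
Proof. by apply: iid_mean_ge0 => s _; case: (A s). Qed.

Lemma iid_markov n A f t :
  (forall s, size s = n -> 0 <= f s) -> (forall s, size s = n -> A s -> t <= f s) ->
  t * iid_prob n A <= iid_mean n f.
Proof.
move=> f0 Af; rewrite -iid_meanZ; apply: iid_mean_le => s hs.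
by case: (A s) (Af s hs) => [/(_ isT)|_]; rewrite ?mulr1 ?mulr0 ?f0.
Qed.

End IidMean.

Section Binomial.
Context {R : realFieldType} (p : R).
Implicit Types (f g : nat -> R).
Local Notation q := (1 - p).

(** The expectation of a function of a binomial variable with parameters n
    and p, again by conditioning on the first trial. *)
Fixpoint bin_mean n g : R :=
  if n is n'.+1
  then p * bin_mean n' (fun c => g c.+1) + q * bin_mean n' g else g 0%N.

Lemma bin_mean_ext n f g :
  (forall c, (c <= n)%N -> f c = g c) -> bin_mean n f = bin_mean n g.
Proof.
elim: n f g => [|n IH] f g fg /=; first exact: fg.
by rewrite (IH f g) ?(IH (fun c => f c.+1) (fun c => g c.+1)) // => c hc; apply: fg; lia.
Qed.

Lemma bin_meanD n f g : bin_mean n (fun c => f c + g c) = bin_mean n f + bin_mean n g.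
Proof. by elim: n f g => [|n IH] f g //=; rewrite !IH; ring. Qed.

Lemma bin_meanZ n a f : bin_mean n (fun c => a * f c) = a * bin_mean n f.
Proof. by elim: n f => [|n IH] f //=; rewrite !IH; ring. Qed.

Lemma bin_meanB n f g : bin_mean n (fun c => f c - g c) = bin_mean n f - bin_mean n g.
Proof. by elim: n f g => [|n IH] f g //=; rewrite !IH; ring. Qed.

Lemma bin_mean_sum n (J : Type) (r : seq J) (P : pred J) (f : J -> nat -> R) :
  bin_mean n (fun c => \sum_(j <- r | P j) f j c) =
  \sum_(j <- r | P j) bin_mean n (f j).
Proof.
elim: r => [|j r IH].
  under bin_mean_ext do rewrite big_nil -(mul0r 0).
  by rewrite bin_meanZ mul0r big_nil.
rewrite big_cons -IH; case: ifP => hP; rewrite -?bin_meanD;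
  by apply: bin_mean_ext => s _; rewrite big_cons hP.
Qed.

Lemma bin_mean_cst n a : bin_mean n (fun=> a) = a.
Proof. by elim: n => [|n IH] //=; rewrite IH; ring. Qed.

Lemma bin_mean_count_mul n g :
  bin_mean n.+1 (fun c => c%:R * g c) = n.+1%:R * p * bin_mean n (fun c => g c.+1).
Proof.
elim: n g => [|n IH] g; first by rewrite /=; ring.
rewrite [LHS]/= -!/(bin_mean n.+1 _).
rewrite (_ : bin_mean n.+1 (fun c => c.+1%:R * g c.+1) =
   bin_mean n.+1 (fun c => c%:R * g c.+1) + bin_mean n.+1 (fun c => g c.+1)); last first.
  by rewrite -bin_meanD; apply: bin_mean_ext => c _; rewrite -natr1; ring.
rewrite !IH [bin_mean n.+1 (fun c => g c.+1)]/= -[n.+2%:R]natr1; ring.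
Qed.

Lemma bin_mean_cocount_mul n g :
  bin_mean n.+1 (fun c => (n.+1%:R - c%:R) * g c) = n.+1%:R * q * bin_mean n g.
Proof.
rewrite (_ : bin_mean _ _ = n.+1%:R * bin_mean n.+1 g - bin_mean n.+1 (fun c => c%:R * g c)).
  by rewrite bin_mean_count_mul /=; ring.
rewrite -bin_meanZ -bin_meanB; apply: bin_mean_ext => c _; ring.
Qed.

(** Stein's identity for the binomial law. It trades one factor of the
    centred count for a discrete derivative and the variance n p (1 - p), and is
    the source of every moment recursion below. *)
Lemma bin_mean_stein n g :
  bin_mean n.+1 (fun c => (c%:R - n.+1%:R * p) * g c) =
  n.+1%:R * (p * q) * bin_mean n (fun c => g c.+1 - g c).
Proof.
transitivity (q * bin_mean n.+1 (fun c => c%:R * g c)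
              - p * bin_mean n.+1 (fun c => (n.+1%:R - c%:R) * g c)).
  rewrite -!bin_meanZ -bin_meanB; apply: bin_mean_ext => c _; ring.
by rewrite bin_mean_count_mul bin_mean_cocount_mul bin_meanB; ring.
Qed.

(** Falling factorials shift the binomial law, which turns them into exact
    moments. *)
Lemma bin_mean_ffact j n g :
  bin_mean n (fun c => (c ^_ j)%:R * g c) =
  (n ^_ j)%:R * p ^+ j * bin_mean (n - j) (fun c => g (c + j)%N).
Proof.
elim: j n g => [|j IH] n g.
  by rewrite ffactn0 subn0 !mul1r; apply: bin_mean_ext => c _; rewrite addn0 mul1r.
case: n => [|n].
  by rewrite !ffact0n !mul0r /= ffact0n mul0r.
rewrite (_ : bin_mean _ _ =
   bin_mean n.+1 (fun c => c%:R * ((c.-1 ^_ j)%:R * g c))); last first.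
  by apply: bin_mean_ext => c _; rewrite ffactnS natrM mulrA.
rewrite bin_mean_count_mul /= (IH n (fun c => g c.+1)) ffactSS natrM subSS exprS.
under [in RHS]bin_mean_ext do rewrite addnS.
ring.
Qed.

Hypothesis p01 : 0 <= p <= 1.

Lemma bin_mean_le n f g :
  (forall c, (c <= n)%N -> f c <= g c) -> bin_mean n f <= bin_mean n g.
Proof.
elim: n f g => [|n IH] f g fg /=; first exact: fg.
have h1 : bin_mean n (fun c => f c.+1) <= bin_mean n (fun c => g c.+1).
  by apply: IH => c hc; apply: fg; lia.
have h2 : bin_mean n f <= bin_mean n g by apply: IH => c hc; apply: fg; lia.
by case/andP: p01 => p0 p1; apply: lerD; apply: ler_wpM2l => //; lra.
Qed.

Lemma bin_mean_ge0 n f : (forall c, (c <= n)%N -> 0 <= f c) -> 0 <= bin_mean n f.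
Proof. by move=> f0; rewrite -(bin_mean_cst n 0); exact: bin_mean_le. Qed.

End Binomial.

(** Only the count of one symbol matters to a function of that count, and
    that count is binomial. *)
Lemma iid_mean_count (R : realFieldType) (I : finType) (w : I -> R) (i : I) n (g : nat -> R) :
  \sum_i w i = 1 ->
  iid_mean w n (fun s => g (count_mem i s)) = bin_mean (w i) n g.
Proof.
move=> w1; elim: n g => [|n IH] g //=.
rewrite (bigD1 i) //= eqxx /= (IH (fun c => g c.+1)); congr (_ + _).
under eq_bigr => j ji do rewrite (negbTE ji) /= IH.
rewrite -mulr_suml; congr (_ * _); apply: (addrI (w i)).
by rewrite [RHS]addrCA subrr addr0 -[RHS]w1 [RHS](bigD1 i).
Qed.

(** The tangent line of a power; it gives Jensen's inequality for powers and
    Bernoulli's inequality. *)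
Lemma exprn_tangent_le (R : realFieldType) (a x : R) m : 0 <= a -> 0 <= x ->
  a ^+ m.+1 + m.+1%:R * a ^+ m * (x - a) <= x ^+ m.+1.
Proof.
move=> a0 x0; elim: m => [|m IH]; first by rewrite !expr1 expr0; lra.
have h := ler_wpM2l x0 IH.
rewrite [x ^+ m.+2]exprS; apply: le_trans h.
have e : 0 <= m.+1%:R * a ^+ m * (x - a) ^+ 2.
  by apply: mulr_ge0; [apply: mulr_ge0 => //; exact: exprn_ge0|exact: sqr_ge0].
rewrite -[m.+2%:R]natr1 [a ^+ m.+2]exprS [a ^+ m.+1]exprS.
by move: e; rewrite expr2; set A := a ^+ m; set k := m.+1%:R; nra.
Qed.

Lemma bin_mean_jensen (R : realFieldType) (p : R) n m (f : nat -> R) : 0 <= p <= 1 ->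
  (forall c, (c <= n)%N -> 0 <= f c) ->
  bin_mean p n f ^+ m <= bin_mean p n (fun c => f c ^+ m).
Proof.
move=> p01 f0; case: m => [|m].
  by rewrite expr0; under bin_mean_ext do rewrite expr0; rewrite bin_mean_cst.
set a := bin_mean p n f; have a0 : 0 <= a by exact: bin_mean_ge0.
apply: le_trans (bin_mean_le p01 (f := fun c => a ^+ m.+1 + m.+1%:R * a ^+ m * (f c - a)) _).
  rewrite bin_meanD bin_mean_cst bin_meanZ bin_meanD bin_mean_cst -/a subrr mulr0 addr0.
  exact: lexx.
by move=> c hc; apply: exprn_tangent_le => //; exact: f0.
Qed.

(** The number of partitions of a set of m elements into j blocks of at least
    two elements (associated Stirling numbers of the second kind), by the size
    m - i of the block of a fixed element, the remaining i elements being split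
    into j - 1 blocks. *)
Fixpoint assoc_stirling j m : nat :=
  if j is j'.+1 then
    if m is m'.+1 then (\sum_(i < m') 'C(m', i) * assoc_stirling j' i)%N else 0
  else m == 0.

Fixpoint stirling2 m j : nat :=
  if m is m'.+1 then
    if j is j'.+1 then (j * stirling2 m' j + stirling2 m' j')%N else 0
  else j == 0.

Lemma stirling2_small m j : (m < j)%N -> stirling2 m j = 0%N.
Proof.
elim: m j => [|m IH] [|j] //= mj; rewrite !IH ?muln0 //; lia.
Qed.

Lemma expn_ffact c m : (c ^ m = \sum_(j < m.+1) stirling2 m j * c ^_ j)%N.
Proof.
elim: m => [|m IH]; first by rewrite big_ord_recl big_ord0 /= ffactn0.
rewrite expnS IH big_distrr /=.
rewrite [RHS]big_ord_recl /= mul0n add0n.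
rewrite (eq_bigr (fun j : 'I_m.+1 => (j * stirling2 m j * c ^_ j + stirling2 m j * c ^_ j.+1)%N)); last first.
  move=> j _; case: (leqP j c) => hj; last by rewrite !ffact_small ?muln0 //; lia.
  by rewrite ffactnSr -{1}(subnK hj); ring.
rewrite big_split /= [RHS](eq_bigr (fun j : 'I_m.+1 =>
  (j.+1 * stirling2 m j.+1 * c ^_ j.+1 + stirling2 m j * c ^_ j.+1)%N)); last first.
  by move=> j _; rewrite /bump /= mulnDl.
rewrite big_split /=; congr (_ + _)%N.
rewrite big_ord_recl /= !mul0n add0n [RHS]big_ord_recr /=.
by rewrite stirling2_small // muln0 mul0n addn0.
Qed.

Lemma assoc_stirling_small j m : (m < j.*2)%N -> assoc_stirling j m = 0%N.
Proof.
elim: j m => [|j IH] [|m] //= mj; apply: big1 => i _; rewrite IH ?muln0 //.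
have := ltn_ord i; lia.
Qed.

Section CentralMoments.
Context {R : realFieldType} (p : R).
Hypothesis p01 : 0 <= p <= 1.
Local Notation q := (1 - p).

(** The shape of a central moment of a sum of n centred variables of variance
    v, each taking values in [-1, 1]: a partition of the m factors into j blocks
    of equal indices contributes n ^_ j choices of indices and at most v ^ j,
    and singleton blocks contribute nothing. *)
Definition moment_bound (v : R) n m : R :=
  \sum_(j < m.+1) (assoc_stirling j m)%:R * (n ^_ j)%:R * v ^+ j.

Lemma moment_bound_widen v n m k : (m <= k)%N -> moment_bound v n m =
  \sum_(j < k.+1) (assoc_stirling j m)%:R * (n ^_ j)%:R * v ^+ j.
Proof.
move=> mk; rewrite /moment_bound.
rewrite (big_ord_widen_cond k.+1 xpredT (fun j => (assoc_stirling j m)%:R * (n ^_ j)%:R * v ^+ j)) //.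
rewrite [RHS](bigID (fun j : 'I_k.+1 => (j < m.+1)%N)) /=.
rewrite [X in _ = _ + X]big1 ?addr0 // => j; rewrite -leqNgt => hj.
by rewrite assoc_stirling_small ?mul0r //; lia.
Qed.

(** The recursion that Stein's identity produces, satisfied by the bound with
    equality. *)
Lemma moment_boundS v n m :
  moment_bound v n.+1 m.+1 =
  n.+1%:R * v * \sum_(i < m) 'C(m, i)%:R * moment_bound v n i.
Proof.
rewrite {1}/moment_bound big_ord_recl /= !mul0r add0r.
under eq_bigr => j _ do rewrite /bump /= natr_sum mulr_suml mulr_suml.
rewrite exchange_big mulr_sumr; apply: eq_bigr => i _.
rewrite (moment_bound_widen v n (k := m)) ?mulr_sumr; last by have := ltn_ord i; lia.
apply: eq_bigr => j _; rewrite add1n ffactSS natrM natrM exprS; ring.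
Qed.

(** Stein's identity and the binomial expansion of the discrete derivative
    give the recursion of [moment_boundS], because q ^ k - (- p) ^ k is at most
    1 in absolute value for k > 0. *)
Lemma bin_central_moment_le n m :
  `|bin_mean p n (fun c => (c%:R - n%:R * p) ^+ m)| <= moment_bound (p * q) n m.
Proof.
elim/ltn_ind: m n => -[|m] IH n.
  under bin_mean_ext do rewrite expr0.
  by rewrite bin_mean_cst /moment_bound big_ord_recl big_ord0 /= normr1 ffactn0 expr0 !mul1r addr0.
have [p0 p1] : 0 <= p /\ p <= 1 by case/andP: p01.
have v0 : 0 <= p * q by apply: mulr_ge0; lra.
case: n => [|n].
  rewrite /= mul0r subr0 expr0n normr0 /moment_bound.
  by apply: sumr_ge0 => j _; apply: mulr_ge0; [exact: mulr_ge0|exact: exprn_ge0].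
under bin_mean_ext do rewrite exprS.
rewrite bin_mean_stein moment_boundS normrM ger0_norm; last exact: mulr_ge0.
apply: ler_wpM2l; first exact: mulr_ge0.
have -> : bin_mean p n (fun c => (c.+1%:R - n.+1%:R * p) ^+ m - (c%:R - n.+1%:R * p) ^+ m) =
  \sum_(i < m) 'C(m, i)%:R * ((q ^+ (m - i) - (- p) ^+ (m - i)) *
     bin_mean p n (fun c => (c%:R - n%:R * p) ^+ i)).
  under [in RHS]eq_bigr => i _ do rewrite -!bin_meanZ.
  rewrite -bin_mean_sum; apply: bin_mean_ext => c _.
  have -> : c.+1%:R - n.+1%:R * p = q + (c%:R - n%:R * p) by rewrite -[c.+1%:R]natr1 -[n.+1%:R]natr1; ring.
  have -> : c%:R - n.+1%:R * p = - p + (c%:R - n%:R * p) by rewrite -[n.+1%:R]natr1; ring.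
  rewrite !exprDn -sumrB big_ord_recr /= subnn !expr0 subrr addr0.
  by apply: eq_bigr => i _; rewrite mulrBl mulrBr !mulr_natl.
apply: le_trans (ler_norm_sum _ _ _) _; apply: ler_sum => i _.
rewrite normrM ger0_norm ?ler0n //; apply: ler_wpM2l; first exact: ler0n.
rewrite normrM -[moment_bound _ _ _]mul1r.
apply: ler_pM => //; last by apply: IH; have := ltn_ord i; lia.
have : (0 < m - i)%N by rewrite subn_gt0.
case: (m - i)%N => // k _.
apply: le_trans (ler_normB _ _) _.
rewrite !normrX normrN !ger0_norm; [|lra|lra].
have h1 : p ^+ k <= 1 by apply: exprn_ile1; lra.
have h2 : q ^+ k <= 1 by apply: exprn_ile1; lra.
by rewrite !exprS; nra.
Qed.

(** Writing c ^ m in falling factorials leaves a binomial law with n - j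
    trials, to which Jensen's inequality applies. *)
Lemma bin_mean_var_pow_ge n m :
  \sum_(j < m.+1) (stirling2 m j)%:R * (n ^_ j)%:R * p ^+ j * ((n - j)%:R * q) ^+ m <=
  bin_mean p n (fun c => (c%:R * (n%:R - c%:R)) ^+ m).
Proof.
have -> : bin_mean p n (fun c => (c%:R * (n%:R - c%:R)) ^+ m) =
  \sum_(j < m.+1) (stirling2 m j)%:R * bin_mean p n (fun c => (c ^_ j)%:R * (n%:R - c%:R) ^+ m).
  under [in RHS]eq_bigr => j _ do rewrite -bin_meanZ.
  rewrite -bin_mean_sum; apply: bin_mean_ext => c _.
  rewrite exprMn -natrX expn_ffact natr_sum mulr_suml.
  by apply: eq_bigr => j _; rewrite natrM mulrA.
case/andP: p01 => p0 p1.
apply: ler_sum => j _; rewrite -!mulrA; apply: ler_wpM2l; first exact: ler0n.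
rewrite bin_mean_ffact -!mulrA.
have [jn|nj] := leqP j n; last by rewrite ffact_small // !mul0r.
apply: ler_wpM2l; first exact: ler0n.
apply: ler_wpM2l; first exact: exprn_ge0.
have -> : (n - j)%:R * q = bin_mean p (n - j) (fun c => n%:R - (c + j)%:R).
  rewrite (bin_mean_ext p (g := fun c => n%:R - j%:R - c%:R * 1)); last first.
    by move=> c _; rewrite natrD; ring.
  rewrite bin_meanB bin_mean_cst -natrB //.
  case: (n - j)%N => [|k]; first by rewrite /=; ring.
  by rewrite bin_mean_count_mul bin_mean_cst; ring.
apply: bin_mean_jensen => // c hc.
by rewrite subr_ge0 ler_nat; lia.
Qed.


End CentralMoments.

(** * Integer tables comparing partition numbers *)

Section Tables.
Local Open Scope nat_scope.

Definition Nsum (s : seq N) : N := foldr N.add 0%num s.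

(** The tables are computed with binary integers, hence the copies in N of
    the binomial, Stirling and falling factorial numbers. *)
Fixpoint Npascal m : seq N :=
  if m is m'.+1 then
    let r := Npascal m' in
    [seq N.add x.1 x.2 | x <- zip (0%num :: r) (rcons r 0%num)]
  else [:: 1%num].

(** Row j + 1 of the associated Stirling numbers from row j, both indexed by
    the size of the partitioned set. *)
Definition Nassoc_row (r : seq N) : seq N :=
  0%num :: mkseq (fun m => Nsum [seq N.mul x.1 x.2 | x <- zip (take m (Npascal m)) r])
                 (size r).-1.

Fixpoint Nassoc_rows k (r : seq N) : seq (seq N) :=
  if k is k'.+1 then r :: Nassoc_rows k' (Nassoc_row r) else [::].

Fixpoint Nstirling_row m : seq N :=
  if m is m'.+1 then
    let r := Nstirling_row m' in
    0%num :: [seq N.add (N.mul (N.of_nat x.1) x.2.1) x.2.2 |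
           x <- zip (iota 1 m) (zip (rcons (behead r) 0%num) r)]
  else [:: 1%num].

Fixpoint Nffact (n j : nat) : N :=
  if j is j'.+1 then N.mul (N.of_nat n) (Nffact n.-1 j') else 1%num.

Definition assoc_table : seq (seq N) := Nassoc_rows 20 (1%num :: nseq 38 0%num).

Definition Nassoc tab j m : N := nth 0%num (nth [::] tab j) m.

(** For every j, the coefficient of n ^_ j (p (1 - p)) ^ j in the bound on the
    moment of order 2 M against the one in the bound on the moment of the
    variance proxy, the factor 2 ^ (M - j) standing for the powers of 1 - p that
    are missing when p <= 1 / 2. *)
Definition Ncoef_check tab M n : bool :=
  let r := Nstirling_row M in
  all (fun j =>
    N.leb (Nassoc tab j M.*2 * 2 ^ N.of_nat (M - j) * N.of_nat n ^ N.of_nat M.-1 * N.of_nat n.-1)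
          (N.of_nat M ^ N.of_nat M * nth 0%num r j * N.of_nat (n - j) ^ N.of_nat M))%num (iota 1 M).

(** The same moment against the deviation scale, all variances being replaced
    by their largest value 1 / 4; squaring removes the factor sqrt (n / 2). *)
Definition Nsmall_check tab M n : bool :=
  let N4 := 4%num in
  let W := Nsum [seq (Nassoc tab j M.*2 * Nffact n j * 4 ^ N.of_nat (M - j))%num | j <- iota 0 M.+1] in
  let C := Nsum [seq (N.of_nat k ^ N.of_nat (M.*2 - k) * N.of_nat n ^ N.of_nat k * 4 ^ N.of_nat (M - k)
               * (4 * N.of_nat k * N.of_nat n ^ 2 + 96 * N.of_nat k ^ 3))%num | k <- iota 1 M] in
  N.leb (2 * N.of_nat n.-1 ^ 2 * N.of_nat n ^ 3 * (4 * W) ^ 2)%num (C ^ 2)%num.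

Lemma assoc_table_dominated : let tab := assoc_table in all (fun M => Ncoef_check tab M (10 * M - 8)) (iota 2 18).
Proof. vm_cast_no_check (erefl true). Qed.

Lemma assoc_table_small : let tab := assoc_table in
  all (fun M => all (Nsmall_check tab M) (iota 2 (if M < 12 then 10 * M - 10 else M.*2))) (iota 2 18).
Proof. vm_cast_no_check (erefl true). Qed.

Lemma to_nat_add (a b : N) : N.to_nat (N.add a b) = (N.to_nat a + N.to_nat b)%N.
Proof. exact: N2Nat.inj_add. Qed.

Lemma to_nat_mul (a b : N) : N.to_nat (N.mul a b) = (N.to_nat a * N.to_nat b)%N.
Proof. exact: N2Nat.inj_mul. Qed.

Lemma to_nat_le (a b : N) : N.leb a b -> (N.to_nat a <= N.to_nat b)%N.
Proof.
move=> /N.leb_le ab; rewrite -(N.sub_add _ _ ab) to_nat_add; exact: leq_addl.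
Qed.

Lemma to_nat_pow (a : N) k : N.to_nat (N.pow a (N.of_nat k)) = (N.to_nat a ^ k)%N.
Proof.
elim: k => [|k IH]; first by rewrite N.pow_0_r.
by rewrite Nat2N.inj_succ N.pow_succ_r' to_nat_mul IH expnS.
Qed.

Lemma to_nat_Nsum s : N.to_nat (Nsum s) = sumn (map N.to_nat s).
Proof. by elim: s => //= x s IH; rewrite to_nat_add IH. Qed.

Lemma to_nat_Npascal m : map N.to_nat (Npascal m) = mkseq (fun i => 'C(m, i)) m.+1.
Proof.
elim: m => [|m IH] //.
have sz : size (Npascal m) = m.+1 by rewrite -(size_map N.to_nat) IH size_mkseq.
have e i : N.to_nat (nth 0%num (Npascal m) i) = 'C(m, i).
  case: (ltnP i m.+1) => hi; last by rewrite nth_default ?sz // bin_small.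
  by rewrite -(nth_map _ 0%N) ?sz // IH nth_mkseq.
have szS : size (Npascal m.+1) = m.+2 by rewrite size_map size_zip /= size_rcons sz minnn.
apply: (@eq_from_nth _ 0%N) => [|i]; first by rewrite size_map szS size_mkseq.
rewrite size_map szS => hi; rewrite (nth_map 0%num) ?szS // nth_mkseq // [Npascal m.+1]/=.
rewrite (nth_map (0%num, 0%num)) ?size_zip /= ?size_rcons ?sz ?minnn //.
rewrite nth_zip /= ?size_rcons // to_nat_add nth_rcons sz.
rewrite (_ : (if _ then _ else _) = nth 0%num (Npascal m) i); last first.
  by case: ltnP => // h; rewrite nth_default ?sz //; case: eqP.
rewrite e; case: i hi => [|i] hi /=; first by rewrite !bin0.
by rewrite e binS addnC.
Qed.

Lemma to_nat_Nassoc_row j L r : map N.to_nat r = mkseq (assoc_stirling j) L.+1 ->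
  map N.to_nat (Nassoc_row r) = mkseq (assoc_stirling j.+1) L.+1.
Proof.
move=> hr; have sz : size r = L.+1 by rewrite -(size_map N.to_nat) hr size_mkseq.
rewrite /Nassoc_row sz /= -map_comp /mkseq /= (iotaDl 1 0) -map_comp; congr (_ :: _).
apply/eq_in_map => m; rewrite mem_iota add0n => /andP[_ mL] /=.
rewrite to_nat_Nsum sumnE !big_map /=.
have szp : size (Npascal m) = m.+1 by rewrite -(size_map N.to_nat) to_nat_Npascal size_mkseq.
have szt : size (zip (take m (Npascal m)) r) = m.
  by rewrite size_zip size_take szp ltnSn sz (minn_idPl _) //; lia.
rewrite (big_nth (0%num, 0%num)) szt big_mkord; apply: eq_bigr => i _.
have im := ltn_ord i.
have := nth_zip_cond (0%num, 0%num) (take m (Npascal m)) r i; rewrite szt im => -> /=.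
rewrite to_nat_mul nth_take //; congr (_ * _)%N.
  have h : (i < m.+1)%N by lia.
  have := @nth_mkseq nat 0%N (fun i => 'C(m, i)) m.+1 i h.
  by rewrite -to_nat_Npascal (nth_map 0%num) ?szp.
have h : (i < L.+1)%N by lia.
have := @nth_mkseq nat 0%N (assoc_stirling j) L.+1 i h.
by rewrite -hr (nth_map 0%num) ?sz.
Qed.

Lemma to_nat_Nassoc_rows k j a L r : map N.to_nat r = mkseq (assoc_stirling a) L.+1 ->
  (j < k)%N -> map N.to_nat (nth [::] (Nassoc_rows k r) j) = mkseq (assoc_stirling (a + j)) L.+1.
Proof.
elim: k j a r => [|k IH] [|j] a r hr //= jk; first by rewrite addn0.
by rewrite addnS -addSn; apply: IH => //; exact: to_nat_Nassoc_row.
Qed.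

Lemma to_nat_Nassoc j m : (j < 20)%N -> (m < 39)%N ->
  N.to_nat (Nassoc assoc_table j m) = assoc_stirling j m.
Proof.
move=> j20 m39; rewrite /Nassoc /assoc_table.
have h : map N.to_nat (1%num :: nseq 38 0%num) = mkseq (assoc_stirling 0) 39 by [].
have := to_nat_Nassoc_rows h j20; rewrite add0n => e.
have sz : size (nth [::] (Nassoc_rows 20 (1%num :: nseq 38 0%num)) j) = 39.
  by rewrite -(size_map N.to_nat) e size_mkseq.
by rewrite -(nth_map _ 0%N) ?sz // e nth_mkseq.
Qed.

Lemma to_nat_Nstirling_row m : map N.to_nat (Nstirling_row m) = mkseq (stirling2 m) m.+1.
Proof.
elim: m => [|m IH] //.
have sz : size (Nstirling_row m) = m.+1 by rewrite -(size_map N.to_nat) IH size_mkseq.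
have e i : N.to_nat (nth 0%num (Nstirling_row m) i) = stirling2 m i.
  case: (ltnP i m.+1) => hi; last by rewrite nth_default ?sz // stirling2_small.
  by rewrite -(nth_map _ 0%N) ?sz // IH nth_mkseq.
pose T := zip (iota 1 m.+1) (zip (rcons (behead (Nstirling_row m)) 0%num) (Nstirling_row m)).
have szT2 : size (zip (rcons (behead (Nstirling_row m)) 0%num) (Nstirling_row m)) = m.+1.
  by rewrite size_zip size_rcons size_behead sz minnn.
have szT : size T = m.+1 by rewrite /T size_zip size_iota szT2 minnn.
have -> : Nstirling_row m.+1 = 0%num :: [seq N.add (N.mul (N.of_nat x.1) x.2.1) x.2.2 | x <- T] by [].
have -> : mkseq (stirling2 m.+1) m.+2 = 0%N :: [seq stirling2 m.+1 j | j <- iota 1 m.+1] by [].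
rewrite map_cons; congr (_ :: _).
apply: (@eq_from_nth _ 0%N) => [|i]; first by rewrite !size_map szT size_iota.
rewrite !size_map szT => hi; rewrite (nth_map 0%num) ?size_map ?szT //.
rewrite (nth_map (0%N, (0%num, 0%num))) ?szT // (nth_map 0%N) ?size_iota //.
rewrite /T nth_zip ?size_iota ?szT2 // nth_zip ?size_rcons ?size_behead ?sz //.
rewrite [X in N.add (N.mul _ X)](_ : _ = nth 0%num (Nstirling_row m) i.+1); last first.
  rewrite nth_rcons size_behead sz /= nth_behead.
  by case: ltnP => // h; rewrite nth_default ?sz //; case: eqP.
by rewrite to_nat_add to_nat_mul Nat2N.id !e nth_iota.
Qed.

Lemma to_nat_Nffact n j : N.to_nat (Nffact n j) = (n ^_ j)%N.
Proof.
by elim: j n => [|j IH] n //=; rewrite to_nat_mul Nat2N.id IH ffactnS.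
Qed.

Lemma assoc_le_stirling M j (n := (10 * M - 8)%N) : (1 < M < 20)%N -> (0 < j <= M)%N ->
  (assoc_stirling j M.*2 * 2 ^ (M - j) * n ^ M.-1 * n.-1 <=
   M ^ M * stirling2 M j * (n - j) ^ M)%N.
Proof.
move=> hM hj; have /allP/(_ M) := assoc_table_dominated.
rewrite mem_iota => /(_ hM)/allP/(_ j); rewrite mem_iota add1n ltnS => /(_ hj).
move=> /to_nat_le; rewrite !(to_nat_mul, to_nat_pow, Nat2N.id, to_nat_Nassoc); [|lia|lia].
rewrite -(nth_map _ 0%N); last first.
  by rewrite -(size_map N.to_nat) to_nat_Nstirling_row size_mkseq; lia.
by rewrite to_nat_Nstirling_row nth_mkseq //; lia.
Qed.

Lemma assoc_sum_le M n : (1 < M < 20)%N -> (1 < n)%N ->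
  (n < if M < 12 then 10 * M - 8 else M.*2.+2)%N ->
  (2 * n.-1 ^ 2 * n ^ 3 * (4 * \sum_(0 <= j < M.+1) assoc_stirling j M.*2 * n ^_ j * 4 ^ (M - j)) ^ 2 <=
   (\sum_(1 <= k < M.+1) k ^ (M.*2 - k) * n ^ k * 4 ^ (M - k) * (4 * k * n ^ 2 + 96 * k ^ 3)) ^ 2)%N.
Proof.
move=> hM n1 hn; have /allP/(_ M) := assoc_table_small.
rewrite mem_iota => /(_ hM)/allP/(_ n); rewrite mem_iota n1 andTb => /(_ _)/to_nat_le h.
have {}h := h _; move: h; rewrite !(to_nat_mul, (to_nat_pow _ 2), (to_nat_pow _ 3), Nat2N.id, to_nat_Nsum).
rewrite !sumnE !big_map /index_iota subn0 subn1 => h.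
have hr : (n < 2 + (if (M < 12)%N then 10 * M - 10 else M.*2))%N.
  by move: hn; case: ifP => _ hn; lia.
have {h hr} := h hr.
rewrite (eq_big_seq (fun j => assoc_stirling j M.*2 * n ^_ j * 4 ^ (M - j))%N); last first.
  move=> j; rewrite mem_iota => /andP[_ jM].
  by rewrite !(to_nat_mul, to_nat_pow) to_nat_Nassoc ?to_nat_Nffact //; lia.
rewrite [X in (_ <= X ^ 2)%N](eq_big_seq (fun k => k ^ (M.*2 - k) * n ^ k * 4 ^ (M - k) * (4 * k * n ^ 2 + 96 * k ^ 3))%N) //.
move=> j _; rewrite !(to_nat_mul, to_nat_add, to_nat_pow, (to_nat_pow _ 2), (to_nat_pow _ 3)) !Nat2N.id.
by [].
Qed.

End Tables.

(** * Exponential moments and the inequality of McDiarmid *)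

Section Exponential.
Context {R : realType}.
Implicit Types (p t x : R).

(** Elementary inequalities between functions on the half line reduce to
    inequalities between their derivatives. *)
Lemma ge0_of_derive_ge0 (f df : R -> R) :
  (forall x, is_derive x 1 f (df x)) -> 0 <= f 0 -> (forall x, 0 <= x -> 0 <= df x) ->
  forall x, 0 <= x -> 0 <= f x.
Proof.
move=> fdf f0 df0 x x0.
have cf : {within `[0, x], continuous f}.
  apply: continuous_subspaceT => y; apply: differentiable_continuous.
  by apply/derivable1_diffP; case: (fdf y).
have [c] := MVT_segment x0 (fun y _ => fdf y) cf.
rewrite in_itv /= => /andP[c0 _] e.
have : 0 <= f x - f 0 by rewrite e subr0; exact: mulr_ge0 (df0 _ c0) x0.
by lra.
Qed.

(** Hoeffding's lemma for a Bernoulli variable. With A the left-hand side, the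
    derivative of A exp(-t^2/8) has the sign of -D, where D vanishes at 0 and
    D' >= 0 because q u <= (q + u)^2 / 4. Negative t is reduced to positive t by
    exchanging p and 1 - p. *)
Lemma two_point_mgf_le p t : 0 <= p <= 1 ->
  (1 - p) * expR (- (t * p)) + p * expR (t * (1 - p)) <= expR (t ^+ 2 / 8).
Proof.
suff H p' x : 0 <= p' <= 1 -> 0 <= x ->
    (1 - p') * expR (- (x * p')) + p' * expR (x * (1 - p')) <= expR (x ^+ 2 / 8).
  move=> p01; have [t0|t0] := leP 0 t; first exact: H.
  have /andP[p0 p1] := p01.
  rewrite -sqrrN; have h1 : 0 <= 1 - p <= 1 by apply/andP; split; lra.
  apply: le_trans (H (1 - p) (- t) h1 _); last by lra.
  rewrite [leRHS]addrC (_ : - t * (1 - (1 - p)) = - (t * p)); last by ring.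
  by rewrite (_ : - (- t * (1 - p)) = t * (1 - p)) ?subKr //; ring.
move=> {}p01 x0; move: p' p01 => {t} {}p /andP[p0 p1].
pose q := 1 - p.
have qe y : 0 < q + p * expR y.
  have := expR_gt0 y; rewrite /q; have [->|pn] := eqVneq p 0; first by lra.
  have : 0 < p by rewrite lt_neqAle eq_sym pn.
  by nra.
pose D y : R := y / 4 - (q - q / (q + p * expR y)).
have dE (y : R) : is_derive y (1 : R) (fun z : R => q + p * expR z) (p * expR y).
  by apply: is_derive_eq; rewrite ?add0r /= /GRing.scale /= ?mulr0 ?mulr1 ?addr0 ?add0r; ring.
have dV (y : R) : is_derive y (1 : R) (fun z : R => (q + p * expR z)^-1) (- (p * expR y) / (q + p * expR y) ^+ 2).
  have n0 : q + p * expR y != 0 by rewrite gt_eqF ?qe.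
  apply: is_derive_eq.
  by rewrite /GRing.scale /= mulNr mulrC mulNr.
have D0 : forall y, 0 <= y -> 0 <= D y.
  apply: (@ge0_of_derive_ge0 D (fun y => 4^-1 - q * (p * expR y) / (q + p * expR y) ^+ 2)).
  - move=> y; rewrite /D; apply: is_derive_eq.
    by rewrite /GRing.scale /=; ring.
  - rewrite /D expR0 /q (_ : 1 - p + p * 1 = 1 :> R); last by ring.
    by rewrite mul0r; lra.
  - move=> y _; rewrite subr_ge0 ler_pdivrMr; last by rewrite exprn_gt0.
    by have := sqr_ge0 (q - p * expR y); rewrite !expr2; nra.
pose A y := q * expR (- (y * p)) + p * expR (y * q).
pose F y : R := 1 - A y * expR (- (y ^+ 2 / 8)).
suff : 0 <= F x.
  rewrite /F subr_ge0 expRN -/(A x) => h.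
  by move: h; rewrite ler_pdivrMr ?expR_gt0 // mul1r.
pose dF y : R := expR (- (y ^+ 2 / 8)) * (expR (- (y * p)) * (q + p * expR y) * D y).
apply: (@ge0_of_derive_ge0 F dF) => //.
- move=> y; rewrite /F /A; apply: is_derive_eq.
  have e1 : expR (y * q) = expR (- (y * p)) * expR y by rewrite -expRD /q; congr expR; ring.
  rewrite /dF /D /GRing.scale /= !e1.
  have n0 : q + p * expR y != 0 by rewrite gt_eqF ?qe.
  by move: n0; rewrite /q => n0; field.
- by rewrite /F /A !mul0r oppr0 expr0n /= mul0r oppr0 !expR0 /q; lra.
- move=> y y0; rewrite /dF; apply: mulr_ge0; first exact: expR_ge0.
  apply: mulr_ge0; last exact: D0.
  by apply: mulr_ge0; [exact: expR_ge0|exact: ltW].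
Qed.


(** A Poisson-type bound on the same quantity, better than the previous one
    when the variance p (1 - p) is small: the difference vanishes at 0 and its
    derivative is p q (e^(p t) - 1) (e^(q t) - e^(- p t)). *)
Lemma expR_mul_sub_ge0 p t : 0 <= p <= 1 -> 0 <= t ->
  (1 - p) * expR (- (t * p)) + p * expR (t * (1 - p)) <=
  1 + p * (1 - p) * (expR t - 1 - t).
Proof.
move=> p01; pose q := 1 - p.
pose F y : R := 1 + p * q * (expR y - 1 - y) - (q * expR (- (y * p)) + p * expR (y * q)).
pose dF y : R := p * q * ((expR (y * p) - 1) * (expR (y * q) - expR (- (y * p)))).
move: t; suff H t : 0 <= t -> 0 <= F t by move=> t /H; rewrite subr_ge0.
have /andP[p0 p1] := p01; have q0 : 0 <= q by rewrite subr_ge0.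
apply: (@ge0_of_derive_ge0 F dF).
- move=> y; rewrite /F; apply: is_derive_eq.
  have e1 : expR y = expR (y * q) * expR (y * p) by rewrite -expRD /q; congr expR; ring.
  have e2 : expR (y * p) * expR (- (y * p)) = 1 by rewrite -expRD subrr expR0.
  rewrite /dF /GRing.scale /= !e1.
  rewrite [X in _ = _ * X](_ : _ = expR (y * q) * expR (y * p) - expR (y * p) * expR (- (y * p))
    - expR (y * q) + expR (- (y * p))); last by ring.
  by rewrite e2; ring.
- by rewrite /F !mul0r oppr0 !expR0 /q; lra.
- move=> y y0; rewrite /dF; apply: mulr_ge0; first exact: mulr_ge0.
  have yp : 0 <= y * p by exact: mulr_ge0.
  have yq : 0 <= y * q by exact: mulr_ge0.
  apply: mulr_ge0; rewrite subr_ge0; first by rewrite -expR0 ler_expR.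
  by rewrite ler_expR; lra.
Qed.

Section Binomial.
Variables (p : R) (n : nat).
Hypothesis p01 : 0 <= p <= 1.
Local Notation q := (1 - p).

Lemma bin_mean_expR t :
  bin_mean p n (fun c => expR (t * (c%:R - n%:R * p))) =
  (q * expR (- (t * p)) + p * expR (t * q)) ^+ n.
Proof.
elim: n => [|k IH]; first by rewrite /= mul0r subr0 mulr0 expR0 expr0.
rewrite exprS -IH; set B := bin_mean p k _.
transitivity (p * bin_mean p k (fun c => expR (t * (c.+1%:R - k.+1%:R * p))) +
  q * bin_mean p k (fun c => expR (t * (c%:R - k.+1%:R * p)))); first by [].
have -> : bin_mean p k (fun c => expR (t * (c.+1%:R - k.+1%:R * p))) = expR (t * q) * B.
  by rewrite -bin_meanZ; apply: bin_mean_ext => c _; rewrite -expRD; congr expR; rewrite -!natr1; ring.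
have -> : bin_mean p k (fun c => expR (t * (c%:R - k.+1%:R * p))) = expR (- (t * p)) * B.
  by rewrite -bin_meanZ; apply: bin_mean_ext => c _; rewrite -expRD; congr expR; rewrite -!natr1; ring.
by ring.
Qed.

Lemma bin_mean_expR_le_sqr t :
  bin_mean p n (fun c => expR (t * (c%:R - n%:R * p))) <= expR (t ^+ 2 / 8 * n%:R).
Proof.
have /andP[p0 p1] := p01.
rewrite bin_mean_expR expRM_natr; apply: lerXn2r; rewrite ?nnegrE ?expR_ge0 //; last exact: two_point_mgf_le.
by apply: addr_ge0; apply: mulr_ge0; rewrite ?expR_ge0 // subr_ge0.
Qed.

End Binomial.

Lemma bin_mean_expR_le_var p n t : 0 <= p <= 1 -> 0 <= t ->
  bin_mean p n (fun c => expR (t * (c%:R - n%:R * p))) <=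
  expR (n%:R * (p * (1 - p)) * (expR t - 1 - t)).
Proof.
move=> p01 t0; have /andP[p0 p1] := p01.
rewrite bin_mean_expR (_ : n%:R * _ * _ = p * (1 - p) * (expR t - 1 - t) * n%:R); last by ring.
rewrite expRM_natr; apply: lerXn2r; rewrite ?nnegrE ?expR_ge0 //; last first.
  by apply: le_trans (expR_mul_sub_ge0 p01 t0) _; exact: expR_ge1Dx.
by apply: addr_ge0; apply: mulr_ge0; rewrite ?expR_ge0 // subr_ge0.
Qed.

Lemma bin_mean_compl p n (g : nat -> R) :
  bin_mean (1 - p) n g = bin_mean p n (fun c => g (n - c)%N).
Proof.
elim: n g => [|n IH] g //=.
rewrite subKr !IH [LHS]addrC; congr (_ * _ + _ * _).
by apply: bin_mean_ext => c cn; rewrite subSn.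
Qed.

Lemma bin_mean_expRN_le_var p n t : 0 <= p <= 1 -> 0 <= t ->
  bin_mean p n (fun c => expR (- t * (c%:R - n%:R * p))) <=
  expR (n%:R * (p * (1 - p)) * (expR t - 1 - t)).
Proof.
move=> p01 t0; have /andP[p0 p1] := p01.
have q01 : 0 <= 1 - p <= 1 by apply/andP; split; lra.
have := bin_mean_expR_le_var n q01 t0; rewrite bin_mean_compl subKr (mulrC (1 - p)).
apply: le_trans; rewrite le_eqVlt; apply/orP; left; apply/eqP.
by apply: bin_mean_ext => c cn; congr expR; rewrite natrB //; ring.
Qed.

(** Convexity of the exponential: the chord over [0, c], obtained from the
    tangent at the intermediate point. *)
Lemma expR_chord_le t c x : 0 < c -> 0 <= x <= c ->
  expR (t * x) <= 1 - x / c + x / c * expR (t * c).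
Proof.
move=> c0 /andP[x0 xc]; set l := x / c.
have xl : x = l * c by rewrite divfK ?gt_eqF.
have l0 : 0 <= l by rewrite /l divr_ge0 // ltW.
have l1 : l <= 1 by rewrite /l ler_pdivrMr // mul1r.
have e0 := expR_gt0 (t * x).
have h1 : expR (t * x) * (1 - t * x) <= 1.
  have : expR (t * x) * expR (- (t * x)) = 1 by rewrite -expRD subrr expR0.
  by move=> h; rewrite -[leRHS]h ler_pM2l //; exact: expR_ge1Dx.
have h2 : expR (t * x) * (1 + t * (c - x)) <= expR (t * c).
  have -> : expR (t * c) = expR (t * x) * expR (t * (c - x)) by rewrite -expRD; congr expR; ring.
  by rewrite ler_pM2l //; exact: expR_ge1Dx.
have h3 : (1 - l) * (expR (t * x) * (1 - t * x)) <= 1 - l by rewrite ler_piMr // subr_ge0.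
have h4 := ler_wpM2l l0 h2.
apply: le_trans (lerD h3 h4); rewrite le_eqVlt; apply/orP; left; apply/eqP.
by move: (expR (t * x)) => E; rewrite xl; ring.
Qed.

Section Hoeffding.
Context {I : finType} (w : I -> R).
Hypothesis w_ge0 : forall i, 0 <= w i.
Hypothesis w_sum1 : \sum_i w i = 1.

(** Hoeffding's lemma: by convexity the worst variable on an interval of length
    c is supported by its end points. *)
Lemma hoeffding_mgf_le (g : I -> R) c t : 0 < c -> (forall i j, g i - g j <= c) ->
  \sum_i w i * expR (t * (g i - \sum_i w i * g i)) <= expR (t ^+ 2 * c ^+ 2 / 8).
Proof.
move=> c0 gc; set mu := \sum_i w i * g i.
have [i0 _|I0] := pickP I; last first.
  by rewrite big1 ?expR_ge0 // => i; have := I0 i.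
have [k0 _ k0P] := @arg_minP _ R I i0 xpredT g isT.
set a := g k0; set p := (mu - a) / c.
have x01 i : 0 <= g i - a <= c by rewrite subr_ge0 k0P //= gc.
have pE : p = \sum_i w i * ((g i - a) / c).
  have -> : p = (\sum_i w i * (g i - a)) / c.
    by under eq_bigr do rewrite mulrBr; rewrite sumrB -mulr_suml w_sum1 mul1r.
  by rewrite mulr_suml; apply: eq_bigr => i _; rewrite mulrA.
have p01 : 0 <= p <= 1.
  rewrite pE; apply/andP; split.
    by apply: sumr_ge0 => i _; apply: mulr_ge0 => //; case/andP: (x01 i) => *; rewrite divr_ge0 // ltW.
  rewrite -[leRHS]w_sum1; apply: ler_sum => i _; rewrite ler_piMr //.
  by rewrite ler_pdivrMr // mul1r; case/andP: (x01 i).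
apply: le_trans (_ : \sum_i expR (- (t * (mu - a))) * (w i * (1 - (g i - a) / c + (g i - a) / c * expR (t * c))) <= _).
  apply: ler_sum => i _.
  rewrite (_ : t * _ = - (t * (mu - a)) + t * (g i - a)); last by ring.
  rewrite expRD mulrCA ler_wpM2l ?expR_ge0 // ler_wpM2l //.
  exact: expR_chord_le.
rewrite -mulr_sumr.
have -> : \sum_i w i * (1 - (g i - a) / c + (g i - a) / c * expR (t * c)) =
   1 - p + p * expR (t * c).
  rewrite pE -[1 in RHS]w_sum1 mulr_suml -sumrB -big_split; apply: eq_bigr => i _ /=; ring.
have tE : t * (mu - a) = t * c * p by rewrite /p; field; rewrite gt_eqF.
rewrite tE -exprMn; apply: le_trans (two_point_mgf_le (t * c) p01).
rewrite le_eqVlt; apply/orP; left; apply/eqP.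
have -> : expR (t * c * (1 - p)) = expR (- (t * c * p)) * expR (t * c) by rewrite -expRD; congr expR; ring.
by ring.
Qed.

(** Conditioning on the first draw: the conditional mean varies by at most c,
    which is one application of Hoeffding's lemma, and the induction hypothesis
    covers the other draws. *)
Lemma mcdiarmid_mgf_le n (f : seq I -> R) c t : 0 < c ->
  (forall s1 s2 i j, (size s1 + size s2).+1 = n ->
     f (s1 ++ i :: s2) - f (s1 ++ j :: s2) <= c) ->
  iid_mean w n (fun s => expR (t * (f s - iid_mean w n f))) <= expR (t ^+ 2 * c ^+ 2 / 8 * n%:R).
Proof.
move=> c0; elim: n f => [|n IH] f fc; first by rewrite /= subrr !mulr0.
rewrite /=; set g := fun i => iid_mean w n (fun s => f (i :: s)).
set mu := \sum_i w i * g i.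
apply: le_trans (_ : \sum_i w i * (expR (t * (g i - mu)) * expR (t ^+ 2 * c ^+ 2 / 8 * n%:R)) <= _).
  apply: ler_sum => i _; rewrite ler_wpM2l //.
  apply: le_trans (_ : expR (t * (g i - mu)) * iid_mean w n (fun s => expR (t * (f (i :: s) - g i))) <= _).
    rewrite -iid_meanZ; apply: iid_mean_le => // s _.
    by rewrite -expRD ler_expR le_eqVlt; apply/orP; left; apply/eqP; ring.
  rewrite ler_wpM2l ?expR_ge0 //; apply: (IH (fun s => f (i :: s))) => s1 s2 k l hs.
  by apply: (fc (i :: s1)); rewrite /= addSn hs.
under eq_bigr do rewrite mulrA.
rewrite -mulr_suml -[n.+1%:R]natr1 mulrDr mulr1 [leRHS]expRD mulrC ler_wpM2l ?expR_ge0 //.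
apply: hoeffding_mgf_le => // i j; rewrite /g.
rewrite lerBlDr -[c](iid_mean_cst w_sum1 n) -iid_meanD; apply: iid_mean_le => // s hs.
by rewrite -lerBlDr; apply: (fc [::]); rewrite /= hs.
Qed.

Lemma mcdiarmid n (f : seq I -> R) c e : 0 < c -> 0 <= e -> (0 < n)%N ->
  (forall s1 s2 i j, (size s1 + size s2).+1 = n ->
     f (s1 ++ i :: s2) - f (s1 ++ j :: s2) <= c) ->
  iid_prob w n (fun s => f s <= iid_mean w n f - e) <= expR (- (2 * e ^+ 2 / (n%:R * c ^+ 2))).
Proof.
move=> c0 e0 n0 fc; set t := 4 * e / (n%:R * c ^+ 2).
have n0' : 0 < n%:R :> R by rewrite ltr0n.
have t0 : 0 <= t by rewrite /t divr_ge0 ?mulr_ge0 ?ler0n ?exprn_ge0 // ltW.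
have := iid_markov w_ge0 (n := n) (A := fun s => f s <= iid_mean w n f - e)
  (f := fun s => expR (- t * (f s - iid_mean w n f))) (t := expR (t * e)).
move=> /(_ (fun _ _ => expR_ge0 _)) h.
have {}h : expR (t * e) * iid_prob w n (fun s => f s <= iid_mean w n f - e) <=
  expR (t ^+ 2 * c ^+ 2 / 8 * n%:R).
  rewrite -[t ^+ 2]sqrrN; apply: le_trans (mcdiarmid_mgf_le (- t) c0 fc).
  apply: h => s _ hs; rewrite ler_expR mulNr -mulrN; apply: ler_wpM2l => //; lra.
have -> : - (2 * e ^+ 2 / (n%:R * c ^+ 2)) = t ^+ 2 * c ^+ 2 / 8 * n%:R - t * e.
  by rewrite /t; field; rewrite !gt_eqF.
by rewrite expRD expRN ler_pdivlMr ?expR_gt0 // mulrC.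
Qed.

End Hoeffding.

End Exponential.

(** * From exponential moments to central moments *)

Section ExpBounds.
Context {R : realType}.
Implicit Types (x t : R).

(** This bound and the next one are the source of all numerical estimates of
    the exponential. *)
Lemma expR_ge_taylor3 x : 0 <= x -> 1 + x + x ^+ 2 / 2 + x ^+ 3 / 6 <= expR x.
Proof.
have h1 y : (0 : R) <= y -> 0 <= expR y - (1 + y + y ^+ 2 / 2).
  apply: (@ge0_of_derive_ge0 R (fun y => expR y - (1 + y + y ^+ 2 / 2)) (fun y => expR y - (1 + y))).
  - by move=> z; apply: is_derive_eq; rewrite /GRing.scale /=; field.
  - by rewrite expR0; lra.
  - by move=> z _; rewrite subr_ge0 expR_ge1Dx.
move=> x0; rewrite -subr_ge0; move: x x0.
apply: (@ge0_of_derive_ge0 R (fun y => expR y - (1 + y + y ^+ 2 / 2 + y ^+ 3 / 6)) (fun y => expR y - (1 + y + y ^+ 2 / 2))) => //.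
- by move=> z; apply: is_derive_eq; rewrite /GRing.scale /=; field.
- by rewrite expR0; lra.
Qed.

Lemma expRN_ge_taylor3 x : 0 <= x -> 1 - x + x ^+ 2 / 2 - x ^+ 3 / 6 <= expR (- x).
Proof.
have h1 y : (0 : R) <= y -> 0 <= (1 - y + y ^+ 2 / 2) - expR (- y).
  apply: (@ge0_of_derive_ge0 R (fun y => (1 - y + y ^+ 2 / 2) - expR (- y)) (fun y => expR (- y) - (1 - y))).
  - by move=> z; apply: is_derive_eq; rewrite /GRing.scale /=; field.
  - by rewrite oppr0 expR0; lra.
  - by move=> z _; rewrite subr_ge0 expR_ge1Dx.
move=> x0; rewrite -subr_ge0; move: x x0.
apply: (@ge0_of_derive_ge0 R (fun y => expR (- y) - (1 - y + y ^+ 2 / 2 - y ^+ 3 / 6)) (fun y => (1 - y + y ^+ 2 / 2) - expR (- y))) => //.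
- by move=> z; apply: is_derive_eq; rewrite /GRing.scale /=; field.
- by rewrite oppr0 expR0; lra.
Qed.

Lemma expR_le_quad x : 0 <= x <= 36 / 100 -> expR x <= 1 + x + 58 / 100 * x ^+ 2.
Proof.
move=> /andP[x0 x1]; have h := expRN_ge_taylor3 x0.
have e0 : expR x * expR (- x) = 1 by rewrite -expRD subrr expR0.
have p0 := expR_gt0 x.
set A := 1 - x + x ^+ 2 / 2 - x ^+ 3 / 6 in h.
have A0 : 0 < A by rewrite /A; nra.
rewrite -(ler_pM2r A0).
apply: le_trans (_ : 1 <= _); first by rewrite -e0 ler_pM2l.
have -> : (1 + x + 58 / 100 * x ^+ 2) * A = 1 + x ^+ 2 * (8 / 100 - (74 / 300) * x + (37 / 300) * x ^+ 2 - (58/600) * x ^+ 3).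
  by rewrite /A; field.
set B := (X in x ^+ 2 * X).
have B0 : 0 <= B.
  have h2 : 0 <= x ^+ 2 * (36 / 100 - x) by apply: mulr_ge0; [exact: sqr_ge0|lra].
  have h3 := sqr_ge0 (x - 36 / 100).
  by rewrite /B; lra.
have := mulr_ge0 (sqr_ge0 x) B0; move: (x ^+ 2 * B) => ?; lra.
Qed.

Lemma expR1_ge : 27 / 10 <= expR 1 :> R.
Proof.
have h := @expR_ge_taylor3 (4^-1); rewrite (_ : 1 = 4^-1 * 4%:R :> R); last by lra.
rewrite expRM_natr; apply: le_trans (lerXn2r _ _ _ (h _)); rewrite ?nnegrE ?expR_ge0; lra.
Qed.

Lemma expR1_le : expR 1 <= 2721 / 1000 :> R.
Proof.
have h := @expRN_ge_taylor3 (4^-1).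
have e : expR 1 * expR (- (4^-1)) ^+ 4 = 1 :> R.
  by rewrite -expRM_natr -expRD (_ : 1 + _ = 0) ?expR0 //; lra.
have h2 : 1000 / 2721 <= expR (- (4^-1)) ^+ 4 :> R.
  by apply: le_trans (lerXn2r _ _ _ (h _)); rewrite ?nnegrE ?expR_ge0; lra.
have p0 := expR_gt0 (1 : R).
by nra.
Qed.

(** The maximum of z ^ k e^(- t z) is attained at z = k / t. *)
Lemma exprn_le_expR (k : nat) (t z : R) : (0 < k)%N -> 0 < t -> 0 <= z ->
  z ^+ k <= (k%:R / t) ^+ k * expR (t * z - k%:R).
Proof.
move=> k0 t0 z0; have k0' : 0 < k%:R :> R by rewrite ltr0n.
have -> : t * z - k%:R = (t * z / k%:R - 1) * k%:R by field; rewrite gt_eqF.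
rewrite expRM_natr -exprMn; apply: lerXn2r; rewrite ?nnegrE //.
  by apply: mulr_ge0; rewrite ?expR_ge0 // divr_ge0 // ltW.
have h := expR_ge1Dx (t * z / k%:R - 1).
rewrite addrC subrK in h.
rewrite [leLHS](_ : z = k%:R / t * (t * z / k%:R)); last by field; rewrite !gt_eqF.
by rewrite ler_wpM2l // ltW // divr_gt0.
Qed.

End ExpBounds.

Section MomentExp.
Context {R : realType}.
Variables (p : R).
Hypothesis p01 : 0 <= p <= 1.
Local Notation q := (1 - p).

Lemma exprS_sub_le (a b z : R) k : a = b + 1 -> `|a| <= z -> `|b| <= z ->
  a ^+ k.+1 - b ^+ k.+1 <= k.+1%:R * z ^+ k.
Proof.
move=> ab az bz; rewrite subrXX (_ : a - b = 1) ?mul1r; last by rewrite ab; lra.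
apply: le_trans (_ : \sum_(i < k.+1) z ^+ k <= _); last first.
  by rewrite sumr_const card_ord mulr_natl.
apply: ler_sum => i _; apply: le_trans (ler_norm _) _.
rewrite normrM !normrX -[X in _ <= z ^+ X](subnK (ltn_ord i : (i <= k)%N)) exprD.
apply: ler_pM; rewrite ?exprn_ge0 //; apply: lerXn2r; rewrite ?nnegrE //;
  exact: le_trans (normr_ge0 _) az.
Qed.

(** Stein's identity keeps the factor n p (1 - p), which an exponential moment
    alone would lose: the discrete derivative of y ^ (2 N + 1) is at most
    (2 N + 1) (|y| + 1) ^ (2 N), and only this power is bounded by an
    exponential. *)
Lemma bin_moment_le_mgf n N (t Psi : R) : (0 < N)%N -> 0 < t ->
  bin_mean p n (fun c => expR (t * (c%:R - n%:R * p))) <= Psi ->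
  bin_mean p n (fun c => expR (- t * (c%:R - n%:R * p))) <= Psi ->
  bin_mean p n.+1 (fun c => (c%:R - n.+1%:R * p) ^+ N.*2.+2) <=
  n.+1%:R * (p * q) * (N.*2.+1%:R * ((N.*2%:R / t) ^+ N.*2 * expR (t - N.*2%:R) * (2 * Psi))).
Proof.
move=> N0 t0 h1 h2; have /andP[p0 p1] := p01.
under bin_mean_ext do rewrite exprS.
rewrite bin_mean_stein; apply: ler_wpM2l.
  by rewrite mulr_ge0 ?ler0n // mulr_ge0 // subr_ge0.
set D := (N.*2%:R / t) ^+ N.*2 * expR (t - N.*2%:R).
have D0 : 0 <= D by rewrite mulr_ge0 ?expR_ge0 // exprn_ge0 // divr_ge0 ?ler0n // ltW.
apply: le_trans (_ : bin_mean p n (fun c => N.*2.+1%:R * (D * (expR (t * (c%:R - n%:R * p))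
   + expR (- t * (c%:R - n%:R * p))))) <= _); last first.
  rewrite bin_meanZ bin_meanZ bin_meanD !ler_wpM2l ?ler0n //; lra.
apply: bin_mean_le => // c _; set y : R := c%:R - n%:R * p.
have -> : c.+1%:R - n.+1%:R * p = y + q by rewrite /y -!natr1; ring.
have -> : c%:R - n.+1%:R * p = y - p by rewrite /y -!natr1; ring.
apply: le_trans (@exprS_sub_le _ _ (`|y| + 1) _ _ _ _) _; first by ring.
- by apply: le_trans (ler_normD _ _) _; rewrite lerD2l ger0_norm; lra.
- by apply: le_trans (ler_normB _ _) _; rewrite lerD2l ger0_norm; lra.
rewrite ler_wpM2l ?ler0n //.
apply: le_trans (exprn_le_expR (k := N.*2) _ t0 _) _; first by rewrite double_gt0.
  by rewrite addr_ge0.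
rewrite /D -mulrA ler_wpM2l; last 1 first.
- rewrite (_ : t * _ - _ = (t - N.*2%:R) + t * `|y|) ?expRD ?ler_wpM2l ?expR_ge0 //; last by ring.
  have := expR_ge0 (t * y); have := expR_ge0 (- t * y).
  by case: (ger0P y) => y0 h3 h4; rewrite ?mulrN -?mulNr; lra.
- by [].
- by rewrite exprn_ge0 // divr_ge0 ?ler0n // ltW.
Qed.

End MomentExp.

(** * The deviation scale *)

Section DevCoef.
Context {R : realType}.

Definition dev_coef_term (n m k : nat) : R :=
  k%:R ^+ (m - k) * n%:R ^+ k *
    (k%:R / (n%:R * 4 ^+ (k - 1))
     + 3 * k%:R ^+ 3 / (n%:R ^+ 3 * 2 ^ (2 * k%:Z - 5))).

(** The sum that multiplies the square root in epsilon. *)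
Definition dev_coef (n m : nat) : R :=
  \sum_(1 <= k < (m %/ 2).+1) dev_coef_term n m k.

(** The value of epsilon when log (1 / delta2) = 1. *)
Definition dev_scale (n m : nat) : R := Num.sqrt (n%:R / 2) * dev_coef n m.

Lemma exprz_2k5 k : (2 : R) ^ (2 * k%:Z - 5) = 4 ^+ k / 32.
Proof.
have -> : 2 * k%:Z - 5 = (2 * k)%N%:Z - 5%N%:Z :> int by rewrite PoszM.
rewrite expfzDr ?pnatr_eq0 // -exprnN -exprnP exprM.
by congr (_ ^+ k / _); [rewrite expr2; lra|rewrite !exprS expr0; lra].
Qed.

Lemma dev_coef_termE n m k : (0 < k)%N -> (0 < n)%N ->
  dev_coef_term n m k =
  k%:R ^+ (m - k) * n%:R ^+ k * (4 * k%:R * n%:R ^+ 2 + 96 * k%:R ^+ 3) / (4 ^+ k * n%:R ^+ 3).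
Proof.
case: k => // k _ n0; rewrite /dev_coef_term exprz_2k5 subn1 /= [4 ^+ k.+1]exprS.
have nn : n%:R != 0 :> R by rewrite pnatr_eq0 -lt0n.
have h4 : (4 : R) ^+ k != 0 by rewrite expf_neq0 // pnatr_eq0.
move: (k.+1%:R ^+ _) (n%:R ^+ k.+1) (4 ^+ k) h4 => A B F hF.
by field; rewrite hF nn.
Qed.

Lemma dev_coef_term_ge0 n m k : (0 < k)%N -> (0 < n)%N -> 0 <= dev_coef_term n m k.
Proof.
by move=> k0 n0; rewrite dev_coef_termE.
Qed.

Lemma dev_coef_ge0 n m : (0 < n)%N -> 0 <= dev_coef n m.
Proof.
move=> n0; rewrite /dev_coef big_nat_cond; apply: sumr_ge0 => k.
by rewrite andbT => /andP[k0 _]; exact: dev_coef_term_ge0.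
Qed.

(** The term with the largest index k = m / 2 is all that high moments need. *)
Lemma dev_scale_ge n N : (0 < n)%N ->
  Num.sqrt (n%:R / 2) * (N.+1%:R ^+ N.+2 * n%:R ^+ N / 4 ^+ N) <= dev_scale n N.*2.+2.
Proof.
move=> n0; rewrite /dev_scale ler_wpM2l ?sqrtr_ge0 // /dev_coef.
have -> : (N.*2.+2 %/ 2 = N.+1)%N by rewrite -doubleS -muln2 mulnK.
rewrite big_nat_recr //= -[leLHS]add0r; apply: lerD.
  rewrite big_nat_cond; apply: sumr_ge0 => k; rewrite andbT => /andP[k0 _].
  exact: dev_coef_term_ge0.
rewrite dev_coef_termE // (_ : (N.*2.+2 - N.+1 = N.+1)%N); last by lia.
have nn : n%:R != 0 :> R by rewrite pnatr_eq0 -lt0n.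
have h4 : (4 : R) ^+ N != 0 by rewrite expf_neq0 // pnatr_eq0.
rewrite [leRHS](_ : _ = N.+1%:R ^+ N.+2 * n%:R ^+ N / 4 ^+ N + N.+1%:R ^+ N.+1 * n%:R ^+ N * (96 * N.+1%:R ^+ 3) / (4 * 4 ^+ N * n%:R ^+ 2)).
  by rewrite lerDl divr_ge0 // !mulr_ge0 ?exprn_ge0 ?ler0n.
rewrite !exprS; move: (4 ^+ N) h4 (N.+1%:R ^+ N) (n%:R ^+ N) => F hF K L.
by field; rewrite hF nn.
Qed.

Lemma half_expn_le N : (0 < N)%N -> 2 * N%:R ^+ N <= N.+1%:R ^+ N :> R.
Proof.
move=> N0; have n0 : N%:R != 0 :> R by rewrite pnatr_eq0 -lt0n.
have h := @exprn_tangent_le R N%:R N.+1%:R N.-1 (ler0n _ _) (ler0n _ _).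
rewrite prednK // in h; apply: le_trans h.
rewrite -[N.+1%:R]natr1 addrAC subrr add0r mulr1 -exprS prednK //; lra.
Qed.

End DevCoef.

(** * Central moments of high order *)

Section LargeMoments.
Context {R : realType}.
Variables (p : R).
Hypothesis p01 : 0 <= p <= 1.
Local Notation q := (1 - p).
Local Notation mom n k := (bin_mean p n (fun c => (c%:R - n%:R * p) ^+ k)).

Let v_ge0 : 0 <= p * q.
Proof. by have /andP[p0 p1] := p01; rewrite mulr_ge0 // subr_ge0. Qed.

Lemma le_of_eq (x y : R) : x = y -> x <= y.
Proof. by move=> ->. Qed.

Lemma le_sqrt_mul (x y a : R) : 0 <= x -> 0 <= y -> 0 <= a ->
  x ^+ 2 <= a * y ^+ 2 -> x <= Num.sqrt a * y.
Proof.
move=> x0 y0 a0 h; rewrite -(ler_pXn2r (n := 2)) ?nnegrE ?mulr_ge0 ?sqrtr_ge0 //.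
by rewrite exprMn sqr_sqrtr.
Qed.

Lemma bin_mean_sqr n : bin_mean p n (fun c => (c%:R - n%:R * p) ^+ 2) = n%:R * (p * q).
Proof.
case: n => [|n]; first by rewrite /= mul0r subr0 expr0n mul0r.
rewrite bin_mean_stein (bin_mean_ext _ (g := fun=> 1)) ?bin_mean_cst ?mulr1 //.
by move=> c _; rewrite -natr1; ring.
Qed.

(** Few observations: |x| <= n, and the variance supplies the factor
    p (1 - p). *)
Lemma bin_moment_le_tiny n N : (0 < n)%N -> (4 * n <= N.+1)%N ->
  mom n N.*2.+2 <= p * q * dev_scale n N.*2.+2.
Proof.
move=> n0 nN; have /andP[p0 p1] := p01.
have n0' : 1 <= n%:R :> R by rewrite ler1n.
apply: le_trans (_ : bin_mean p n (fun c => n%:R ^+ N.*2 * (c%:R - n%:R * p) ^+ 2) <= _).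
  apply: bin_mean_le => // c cn; rewrite -[N.*2.+2]addn2 exprD.
  rewrite ler_wpM2r ?sqr_ge0 // -[N.*2]mul2n !exprM; apply: lerXn2r; rewrite ?nnegrE ?sqr_ge0 //.
  have : c%:R <= n%:R :> R by rewrite ler_nat.
  have := ler0n R c; have := ler_wpM2l (ler0n R n) p1; have := mulr_ge0 (ler0n R n) p0.
  by rewrite !expr2 => *; nra.
rewrite bin_meanZ bin_mean_sqr mulrCA mulrA mulrC ler_wpM2l //.
apply: le_trans (dev_scale_ge N n0).
apply: le_trans (_ : 2^-1 * (16 * n%:R ^+ 2 * (n%:R ^+ N * n%:R ^+ N)) <= _).
  rewrite -exprD addnn; have : 0 <= n%:R ^+ N.*2 :> R by rewrite exprn_ge0.
  by move: (n%:R ^+ N.*2) => Y Y0; rewrite expr2; have := ler_wpM2r Y0 n0'; nra.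
apply: ler_pM => //.
- rewrite -[leRHS]mulr1; apply: le_sqrt_mul; rewrite ?divr_ge0 ?invr_ge0 // expr1n !expr2; lra.
have h4 : 4 * n%:R <= N.+1%:R :> R by rewrite -natrM ler_nat.
rewrite -[N.+2]addn2 exprD ler_pdivlMr ?exprn_gt0 //.
rewrite (_ : _ * _ = (4 * n%:R) ^+ N * (4 * n%:R) ^+ 2 * n%:R ^+ N); last first.
  by rewrite !exprMn; move: (n%:R ^+ N) (4 ^+ N) => Y F; ring.
rewrite ler_wpM2r ?exprn_ge0 //; apply: ler_pM; rewrite ?exprn_ge0 ?mulr_ge0 //;
  by apply: lerXn2r; rewrite ?nnegrE ?mulr_ge0.
Qed.

(** [bin_moment_le_mgf] with the Gaussian bound on the exponential moments and
    the optimal t = sqrt (8 N / n). The square root of n / 2 in the scale makes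
    it natural to compare squares, and (2 / e)^2 <= 11 / 20. *)
Lemma bin_moment_le_sqr_mgf n N : (0 < n)%N -> (0 < N)%N ->
  8 * n%:R * expR (2 * Num.sqrt (8 * N%:R / n%:R)) * (11 / 20) ^+ N <= N.+1%:R ^+ 2 :> R ->
  mom n N.*2.+2 <= p * q * dev_scale n N.*2.+2.
Proof.
case: n => // n _ N0; set t := Num.sqrt _ => h; have hN2 : (N.*2.+1 <= 2 * N.+1)%N by rewrite mul2n doubleS.
 have /andP[p0 p1] := p01.
have n0 : 0 < n.+1%:R :> R by rewrite ltr0n.
have N0' : 0 < N%:R :> R by rewrite ltr0n.
have t2 : t ^+ 2 = 8 * N%:R / n.+1%:R by rewrite sqr_sqrtr // divr_ge0 // mulr_ge0.
have t0 : 0 < t by rewrite sqrtr_gt0 divr_gt0 // mulr_gt0.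
have hPsi (s : R) : s ^+ 2 = t ^+ 2 -> bin_mean p n (fun c => expR (s * (c%:R - n%:R * p))) <= expR 1 ^+ N.
  move=> s2; apply: le_trans (bin_mean_expR_le_sqr n p01 s) _.
  rewrite -expRM_natr mul1r ler_expR s2 t2 -[n.+1%:R]natr1.
  rewrite [leLHS](_ : _ = N%:R * (n%:R / (n%:R + 1))); last by field; rewrite natr1 pnatr_eq0.
  by rewrite ler_piMr // ler_pdivrMr natr1 // mul1r ler_nat.
apply: le_trans (bin_moment_le_mgf p01 N0 t0 (hPsi t _) (hPsi (- t) _)) _ => //.
  by rewrite sqrrN.
rewrite [n.+1%:R * _]mulrC -[leLHS]mulrA ler_wpM2l //.
apply: le_trans (dev_scale_ge N (ltn0Sn n)).
have e2 : expR (t - N.*2%:R) = expR t / (expR 1 ^+ N * expR 1 ^+ N).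
  by rewrite -exprD addnn -expRM_natr mul1r expRD expRN.
have k2 : (N.*2%:R / t) ^+ N.*2 = N%:R ^+ N * n.+1%:R ^+ N / 2 ^+ N.
  rewrite -[N.*2 in X in _ ^+ X]mul2n exprM -exprMn -expr_div_n; congr (_ ^+ N).
  by rewrite expr_div_n t2 -muln2 natrM; field; rewrite !gt_eqF.
rewrite k2 e2.
set Q : R := (2 / expR 1) ^+ N.
have Q0 : 0 <= Q by rewrite exprn_ge0 // divr_ge0 ?expR_ge0.
have E0 : 0 < expR 1 ^+ N :> R by rewrite exprn_gt0 // expR_gt0.
have Q2 : Q ^+ 2 <= (11 / 20) ^+ N.
  rewrite /Q -exprM mulnC exprM; apply: lerXn2r; rewrite ?nnegrE ?sqr_ge0 //.
  rewrite expr_div_n ler_pdivrMr ?exprn_gt0 ?expR_gt0 //.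
  by have := @expR1_ge R; rewrite !expr2; nra.
have hN := @half_expn_le R N N0.
set M : R := N.+1%:R in h hN *.
have M0 : 0 < M by rewrite ltr0n.
have F0 : 0 < (2 : R) ^+ N by rewrite exprn_gt0.
apply: le_trans (_ : n.+1%:R * (2 * M) * expR t * Q * M ^+ N * n.+1%:R ^+ N / 4 ^+ N <= _).
  rewrite [leLHS](_ : _ = n.+1%:R * N.*2.+1%:R * expR t * Q * (2 * N%:R ^+ N) * n.+1%:R ^+ N / 4 ^+ N); last first.
    rewrite /Q expr_div_n (_ : (4 : R) ^+ N = 2 ^+ N * 2 ^+ N); last by rewrite -exprMn; congr (_ ^+ N); lra.
    move: (expR 1 ^+ N) E0 (2 ^+ N) F0 (expR t) (N%:R ^+ N) (n.+1%:R ^+ N) => E E0 F F0 T K L.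
    by field; rewrite !gt_eqF.
  rewrite !ler_wpM2r ?invr_ge0 ?exprn_ge0 ?ler0n //.
  apply: ler_pM => //; rewrite ?mulr_ge0 ?exprn_ge0 ?expR_ge0 //.
  apply: ler_wpM2r; first exact: Q0.
  apply: ler_wpM2r; first exact: expR_ge0.
  apply: ler_wpM2l; first exact: ler0n.
  by rewrite /M -natrM ler_nat.
set Z := M ^+ N * n.+1%:R ^+ N / 4 ^+ N.
have Z0 : 0 <= Z by rewrite divr_ge0 // mulr_ge0 // exprn_ge0 // ltW.
rewrite [leLHS](_ : _ = n.+1%:R * (2 * M) * expR t * Q * Z); last by rewrite /Z !mulrA.
rewrite [leRHS](_ : _ = Num.sqrt (n.+1%:R / 2) * M ^+ 2 * Z); last first.
  by rewrite /Z -[N.+2]addn2 exprD; move: (M ^+ N) (n.+1%:R ^+ N) ((4 ^+ N)^-1) => ? ? ?; ring.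
apply: ler_wpM2r => //; apply: le_sqrt_mul; rewrite ?sqr_ge0 ?divr_ge0 //.
  by rewrite !mulr_ge0 ?expR_ge0 // ltW.
rewrite [2 * t]mulrC expRM_natr in h.
have h1 : 8 * n.+1%:R * expR t ^+ 2 * Q ^+ 2 <= M ^+ 2.
  by apply: le_trans h; rewrite ler_wpM2l // !mulr_ge0 ?sqr_ge0.
have nM : 0 <= n.+1%:R / 2 * M ^+ 2 :> R by rewrite mulr_ge0 ?sqr_ge0 // divr_ge0.
apply: (le_trans _ (le_trans (ler_wpM2l nM h1) _)); apply: le_of_eq.
  by field.
by field.
Qed.


Lemma bin_mean_expR_var_le n (t : R) (s : R) : (s == t) || (s == - t) -> 0 <= t <= 36 / 100 ->
  bin_mean p n (fun c => expR (s * (c%:R - n%:R * p))) <= expR (n.+1%:R * (p * q) * (58 / 100 * t ^+ 2)).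
Proof.
move=> st t01; have /andP[t0 t1] := t01.
apply: le_trans (_ : _ <= expR (n%:R * (p * q) * (expR t - 1 - t))) _.
  by case/orP: st => /eqP->; [exact: bin_mean_expR_le_var|exact: bin_mean_expRN_le_var].
rewrite ler_expR; apply: ler_pM; rewrite ?(mulr_ge0 (ler0n _ _) v_ge0) //.
- by have := expR_ge1Dx t; lra.
- by rewrite ler_wpM2r // ler_nat.
- by have := expR_le_quad t01; lra.
Qed.

(** [bin_moment_le_mgf] with the Poisson-type bound on the exponential moments,
    for small t: then e^t - 1 - t <= 0.58 t^2 and 2 e^t <= 3. *)
Lemma bin_moment_le_var_mgf n N (t l : R) : (0 < N)%N -> 0 < t <= 36 / 100 ->
  l = n.+1%:R * (p * q) ->
  mom n.+1 N.*2.+2 <= l * (N.+1%:R * (6 * ((N.*2%:R / t) ^+ N.*2 *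
     expR (58 / 100 * (l * t ^+ 2) - N.*2%:R)))).
Proof.
move=> N0 /andP[t0 t1] lE; have t01 : 0 <= t <= 36 / 100 by rewrite ltW.
apply: le_trans (bin_moment_le_mgf p01 N0 t0 (bin_mean_expR_var_le n _ t01) (bin_mean_expR_var_le n _ t01)) _; rewrite ?eqxx ?orbT //.
rewrite -lE ler_wpM2l ?lE ?(mulr_ge0 (ler0n _ _) v_ge0) // -lE.
set A := (N.*2%:R / t) ^+ N.*2.
have A0 : 0 <= A by rewrite exprn_ge0 // divr_ge0 // ltW.
have -> : expR (58 / 100 * (l * t ^+ 2) - N.*2%:R) = expR (l * (58 / 100 * t ^+ 2)) * expR (- N.*2%:R).
  by rewrite -expRD mulrCA.
rewrite expRD.
have ht : expR t <= 3 / 2.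
  apply: le_trans (expR_le_quad t01) _.
  have : t ^+ 2 <= 36 / 100 * t by rewrite expr2 ler_wpM2r // ltW.
  by lra.
set E := expR (l * _); set G := expR (- _).
apply: le_trans (_ : (2 * N.+1%:R) * (A * (3 / 2 * G) * (2 * E)) <= _).
  apply: ler_pM; rewrite ?mulr_ge0 ?expR_ge0 //; first by rewrite -natrM ler_nat mul2n doubleS.
  apply: ler_wpM2r; first by rewrite mulr_ge0 ?expR_ge0.
  apply: ler_wpM2l; first exact: A0.
  by apply: ler_wpM2r; first exact: expR_ge0.
by apply: le_of_eq; field.
Qed.

End LargeMoments.

Section Numeric.
Context {R : realType}.

Lemma exprn_le_exprn (a b : R) k N : 0 <= a <= 1 -> (k <= N)%N -> a ^+ k <= b -> a ^+ N <= b.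
Proof.
by move=> /andP[a0 a1] kN; apply: le_trans; apply: ler_wiXn2l.
Qed.

Lemma exprM2_le (a b : R) k : 0 <= a -> a ^+ 2 <= b -> a ^+ (2 * k) <= b ^+ k.
Proof.
by move=> a0 ab; rewrite exprM; apply: lerXn2r => //; rewrite nnegrE ?sqr_ge0 // (le_trans _ ab) ?sqr_ge0.
Qed.

Lemma pow87_16 : (87 / 100 : R) ^+ 16 <= 116 / 1000.
Proof.
apply: le_trans (exprM2_le 8 (b := 76 / 100) _ _) _; [lra|lra|].
apply: le_trans (exprM2_le 4 (b := 58 / 100) _ _) _; [lra|lra|].
apply: le_trans (exprM2_le 2 (b := 34 / 100) _ _) _; [lra|lra|].
by rewrite expr2; lra.
Qed.

Lemma expRN84_le : 2 * expR (- (84 / 100)) <= 87 / 100 :> R.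
Proof.
have h := @expR_ge_taylor3 R (21 / 100).
have e : expR (- (84 / 100)) * expR (21 / 100) ^+ 4 = 1 :> R.
  by rewrite -expRM_natr -expRD (_ : - _ + _ = 0) ?expR0 //; lra.
have h2 : 23 / 10 <= expR (21 / 100) ^+ 4 :> R.
  by apply: le_trans (lerXn2r _ _ _ (h _)); rewrite ?nnegrE ?expR_ge0; lra.
have p0 := expR_gt0 (- (84 / 100) : R).
move: (expR (21 / 100) ^+ 4) e h2 p0 => X; move: (expR _) => Y *.
have : (X - 23 / 10) * Y >= 0 by rewrite mulr_ge0 //; lra.
by lra.
Qed.

Lemma expRN7_le : expR (- (7 / 10)) <= 2^-1 :> R.
Proof.
have h := @expR_ge_taylor3 R (35 / 100).
have e : expR (- (7 / 10)) * expR (35 / 100) ^+ 2 = 1 :> R.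
  by rewrite -expRM_natr -expRD (_ : - _ + _ = 0) ?expR0 //; lra.
have h2 : 2 <= expR (35 / 100) ^+ 2 :> R.
  by apply: le_trans (lerXn2r _ _ _ (h _)); rewrite ?nnegrE ?expR_ge0; lra.
have p0 := expR_gt0 (- (7 / 10) : R).
move: (expR (35 / 100) ^+ 2) e h2 p0 => X; move: (expR _) => Y *.
have : (X - 2) * Y >= 0 by rewrite mulr_ge0 //; lra.
by lra.
Qed.

End Numeric.

Section LargeMoments.
Context {R : realType}.
Variables (p : R).
Hypothesis p01 : 0 <= p <= 1.
Local Notation q := (1 - p).
Local Notation mom n k := (bin_mean p n (fun c => (c%:R - n%:R * p) ^+ k)).

(** For c successes in n trials, c (n - c) / n is the empirical counterpart of
    n p (1 - p), and the moments of c (n - c) are what the empirical sum of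
    order m controls. *)
Definition var_moment n M := bin_mean p n (fun c => (c%:R * (n%:R - c%:R)) ^+ M).

Let v_ge0 : 0 <= p * q.
Proof. by have /andP[p0 p1] := p01; rewrite mulr_ge0 // subr_ge0. Qed.

(** Jensen's inequality, E c (n - c) being n (n - 1) p (1 - p). *)
Lemma var_moment_ge n M : (n%:R * (n%:R - 1) * (p * q)) ^+ M <= var_moment n M.
Proof.
have /andP[p0 p1] := p01.
case: n => [|n].
  by rewrite /var_moment /= !mul0r.
have e : n.+1%:R * (n.+1%:R - 1) * (p * q) = bin_mean p n.+1 (fun c => c%:R * (n.+1%:R - c%:R)).
  have e2 : bin_mean p n (fun c => n.+1%:R - c.+1%:R) = n%:R * q.
    rewrite (bin_mean_ext p (g := fun c => n%:R - c%:R * 1)); last first.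
      by move=> c _; rewrite -!natr1; ring.
    rewrite bin_meanB bin_mean_cst.
    case: (n) => [|k]; first by rewrite /=; ring.
    by rewrite bin_mean_count_mul bin_mean_cst -!natr1; ring.
  by rewrite bin_mean_count_mul e2 -!natr1; ring.
rewrite e; apply: bin_mean_jensen => // c cn.
by rewrite mulr_ge0 // subr_ge0 ler_nat.
Qed.

(** Large variance l = n p (1 - p): with t = sqrt (2 N / l) the moment is at
    most a quantity of order (2 e^(-0.84))^N times M^M l^M, where M = N + 1, and
    Jensen's inequality bounds the variance moment below by nearly l^M. *)
Lemma bin_moment_le_var n N : (16 <= N)%N -> (128 * N.+1 <= n.+1)%N ->
  16 * N.+1%:R <= n.+1%:R * (p * q) ->
  mom n.+1 N.*2.+2 <= 2^-1 * (N.+1%:R ^+ N.+1 / n.+1%:R ^+ N.+1 * var_moment n.+1 N.+1).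
Proof.
move=> N16 nN; set l : R := _ * (p * q) => hl.
have N0 : (0 < N)%N by lia.
have N0' : 0 < N%:R :> R by rewrite ltr0n.
have M0 : 0 < N.+1%:R :> R by rewrite ltr0n.
have n0 : 0 < n.+1%:R :> R by rewrite ltr0n.
have l0 : 0 < l by lra.
set t : R := Num.sqrt (N.*2%:R / l).
have k0 : 0 < N.*2%:R :> R by rewrite ltr0n double_gt0.
have t2 : t ^+ 2 = N.*2%:R / l by rewrite sqr_sqrtr // divr_ge0 // ltW.
have t0 : 0 < t by rewrite sqrtr_gt0 divr_gt0.
have kM : N.*2%:R <= 2 * N.+1%:R :> R by rewrite -natrM ler_nat mul2n leq_double.
have t1 : t <= 36 / 100.
  rewrite -(ler_pXn2r (n := 2)) ?nnegrE ?(ltW t0) //.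
  by rewrite t2 ler_pdivrMr // expr2; lra.
have t01 : 0 < t <= 36 / 100 by rewrite t0.
apply: le_trans (bin_moment_le_var_mgf p01 N0 t01 (erefl l)) _.
have -> : 58 / 100 * (l * t ^+ 2) - N.*2%:R = (- (84 / 100)) * N%:R.
  by rewrite t2 -muln2 natrM; field; rewrite gt_eqF.
have -> : (N.*2%:R / t) ^+ N.*2 = 2 ^+ N * N%:R ^+ N * l ^+ N.
  rewrite -[N.*2 in X in _ ^+ X]mul2n exprM -!exprMn; congr (_ ^+ N).
  by rewrite expr_div_n t2 -muln2 natrM; field; rewrite !gt_eqF.
rewrite expRM_natr.
have hE : 2 ^+ N * expR (- (84 / 100)) ^+ N <= 116 / 1000 :> R.
  rewrite -exprMn; apply: le_trans (_ : (87 / 100) ^+ N <= _).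
    by apply: lerXn2r expRN84_le; rewrite nnegrE ?mulr_ge0 ?expR_ge0.
  by apply: exprn_le_exprn N16 pow87_16; apply/andP; split; lra.
have hN := @half_expn_le R N N0.
have hV := var_moment_ge n.+1 N.+1.
have hn : 1 - N.+1%:R / n.+1%:R <= (1 - 1 / n.+1%:R : R) ^+ N.+1.
  have := @exprn_tangent_le R 1 (1 - 1 / n.+1%:R) N ler01.
  rewrite !expr1n mulr1 addrAC subrr add0r mulrN mul1r; apply.
  by rewrite subr_ge0 invf_le1 // ler1n.
have hn2 : N.+1%:R / n.+1%:R <= 1 / 128 :> R.
  have n1 : 128 * N.+1%:R <= n.+1%:R :> R by rewrite -natrM ler_nat.
  by rewrite ler_pdivrMr //; lra.
apply: le_trans (_ : 2^-1 * (N.+1%:R ^+ N.+1 / n.+1%:R ^+ N.+1 * ((n.+1%:R * (n.+1%:R - 1) * (p * q)) ^+ N.+1)) <= _); last first.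
  by rewrite !ler_wpM2l ?invr_ge0 // divr_ge0 ?exprn_ge0.
have -> : N.+1%:R ^+ N.+1 / n.+1%:R ^+ N.+1 * (n.+1%:R * (n.+1%:R - 1) * (p * q)) ^+ N.+1 =
  N.+1%:R ^+ N.+1 * l ^+ N.+1 * (1 - 1 / n.+1%:R) ^+ N.+1.
  rewrite -expr_div_n -!exprMn; congr (_ ^+ N.+1).
  by rewrite /l; field; rewrite gt_eqF.
apply: le_trans (_ : l * (N.+1%:R * (6 * (2 ^+ N * expR (- (84 / 100)) ^+ N) * (2^-1 * N.+1%:R ^+ N) * l ^+ N)) <= _).
  rewrite ler_pM2l // ler_pM2l //.
  rewrite [leLHS](_ : _ = 6 * (2 ^+ N * expR (- (84 / 100)) ^+ N) * N%:R ^+ N * l ^+ N); last first.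
    by move: (2 ^+ N) (N%:R ^+ N) (l ^+ N) (expR _ ^+ N) => *; ring.
  rewrite ler_pM2r ?exprn_gt0 //; apply: ler_wpM2l.
    by apply: mulr_ge0 => //; apply: mulr_ge0; rewrite exprn_ge0 ?expR_ge0.
  move: hN; move: (N%:R ^+ N) (N.+1%:R ^+ N) => a b; lra.
have h9 : 48 / 100 <= 2^-1 * (1 - 1 / n.+1%:R) ^+ N.+1 :> R.
  move: hn hn2; move: (N.+1%:R / n.+1%:R) ((1 - 1 / n.+1%:R) ^+ N.+1) => a b; lra.
have X0 : 0 <= N.+1%:R ^+ N.+1 * l ^+ N.+1 by rewrite mulr_ge0 ?exprn_ge0 ?ltW.
rewrite [leRHS]mulrCA; apply: le_trans (ler_wpM2l X0 h9).
rewrite [leLHS](_ : _ = N.+1%:R ^+ N.+1 * l ^+ N.+1 * (3 * (2 ^+ N * expR (- (84 / 100)) ^+ N))).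
  by apply: ler_wpM2l => //; lra.
by rewrite !exprS; move: (2 ^+ N) (N.+1%:R ^+ N) (l ^+ N) (expR _ ^+ N) => *; field.
Qed.

(** Small variance, t = 1 / 3: the exponential moments are at most exponential
    in M, whereas the scale grows like n^(M - 1/2). *)
Lemma bin_moment_le_sparse n N : (12 <= N)%N -> (128 * N.+1 <= n.+1)%N ->
  n.+1%:R * (p * q) <= 16 * N.+1%:R ->
  mom n.+1 N.*2.+2 <= 2^-1 * (p * q * dev_scale n.+1 N.*2.+2).
Proof.
move=> N12 nN; set l : R := _ * (p * q) => hl.
have N0 : (0 < N)%N by lia.
have N0' : 12 <= N%:R :> R by rewrite ler_nat.
have M0 : 0 < N.+1%:R :> R by rewrite ltr0n.
have n0 : 0 < n.+1%:R :> R by rewrite ltr0n.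
have n1 : 128 * N.+1%:R <= n.+1%:R :> R by rewrite -natrM ler_nat.
have t01 : 0 < (1 / 3 : R) <= 36 / 100 by apply/andP; split; lra.
apply: le_trans (bin_moment_le_var_mgf p01 N0 t01 (erefl l)) _.
have MN : N.+1%:R = N%:R + 1 :> R by rewrite natr1.
have -> : (N.*2%:R / (1 / 3) : R) ^+ N.*2 = 36 ^+ N * (N%:R ^+ N * N%:R ^+ N).
  rewrite -[N.*2 in X in _ ^+ X]mul2n exprM -!exprMn; congr (_ ^+ N).
  by rewrite -muln2 natrM; field.
have hE : expR (58 / 100 * (l * (1 / 3) ^+ 2) - N.*2%:R) <= 2 ^- N.
  apply: le_trans (_ : expR (- (7 / 10) * N%:R) <= _).
    rewrite ler_expR -muln2 natrM expr2; lra.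
  rewrite expRM_natr -exprVn; apply: lerXn2r expRN7_le; rewrite nnegrE ?expR_ge0 ?invr_ge0 //.
have hN := @half_expn_le R N N0.
have hs := dev_scale_ge N (ltn0Sn n) (R := R).
apply: le_trans (_ : l * (N.+1%:R * (6 * (36 ^+ N * ((N.+1%:R ^+ N / 2) * (N.+1%:R ^+ N / 2)) * 2 ^- N))) <= _).
  apply: ler_wpM2l; first by rewrite mulr_ge0.
  rewrite ler_pM2l // ler_pM2l //; apply: ler_pM => //; rewrite ?expR_ge0 ?mulr_ge0 ?exprn_ge0 //.
  apply: ler_wpM2l; first by rewrite exprn_ge0.
  by apply: ler_pM; rewrite ?exprn_ge0 // ?ler_pdivlMr //; lra.
apply: le_trans (_ : 2^-1 * (p * q * (1 * (N.+1%:R ^+ N.+2 * n.+1%:R ^+ N / 4 ^+ N))) <= _); last first.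
  rewrite ler_wpM2l ?invr_ge0 // ler_wpM2l //; apply: le_trans hs.
  apply: ler_wpM2r; first by apply: divr_ge0; [apply: mulr_ge0|]; apply: exprn_ge0.
  rewrite -[leRHS]mulr1; apply: le_sqrt_mul; rewrite ?divr_ge0 // !expr2; lra.
have hnN : (128 * N.+1%:R) ^+ N.-1 * n.+1%:R <= n.+1%:R ^+ N :> R.
  rewrite -[X in _ <= _ ^+ X](prednK N0) exprSr ler_pM2r //; apply: lerXn2r; rewrite ?nnegrE ?mulr_ge0 //.
apply: le_trans (_ : 2^-1 * (p * q * (1 * (N.+1%:R ^+ N.+2 * ((128 * N.+1%:R) ^+ N.-1 * n.+1%:R) / 4 ^+ N))) <= _); last first.
  rewrite ler_wpM2l ?invr_ge0 // ler_wpM2l // !mul1r; apply: ler_wpM2r; first by rewrite invr_ge0 exprn_ge0.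
  by apply: ler_wpM2l; first exact: exprn_ge0.
have h16 : 384 * 18 ^+ N <= 32 ^+ N :> R.
  have h3 : (384 : R) <= (16 / 9) ^+ N.
    apply: le_trans (_ : 3 ^+ 6 <= _); first by rewrite !exprS expr0; lra.
    apply: le_trans (_ : (16 / 9) ^+ 12 <= _).
      rewrite -[12%N]/(2 * 6)%N exprM; apply: lerXn2r; rewrite ?nnegrE ?sqr_ge0 // expr2; lra.
    by apply: ler_weXn2l => //; lra.
  rewrite (_ : 32 = 18 * (16 / 9) :> R); last by lra.
  by rewrite exprMn mulrC ler_wpM2l ?exprn_ge0.
set M : R := N.+1%:R in M0 *.
rewrite [leLHS](_ : _ = p * q * (n.+1%:R * M * M ^+ N * M ^+ N / 256) * (384 * 18 ^+ N)); last first.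
  rewrite (_ : 36 = 18 * 2 :> R); last by lra.
  rewrite exprMn /l; have : (2 : R) ^+ N != 0 by rewrite expf_neq0.
  by move: (2 ^+ N) (18 ^+ N) (M ^+ N) => F G H F0; field.
rewrite [leRHS](_ : _ = p * q * (n.+1%:R * M * M ^+ N * M ^+ N / 256) * 32 ^+ N); last first.
  rewrite -(prednK N0) /= (_ : (32 : R) ^+ N.-1.+1 = 128 ^+ N.-1 * 32 / 4 ^+ N.-1); last first.
    rewrite (_ : 128 = 32 * 4 :> R); last by lra.
    rewrite exprMn exprS; have : (4 : R) ^+ N.-1 != 0 by rewrite expf_neq0.
    by move: (4 ^+ N.-1) (32 ^+ N.-1) => F G F0; field.
  rewrite exprMn !exprS; have : (4 : R) ^+ N.-1 != 0 by rewrite expf_neq0.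
  move: (4 ^+ N.-1) (128 ^+ N.-1) (M ^+ N.-1) => F G H F0.
  by field.
apply: ler_wpM2l h16; apply: mulr_ge0; first exact: v_ge0.
apply: divr_ge0; last exact: ler0n.
by apply: mulr_ge0; first apply: mulr_ge0; rewrite ?exprn_ge0 // mulr_ge0.
Qed.

End LargeMoments.

(** * Central moments against variance moments *)

(** The ratio of the two sides is monotone in n, so that the table at
    n = 10 M - 8 settles all larger n. *)
Lemma assoc_le_stirling_ge M n j : (1 < M < 20)%N -> (0 < j <= M)%N -> (10 * M - 8 <= n)%N ->
  (assoc_stirling j M.*2 * 2 ^ (M - j) * n ^ M.-1 * n.-1 <=
   M ^ M * stirling2 M j * (n - j) ^ M)%N.
Proof.
move=> hM hj hn; have := assoc_le_stirling hM hj.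
set n0 := (10 * M - 8)%N in hn *.
have [j0 jn0] : (0 < n0 - j)%N /\ (j < n0)%N by rewrite /n0; lia.
clearbody n0.
have h1 : (n.-1 * (n0 - j) <= n0.-1 * (n - j))%N by nia.
have h2 : (n * (n0 - j) <= n0 * (n - j))%N by rewrite !mulnBr [(n * n0)%N]mulnC leq_sub2l // leq_mul2r hn orbT.
have {h2} : ((n * (n0 - j)) ^ M.-1 <= (n0 * (n - j)) ^ M.-1)%N.
  by case: (M.-1) => // k; rewrite leq_exp2r.
rewrite !expnMn => h2 h.
rewrite -(leq_pmul2r (m := (n0 - j) ^ M)) ?expn_gt0 ?j0 //.
have EM x : (x ^ M = x * x ^ M.-1)%N by rewrite -expnS prednK //; lia.
move: h; rewrite !(EM (n0 - j)%N) !(EM (n - j)%N).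
move: (_ * 2 ^ _)%N (M ^ M * _)%N => A B h.
have {h1 h2} := leq_mul h1 h2.
move: (n ^ _)%N (n0 ^ _)%N ((n - j) ^ _)%N ((n0 - j) ^ _)%N h => a b c d h h3.
have := leq_mul (leqnn ((n - j) * c)) h; have := leq_mul (leqnn A) h3; nia.
Qed.

Section Mix.
Context {R : realType}.
Implicit Types (p : R).
Local Notation mom p n k := (bin_mean p n (fun c => (c%:R - n%:R * p) ^+ k)).

Lemma var_moment_compl p n M : var_moment (1 - p) n M = var_moment p n M.
Proof.
rewrite /var_moment bin_mean_compl; apply: bin_mean_ext => c cn.
by congr (_ ^+ _); rewrite natrB //; ring.
Qed.

Lemma bin_moment_compl p n k : mom (1 - p) n k.*2 = mom p n k.*2.
Proof.
rewrite bin_mean_compl; apply: bin_mean_ext => c cn.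
by rewrite -mul2n !exprM; congr (_ ^+ _); rewrite natrB // -[RHS]sqrrN; congr (_ ^+ _); ring.
Qed.

Lemma assoc_stirling0 m : (0 < m)%N -> assoc_stirling 0 m = 0%N.
Proof. by case: m. Qed.

(** Both sides are sums over j of multiples of n ^_ j (p (1 - p)) ^ j, compared
    coefficient by coefficient; the symmetry p <-> 1 - p allows p <= 1 / 2. *)
Lemma bin_moment_le_table p n M : 0 <= p <= 1 -> (1 < M < 20)%N -> (10 * M - 8 <= n)%N ->
  mom p n M.*2 <= n%:R / (n%:R - 1) * (M%:R ^+ M / n%:R ^+ M * var_moment p n M).
Proof.
move=> p01 hM hn.
wlog p2 : p p01 / p <= 2^-1.
  move=> H; case: (lerP p 2^-1) => hp; first exact: H.
  rewrite -bin_moment_compl -var_moment_compl; apply: H; first by case/andP: p01 => *; apply/andP; split; lra.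
  by lra.
have [p0 p1] := andP p01.
have n2 : (2 <= n)%N by lia.
have n0' : 1 <= n%:R - 1 :> R by rewrite -(natrB _ (ltnW n2)) ler1n subn_gt0.
have n0 : 0 < n%:R :> R by lra.
apply: le_trans (ler_norm _) _; apply: le_trans (bin_central_moment_le p01 _ _) _.
rewrite mulrA; set K : R := _ * (M%:R ^+ M / n%:R ^+ M).
have K0 : 0 <= K by rewrite /K mulr_ge0 ?divr_ge0 ?exprn_ge0 //; lra.
apply: le_trans (ler_wpM2l K0 (bin_mean_var_pow_ge p01 n M)).
rewrite /moment_bound.
rewrite (bigID (fun j : 'I_M.*2.+1 => (j < M.+1)%N)) /= [X in _ + X]big1 ?addr0; last first.
  by move=> j; rewrite -leqNgt => hj; rewrite assoc_stirling_small ?mul0r //; lia.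
rewrite -(@big_ord_widen_cond _ _ _ M.+1 M.*2.+1 xpredT (fun j => (assoc_stirling j M.*2)%:R * (n ^_ j)%:R * (p * (1 - p)) ^+ j)) /=; last by lia.
rewrite mulr_sumr; apply: ler_sum => -[[|j] hj] _ /=.
  rewrite (_ : (M.*2 == 0)%N = false) ?mul0r; last by lia.
  apply: mulr_ge0 K0 _; apply: mulr_ge0; first by apply: mulr_ge0 => //; exact: exprn_ge0.
  by apply: exprn_ge0; apply: mulr_ge0 => //; rewrite subr_ge0.
have hjM : (0 < j.+1 <= M)%N by lia.
have h := assoc_le_stirling_ge hM hjM hn.
have q0 : 0 <= 1 - p by lra.
(* p <= 1 / 2, so each missing power of 1 - p costs at most a factor 2 *)
have hq : 1 <= 2 ^+ (M - j.+1) * (1 - p) ^+ (M - j.+1).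
  by rewrite -exprMn exprn_ege1 //; lra.
have -> : K * ((stirling2 M j.+1)%:R * (n ^_ j.+1)%:R * p ^+ j.+1 * ((n - j.+1)%:R * (1 - p)) ^+ M) =
  (n ^_ j.+1)%:R * (p * (1 - p)) ^+ j.+1 * ((1 - p) ^+ (M - j.+1) *
    (K * (stirling2 M j.+1)%:R * (n - j.+1)%:R ^+ M)).
  have -> : ((n - j.+1)%:R * (1 - p)) ^+ M = (n - j.+1)%:R ^+ M * ((1 - p) ^+ (M - j.+1) * (1 - p) ^+ j.+1).
    by rewrite exprMn -exprD subnK.
  rewrite [(p * (1 - p)) ^+ _]exprMn.
  move: (p ^+ _) ((1 - p) ^+ j.+1) ((1 - p) ^+ _) (_ ^+ M) => a b c d.
  by ring.
rewrite -mulrA mulrC; apply: ler_wpM2l; first by rewrite !mulr_ge0 ?exprn_ge0 ?mulr_ge0.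
have hK : (assoc_stirling j.+1 M.*2)%:R * 2 ^+ (M - j.+1) <= K * (stirling2 M j.+1)%:R * (n - j.+1)%:R ^+ M.
  have -> : K = M%:R ^+ M / (n%:R ^+ M.-1 * (n.-1)%:R).
    have -> : n.-1%:R = n%:R - 1 :> R by rewrite -subn1 natrB //; lia.
    have -> : K = n%:R / (n%:R - 1) * (M%:R ^+ M / (n%:R * n%:R ^+ M.-1)) by rewrite -exprS prednK //; lia.
    have : n%:R ^+ M.-1 != 0 :> R by rewrite expf_neq0 // gt_eqF.
    move: (n%:R ^+ M.-1) => y y0; field; rewrite y0 !gt_eqF //; lra.
  rewrite mulrAC -mulrA mulrAC ler_pdivlMr; last first.
    by rewrite mulr_gt0 ?exprn_gt0 // ltr0n; lia.
  by move: h; rewrite -(ler_nat R) !natrM !natrX => {}h; apply: (le_trans _ (le_trans h _)); apply: le_of_eq; ring.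
have a0 : 0 <= (assoc_stirling j.+1 M.*2)%:R :> R by [].
have := ler_wpM2l (exprn_ge0 (M - j.+1) q0) hK; apply: le_trans.
by rewrite [leRHS]mulrCA ler_peMr // mulrC.
Qed.


(** One factor p (1 - p) of each power is kept and the others are bounded
    by 1 / 4. *)
Lemma bin_moment_le_small p n M : 0 <= p <= 1 -> (1 < M < 20)%N -> (1 < n)%N ->
  (n < if M < 12 then 10 * M - 8 else M.*2.+2)%N ->
  mom p n M.*2 <= n%:R / (n%:R - 1) * (p * (1 - p) * dev_scale n M.*2).
Proof.
move=> p01 hM n1 hn; have [p0 p1] := andP p01.
have n0' : 1 <= n%:R - 1 :> R by rewrite -(natrB _ (ltnW n1)) ler1n subn_gt0.
have n0 : 0 < n%:R :> R by lra.
set v : R := p * (1 - p); have v0 : 0 <= v by rewrite mulr_ge0 // subr_ge0.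
have v4 : v <= 4^-1 by have := sqr_ge0 (p - 2^-1); rewrite /v expr2; lra.
have h := assoc_sum_le hM n1 hn.
set W := (\sum_(0 <= j < M.+1) assoc_stirling j M.*2 * n ^_ j * 4 ^ (M - j))%N in h.
set C := (\sum_(1 <= k < M.+1) _)%N in h.
have F0 : (0 : R) < 4 ^+ M by rewrite exprn_gt0.
have hC : dev_coef n M.*2 = C%:R / (4 ^+ M * n%:R ^+ 3) :> R.
  rewrite /dev_coef (_ : (M.*2 %/ 2 = M)%N); last by rewrite -muln2 mulnK.
  rewrite /C natr_sum mulr_suml big_nat_cond [RHS]big_nat_cond.
  apply: eq_bigr => k; rewrite andbT ltnS => /andP[k0 kM].
  rewrite dev_coef_termE //; last by lia.
  have -> : (4 : R) ^+ M = 4 ^+ (M - k) * 4 ^+ k by rewrite -exprD subnK.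
  have : (4 : R) ^+ (M - k) != 0 by rewrite expf_neq0.
  have : (4 : R) ^+ k != 0 by rewrite expf_neq0.
  rewrite !(natrM, natrD, natrX).
  move: (4 ^+ k) (4 ^+ (M - k)) (k%:R ^+ (M.*2 - k)) (n%:R ^+ k) => a b c d a0 b0.
  by field; rewrite a0 b0 gt_eqF.
have hm : mom p n M.*2 <= v * (4 * W%:R / 4 ^+ M).
  apply: le_trans (ler_norm _) _; apply: le_trans (bin_central_moment_le p01 _ _) _.
  rewrite /moment_bound.
  rewrite (bigID (fun j : 'I_M.*2.+1 => (j < M.+1)%N)) /= [X in _ + X]big1 ?addr0; last first.
    by move=> j; rewrite -leqNgt => hj; rewrite assoc_stirling_small ?mul0r //; lia.
  rewrite -(@big_ord_widen_cond _ _ _ M.+1 M.*2.+1 xpredT (fun j => (assoc_stirling j M.*2)%:R * (n ^_ j)%:R * (p * (1 - p)) ^+ j)) /=; last by lia.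
  rewrite /W big_mkord natr_sum [v * _]mulrA [v * (4 * _)]mulrA mulr_sumr mulr_suml -/v; apply: ler_sum => -[j hj] _.
  change (nat_of_ord (Ordinal hj)) with j.
  case: j hj => [|j] hj; first by rewrite assoc_stirling0 ?mul0n ?mulr0 ?mul0r //; lia.
  rewrite [(_ * 4 ^ _)%:R]natrM [(assoc_stirling _ _ * _)%:R]natrM natrX.
  have -> : (4 : R) ^+ M = 4 ^+ (M - j.+1) * 4 ^+ j.+1 by rewrite -exprD subnK.
  have f0 : (4 : R) ^+ (M - j.+1) != 0 by rewrite expf_neq0.
  have g0 : (4 : R) ^+ j != 0 by rewrite expf_neq0.
  rewrite [leRHS](_ : _ = (assoc_stirling j.+1 M.*2)%:R * (n ^_ j.+1)%:R * (v * (4^-1) ^+ j)); last first.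
    rewrite exprVn [4 ^+ j.+1]exprS; move: (4 ^+ (M - j.+1)) (4 ^+ j) f0 g0 => a b a0 b0.
    by field; rewrite a0 b0.
  rewrite -/v exprS; apply: ler_wpM2l; first exact: mulr_ge0.
  apply: ler_wpM2l => //.
  by apply: lerXn2r; rewrite ?nnegrE ?invr_ge0.
apply: le_trans hm _; rewrite [leRHS]mulrCA; apply: ler_wpM2l => //.
have h2 : 4 * W%:R * (n%:R - 1) * n%:R ^+ 2 <= Num.sqrt (n%:R / 2) * C%:R :> R.
  apply: le_sqrt_mul => //.
    by rewrite !mulr_ge0 ?sqr_ge0 //; lra.
  move: h; rewrite -(ler_nat R) !(natrM, natrX) -subn1 natrB ?(ltnW n1) // => h.
  have n2 : 0 <= n%:R / 2 :> R by rewrite divr_ge0.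
  have := ler_wpM2l n2 h => {}h.
  by apply: (le_trans _ h); apply: le_of_eq; field.
rewrite /dev_scale hC.
have -> : n%:R / (n%:R - 1) * (Num.sqrt (n%:R / 2) * (C%:R / (4 ^+ M * n%:R ^+ 3))) =
   (Num.sqrt (n%:R / 2) * C%:R) / ((n%:R - 1) * n%:R ^+ 2) / 4 ^+ M :> R.
  by field; rewrite !gt_eqF //; lra.
rewrite ler_pM2r ?invr_gt0 // ler_pdivlMr; last by rewrite mulr_gt0 ?exprn_gt0 //; lra.
by rewrite mulrA.
Qed.

Lemma pow55_11 : (11 / 20 : R) ^+ 11 <= 1398 / 1000 / 1000.
Proof.
have h : (11 / 20 : R) ^+ (2 * 4) <= 84 / 10000.
  apply: le_trans (exprM2_le 4 (b := 3025 / 10000) _ _) _; [lra|lra|].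
  apply: le_trans (exprM2_le 2 (b := 916 / 10000) _ _) _; [lra|lra|].
  by rewrite expr2; lra.
apply: le_trans (_ : (11 / 20) ^+ (2 * 4) * (11 / 20) ^+ 3 <= _); first by rewrite -exprD.
move: (_ ^+ (2 * 4)) h => x h.
by rewrite !exprS expr0; lra.
Qed.

Lemma pow55_19 : (11 / 20 : R) ^+ 19 <= 118 / 10000 / 1000.
Proof.
have h : (11 / 20 : R) ^+ (2 * 8) <= 708 / 10000 / 1000.
  apply: le_trans (exprM2_le 8 (b := 3025 / 10000) _ _) _; [lra|lra|].
  apply: le_trans (exprM2_le 4 (b := 916 / 10000) _ _) _; [lra|lra|].
  apply: le_trans (exprM2_le 2 (b := 84 / 10000) _ _) _; [lra|lra|].
  by rewrite expr2; lra.
apply: le_trans (_ : (11 / 20) ^+ (2 * 8) * (11 / 20) ^+ 3 <= _); first by rewrite -exprD.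
move: (_ ^+ (2 * 8)) h => x h.
by rewrite !exprS expr0; lra.
Qed.

(** Repeated squaring with rounding keeps the numbers of the numerical bounds
    small. *)
Lemma exprn_double_le (x a b : R) k : 0 <= x -> x ^+ k <= a -> a ^+ 2 <= b -> x ^+ k.*2 <= b.
Proof.
move=> x0 xa; apply: le_trans; rewrite -addnn exprD expr2.
by apply: ler_pM; rewrite ?exprn_ge0.
Qed.

Lemma expR4_le : expR (2 * 2) <= 55 :> R.
Proof.
have -> : expR (2 * 2) = expR 1 ^+ 4 :> R by rewrite -expRM_natr; congr expR; lra.
have e0 := expR_ge0 (1 : R).
have h1 : expR 1 ^+ 1 <= 2721 / 1000 :> R by rewrite expr1; exact: expR1_le.
have h2 : expR 1 ^+ 2 <= 741 / 100 :> R by apply: exprn_double_le e0 h1 _; lra.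
by apply: exprn_double_le e0 h2 _; lra.
Qed.

Lemma expR_34_thirds_le : expR (2 * (17 / 3)) <= 85 * 1000 :> R.
Proof.
have e0 := expR_ge0 (1 / 6 : R).
have h1 : expR (1 / 6) ^+ 1 <= 11815 / 10000 :> R.
  rewrite expr1; have y0 : 0 <= 1 / 6 :> R by lra.
  have := expRN_ge_taylor3 y0; rewrite [_ ^+ 3]exprS expr2 => h.
  have e : expR (1 / 6) * expR (- (1 / 6)) = 1 :> R by rewrite -expRD subrr expR0.
  have := ler_wpM2l e0 h; rewrite e; lra.
have h2 : expR (1 / 6) ^+ 2 <= 1396 / 1000 :> R by apply: exprn_double_le e0 h1 _; lra.
have h4 : expR (1 / 6) ^+ 4 <= 1949 / 1000 :> R by apply: exprn_double_le e0 h2 _; lra.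
have h8 : expR (1 / 6) ^+ 8 <= 3799 / 1000 :> R by apply: exprn_double_le e0 h4 _; lra.
have h16 : expR (1 / 6) ^+ 16 <= 1444 / 100 :> R by apply: exprn_double_le e0 h8 _; lra.
have h32 : expR (1 / 6) ^+ 32 <= 2086 / 10 :> R by apply: exprn_double_le e0 h16 _; lra.
have h64 : expR (1 / 6) ^+ 64 <= 4352 * 10 :> R by apply: exprn_double_le e0 h32 _; lra.
have -> : expR (2 * (17 / 3)) = expR (1 / 6) ^+ (64 + 4) :> R by rewrite -!expRM_natr; congr expR; field.
rewrite exprD; apply: le_trans (ler_pM (exprn_ge0 _ e0) (exprn_ge0 _ e0) h64 h4) _.
by lra.
Qed.

End Mix.

Section Mix.
Context {R : realType}.
Implicit Types (p : R).
Local Notation mom p n k := (bin_mean p n (fun c => (c%:R - n%:R * p) ^+ k)).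

Lemma bin_moment_le_sqr_num p n N (t E c : R) : 0 <= p <= 1 -> (0 < n)%N -> (0 < N)%N ->
  0 <= t -> 8 * N%:R <= t ^+ 2 * n%:R -> expR (2 * t) <= E -> (11 / 20) ^+ N <= c ->
  8 * n%:R * E * c <= N.+1%:R ^+ 2 ->
  mom p n N.*2.+2 <= p * (1 - p) * dev_scale n N.*2.+2.
Proof.
move=> p01 n0 N0 t0 tN tE hc h; apply: bin_moment_le_sqr_mgf => //.
apply: le_trans h; have nn : 0 < n%:R :> R by rewrite ltr0n.
apply: ler_pM => //.
apply: ler_wpM2l; first by rewrite mulr_ge0.
apply: le_trans tE; rewrite ler_expR ler_pM2l // -[leRHS](ger0_norm t0) -sqrtr_sqr ler_wsqrtr //.
by rewrite ler_pdivrMr.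
Qed.

(** The central moment of order 2 M of a binomial variable is controlled either
    by the variance moment, which the empirical sum dominates, or by the
    deviation scale. The weight a is the same for all p, so that the inequality
    can be summed over an alphabet. For M < 20 the tables apply, except for
    12 <= M and 2 M + 1 < n < 10 M - 8. There, and for M >= 20 and n < 128 M,
    exponential moments, or |x| <= n when 4 n <= M, give a = 0; for M >= 20 and n >= 128 M each p satisfies
    one of two bounds with an additional factor 1 / 2, and a = 1 / 2. *)
Lemma bin_moment_le_mix n M : (1 < n)%N -> (1 < M)%N -> exists2 a : R, 0 <= a <= 1 &
  forall p, 0 <= p <= 1 -> mom p n M.*2 <=
    n%:R / (n%:R - 1) * (a * (M%:R ^+ M / n%:R ^+ M * var_moment p n M) +
      (1 - a) * (p * (1 - p) * dev_scale n M.*2)).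
Proof.
move=> n1 M1.
have n0' : 1 <= n%:R - 1 :> R by rewrite -(natrB _ (ltnW n1)) ler1n subn_gt0.
have n0 : 0 < n%:R :> R by lra.
have r1 : 1 <= n%:R / (n%:R - 1) :> R by rewrite ler_pdivlMr; lra.
have S0 : 0 <= dev_scale n M.*2 :> R by rewrite mulr_ge0 ?sqrtr_ge0 // dev_coef_ge0 // ltnW.
have V0 p : 0 <= p <= 1 -> 0 <= p * (1 - p) * dev_scale n M.*2.
  by move=> /andP[p0 p1]; rewrite mulr_ge0 // mulr_ge0 // subr_ge0.
pose holds (a : R) := forall p, 0 <= p <= 1 -> mom p n M.*2 <=
    n%:R / (n%:R - 1) * (a * (M%:R ^+ M / n%:R ^+ M * var_moment p n M) +
      (1 - a) * (p * (1 - p) * dev_scale n M.*2)).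
have case1 : (M < 20)%N -> (10 * M - 8 <= n)%N -> exists2 a : R, 0 <= a <= 1 & holds a.
  move=> M20 hn; exists 1; first by rewrite ler01 lexx.
  by move=> p p01; rewrite subrr mul0r addr0 mul1r; apply: bin_moment_le_table; rewrite ?M1.
have case2 : (M < 20)%N -> (n < if M < 12 then 10 * M - 8 else M.*2.+2)%N -> exists2 a : R, 0 <= a <= 1 & holds a.
  move=> M20 hn; exists 0; first by rewrite ler01 lexx.
  by move=> p p01; rewrite subr0 mul0r add0r mul1r; apply: bin_moment_le_small; rewrite ?M1.
have case3 : (forall p, 0 <= p <= 1 -> mom p n M.*2 <= p * (1 - p) * dev_scale n M.*2) ->
    exists2 a : R, 0 <= a <= 1 & holds a.
  move=> H; exists 0; first by rewrite ler01 lexx.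
  move=> p p01; rewrite subr0 mul0r add0r mul1r; apply: le_trans (H p p01) _.
  by rewrite ler_peMl // V0.
have MN : (M = M.-1.+1)%N by lia.
have MN2 : (M.*2 = M.-1.*2.+2)%N by lia.
have M10 : (0 < M.-1)%N by lia.
have nE : (n = n.-1.+1)%N by lia.
have MR : M%:R = M.-1%:R + 1 :> R by rewrite natr1 -MN.
have [M20|M20] := ltnP M 20.
  have [hn|hn] := leqP (10 * M - 8) n; first exact: case1.
  have [hn2|hn2] := ltnP n (if (M < 12)%N then 10 * M - 8 else M.*2.+2)%N; first exact: case2.
  have M12 : (11 < M)%N by move: hn2; case: ifP => //; lia.
  move: hn2; rewrite ltnNge M12 /= => hn2.
  have h1 : 2 * M%:R <= n%:R :> R by rewrite -natrM ler_nat; lia.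
  have h2 : n%:R <= 10 * M%:R :> R by rewrite -natrM ler_nat; lia.
  have h3 : 12 <= M%:R :> R by rewrite ler_nat.
  apply: case3 => p p01; rewrite MN2.
  (* n >= 2 M gives t <= 2, and e^4 <= 55 *)
  apply: (@bin_moment_le_sqr_num p n M.-1 2 55 (1398 / 1000 / 1000)) => //.
  - exact: ltnW.
  - by rewrite expr2; lra.
  - exact: expR4_le.
  - apply: exprn_le_exprn pow55_11; [by apply/andP; split; lra|by lia].
  by rewrite -MN expr2; nra.
have M19 : (19 <= M.-1)%N by lia.
have M16 : (16 <= M.-1)%N by exact: leq_trans M19.
have M12 : (12 <= M.-1)%N by exact: leq_trans M19.
have p55 : (11 / 20 : R) ^+ M.-1 <= 118 / 10000 / 1000.
  apply: exprn_le_exprn M19 pow55_19; by apply/andP; split; lra.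
have h3 : 20 <= M%:R :> R by rewrite ler_nat.
have [hn|hn] := leqP (4 * n) M.
  apply: case3 => p p01; rewrite MN2; apply: bin_moment_le_tiny => //; first exact: ltnW.
  by rewrite -MN.
have h4 : M%:R <= 4 * n%:R :> R by rewrite -natrM ler_nat ltnW.
have [hn2|hn2] := ltnP n (2 * M).
  have h2 : n%:R <= 2 * M%:R :> R by rewrite -natrM ler_nat ltnW.
  apply: case3 => p p01; rewrite MN2.
  (* 4 n >= M gives t^2 <= 32 <= (17 / 3)^2 *)
  apply: (@bin_moment_le_sqr_num p n M.-1 (17 / 3) (85 * 1000) (118 / 10000 / 1000)) => //.
  - exact: ltnW.
  - by rewrite expr2; lra.
  - exact: expR_34_thirds_le.
  by rewrite -MN expr2; nra.
have h1 : 2 * M%:R <= n%:R :> R by rewrite -natrM ler_nat.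
have [hn3|hn3] := ltnP n (128 * M).
  have h2 : n%:R <= 128 * M%:R :> R by rewrite -natrM ler_nat ltnW.
  apply: case3 => p p01; rewrite MN2.
  apply: (@bin_moment_le_sqr_num p n M.-1 2 55 (118 / 10000 / 1000)) => //.
  - exact: ltnW.
  - by rewrite expr2; lra.
  - exact: expR4_le.
  by rewrite -MN expr2; nra.
clear p55; exists 2^-1; first by apply/andP; split; lra.
move=> p p01.
have V1 : 0 <= M%:R ^+ M / n%:R ^+ M * var_moment p n M.
  apply: mulr_ge0; first by apply: divr_ge0; rewrite exprn_ge0.
  apply: le_trans (var_moment_ge p01 n M); apply: exprn_ge0.
  have [p0 p1] := andP p01; apply: mulr_ge0; first by rewrite mulr_ge0; lra.
  by rewrite mulr_ge0 // subr_ge0.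
have -> : 1 - 2^-1 = 2^-1 :> R by lra.
have V0p := V0 p p01.
set V := _ * var_moment p n M in V1 *; set S : R := p * (1 - p) * _ in V0p *.
suff H : mom p n M.*2 <= 2^-1 * V \/ mom p n M.*2 <= 2^-1 * S.
  have X0 : 0 <= 2^-1 * V + 2^-1 * S by lra.
  have := ler_peMl X0 r1; move: (n%:R / (n%:R - 1) * _) => Y hY.
  by case: H => H; lra.
have [hl|hl] := lerP (16 * M%:R) (n%:R * (p * (1 - p))).
  left; rewrite /V; have := @bin_moment_le_var R p p01 n.-1 M.-1 M16.
  by rewrite -nE -MN -MN2; apply.
right; rewrite /S; have := @bin_moment_le_sparse R p p01 n.-1 M.-1 M12.
by rewrite -nE -MN -MN2; apply => //; exact: ltW.
Qed.

End Mix.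

(** * Sensitivity of the empirical sum to one observation *)

Section VarPower.
Context {R : realType}.
Implicit Types (x h : R).

(** The derivative of (x (1 - x))^2 is at most 1 / (3 sqrt 3) < 1 / 5 in absolute
    value. In terms of t = 1 - 2 x and u = 1 - 2 (x + h) the quotient of the
    difference by h is (t + u) / 2 (1 - W) / 2 with W = (t^2 + u^2) / 2, whose
    square is at most W (1 - W)^2 / 4 <= 1 / 27. *)
Lemma var_sqr_diff_le x h : 0 <= x -> 0 <= h -> x + h <= 1 ->
  `|((x + h) * (1 - (x + h))) ^+ 2 - (x * (1 - x)) ^+ 2| <= h / 5.
Proof.
move=> x0 h0 xh.
pose t : R := 1 - 2 * x; pose u : R := 1 - 2 * (x + h).
pose W : R := (t ^+ 2 + u ^+ 2) / 2.
have -> : ((x + h) * (1 - (x + h))) ^+ 2 - (x * (1 - x)) ^+ 2 = h * ((t + u) / 2 * ((1 - W) / 2)).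
  by rewrite /W /t /u; field.
rewrite normrM (ger0_norm h0); apply: ler_wpM2l => //.
rewrite -(ger0_norm (_ : 0 <= 5^-1)); last by rewrite invr_ge0.
rewrite -ler_sqr ?nnegrE ?normr_ge0 // !real_normK ?num_real // exprMn.
have t1 : t ^+ 2 <= 1 by rewrite /t expr2; nra.
have u1 : u ^+ 2 <= 1 by rewrite /u expr2; nra.
have W0 : 0 <= W by rewrite /W; have := sqr_ge0 t; have := sqr_ge0 u; lra.
have W1 : W <= 1 by rewrite /W; lra.
have hW : ((t + u) / 2) ^+ 2 <= W by rewrite /W; have := sqr_ge0 (t - u); rewrite !expr2; lra.
have h2 : W * ((1 - W) / 2) ^+ 2 <= 5^-1 ^+ 2.
  have := mulr_ge0 (sqr_ge0 (W - 1 / 3)) (_ : 0 <= 4 / 3 - W); rewrite !expr2 => /(_ _) H.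
  by have := H ltac:(lra); lra.
by apply: le_trans h2; apply: ler_wpM2r => //; exact: sqr_ge0.
Qed.

Lemma var_le4 x : 0 <= x <= 1 -> 0 <= x * (1 - x) <= 4^-1.
Proof.
move=> /andP[x0 x1]; have := sqr_ge0 (x - 2^-1); rewrite expr2 => ?.
by apply/andP; split; [rewrite mulr_ge0 // subr_ge0|lra].
Qed.

(** From the identity
    2 (a^(k+1) - b^(k+1)) = (a - b) (a^k + b^k) + (a + b) (a^k - b^k); starting
    at the squares keeps the small constant of [var_sqr_diff_le]. *)
Lemma exprn_diff_le (a b G : R) k : 0 <= a <= 4^-1 -> 0 <= b <= 4^-1 ->
  `|a ^+ 2 - b ^+ 2| <= G ->
  `|a ^+ k.+2 - b ^+ k.+2| <= G * (k.+2%:R / 2) / 4 ^+ k.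
Proof.
move=> /andP[a0 a4] /andP[b0 b4] hG; elim: k => [|k IH].
  by rewrite expr0 divr1 divff // mulr1.
have hk (c : R) : 0 <= c -> c <= 4^-1 -> c ^+ k.+1 <= c / 4 ^+ k.
  move=> c0 c4; rewrite exprS ler_wpM2l // -exprVn; apply: lerXn2r => //; rewrite nnegrE //.
have -> : a ^+ k.+3 - b ^+ k.+3 = ((a - b) * (a ^+ k.+2 + b ^+ k.+2) + (a + b) * (a ^+ k.+2 - b ^+ k.+2)) / 2.
  by rewrite [a ^+ k.+3]exprS [b ^+ k.+3]exprS; field.
have F0 : (0 : R) < 4 ^+ k by rewrite exprn_gt0.
have hd : `|a ^+ 2 - b ^+ 2| = `|a - b| * (a + b).
  by rewrite subr_sqr normrM [X in _ * X]ger0_norm // addr_ge0.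
have h1 : `|a - b| * (a ^+ k.+2 + b ^+ k.+2) <= G / (4 * 4 ^+ k).
  have e : a ^+ k.+2 + b ^+ k.+2 <= (a + b) / (4 * 4 ^+ k).
    have := hk _ a0 a4; have := hk _ b0 b4.
    rewrite !ler_pdivlMr ?mulr_gt0 // => hb ha.
    have := ler_pM (mulr_ge0 (exprn_ge0 _ a0) (ltW F0)) a0 ha a4.
    have := ler_pM (mulr_ge0 (exprn_ge0 _ b0) (ltW F0)) b0 hb b4.
    rewrite [a ^+ k.+2]exprSr [b ^+ k.+2]exprSr.
    by move: (a ^+ k.+1) (b ^+ k.+1) (4 ^+ k) => A B F; lra.
  apply: le_trans (ler_wpM2l (normr_ge0 _) e) _; rewrite mulrA -hd; apply: ler_wpM2r hG.
  by rewrite invr_ge0; apply: mulr_ge0 => //; exact: ltW.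
have h2 : (a + b) * `|a ^+ k.+2 - b ^+ k.+2| <= 2^-1 * (G * (k.+2%:R / 2) / 4 ^+ k).
  apply: ler_pM => //; first exact: addr_ge0; lra.
have half : 0 <= 2^-1 :> R by rewrite invr_ge0.
have S0 : 0 <= a ^+ k.+2 + b ^+ k.+2 by rewrite addr_ge0 ?exprn_ge0.
have hn := ler_normD ((a - b) * (a ^+ k.+2 + b ^+ k.+2)) ((a + b) * (a ^+ k.+2 - b ^+ k.+2)).
rewrite !normrM (ger0_norm S0) (ger0_norm (addr_ge0 a0 b0)) in hn.
rewrite normrM (ger0_norm half).
apply: le_trans (ler_wpM2r half (le_trans hn (lerD h1 h2))) _.
apply: le_of_eq; rewrite -[k.+3%:R]natr1 exprS.
by move: (4 ^+ k) F0 => F F0; field; rewrite gt_eqF.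
Qed.

Lemma var_pow_diff_le x h k : 0 <= x -> 0 <= h -> x + h <= 1 ->
  `|((x + h) * (1 - (x + h))) ^+ k.+2 - (x * (1 - x)) ^+ k.+2| <= h * (k.+2%:R / 10 / 4 ^+ k).
Proof.
move=> x0 h0 xh.
have hx : 0 <= x <= 1 by apply/andP; split; lra.
have hxh : 0 <= x + h <= 1 by apply/andP; split; lra.
apply: le_trans (exprn_diff_le k (var_le4 hxh) (var_le4 hx) (var_sqr_diff_le x0 h0 xh)) _.
by apply: le_of_eq; have : (4 : R) ^+ k != 0 by [rewrite expf_neq0]; move: (4 ^+ k) => F F0; field.
Qed.

End VarPower.

Section EmpWeight.
Context {R : realType}.

Definition emp_term (n m k c : nat) : R :=
  k%:R ^+ (m - k) * n%:R ^+ k * (c%:R / n%:R * (1 - c%:R / n%:R)) ^+ k.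

(** The contribution to the empirical sum of a symbol that appears c times. *)
Definition emp_weight (n m c : nat) : R := \sum_(1 <= k < (m %/ 2).+1) emp_term n m k c.

Lemma emp_term_ge0 n m k c : (c <= n)%N -> 0 <= emp_term n m k c.
Proof.
move=> cn; rewrite /emp_term mulr_ge0 ?mulr_ge0 ?exprn_ge0 //.
rewrite mulr_ge0 ?divr_ge0 // subr_ge0.
case: n cn => [|n] cn; first by rewrite invr0 mulr0.
by rewrite ler_pdivrMr ?ltr0n // mul1r ler_nat.
Qed.

Lemma emp_weight_ge0 n m c : (c <= n)%N -> 0 <= emp_weight n m c.
Proof. by move=> cn; apply: sumr_ge0 => k _; exact: emp_term_ge0. Qed.

Lemma emp_term_diff_le n m k a b : (0 < n)%N -> (a + b < n)%N ->
  emp_term n m k.+2 a.+1 - emp_term n m k.+2 a + (emp_term n m k.+2 b - emp_term n m k.+2 b.+1) <=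
  k.+2%:R ^+ (m - k.+2) * n%:R ^+ k.+2 * (k.+2%:R / (5 * n%:R * 4 ^+ k)).
Proof.
move=> n0 abn; have nn : 0 < n%:R :> R by rewrite ltr0n.
have h0 : 0 <= n%:R^-1 :> R by rewrite invr_ge0.
have D c : (c < n)%N -> `|(c.+1%:R / n%:R * (1 - c.+1%:R / n%:R)) ^+ k.+2 -
   (c%:R / n%:R * (1 - c%:R / n%:R)) ^+ k.+2| <= n%:R^-1 * (k.+2%:R / 10 / 4 ^+ k) :> R.
  move=> cn; have -> : c.+1%:R / n%:R = c%:R / n%:R + n%:R^-1 :> R by rewrite -natr1 mulrDl mul1r.
  apply: var_pow_diff_le => //.
  have -> : c%:R / n%:R + n%:R^-1 = c.+1%:R / n%:R :> R by rewrite -natr1 mulrDl mul1r.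
  by rewrite ler_pdivrMr // mul1r ler_nat.
have /ler_normlP[_ h1] := D a (leq_ltn_trans (leq_addr _ _) abn).
have /ler_normlP[h2 _] := D b (leq_ltn_trans (leq_addl _ _) abn).
rewrite /emp_term -!mulrBr -mulrDr; apply: ler_wpM2l; first by rewrite mulr_ge0 ?exprn_ge0.
have F0 : (4 : R) ^+ k != 0 by rewrite expf_neq0.
have -> : k.+2%:R / (5 * n%:R * 4 ^+ k) = n%:R^-1 * (k.+2%:R / 10 / 4 ^+ k) + n%:R^-1 * (k.+2%:R / 10 / 4 ^+ k) :> R.
  by move: (4 ^+ k) F0 => F F0; field; rewrite F0 gt_eqF.
by apply: lerD => //; rewrite -opprB.
Qed.

(** When one observation changes, one count increases and another one
    decreases. The terms k >= 3 of the sum change by at most the corresponding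
    terms of C. For k = 1 the change can be nearly 2 and thus exceed the term
    1 + 24 / n^2; the slack left by the term k = 2, at least 2 n / 5, compensates
    for it. This is where m >= 4 is needed. *)
Lemma emp_weight_diff_le n N a b : (1 < n)%N -> (a + b < n)%N ->
  emp_weight n N.*2.+4 a.+1 - emp_weight n N.*2.+4 a + (emp_weight n N.*2.+4 b - emp_weight n N.*2.+4 b.+1) <=
  dev_coef n N.*2.+4.
Proof.
move=> n1 abn; have n0 : (0 < n)%N by exact: ltnW.
have nn : 0 < n%:R :> R by rewrite ltr0n.
set m := N.*2.+4; have mE : (m %/ 2 = N.+2)%N by rewrite /m -!doubleS -muln2 mulnK.
pose T k : R := emp_term n m k a.+1 - emp_term n m k a + (emp_term n m k b - emp_term n m k b.+1).
have -> : emp_weight n m a.+1 - emp_weight n m a + (emp_weight n m b - emp_weight n m b.+1) =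
  \sum_(1 <= k < N.+3) T k.
  by rewrite /emp_weight mE -!sumrB -big_split.
rewrite /dev_coef mE.
rewrite !(@big_ltn _ _ _ 1 N.+3) // !(@big_ltn _ _ _ 2 N.+3) // addrA [leRHS]addrA.
have Dge k : dev_coef_term n m k.+2 >= k.+2%:R ^+ (m - k.+2) * n%:R ^+ k.+2 * (k.+2%:R / (4 * n%:R * 4 ^+ k)) :> R.
  rewrite dev_coef_termE // -[leRHS]mulrA; apply: ler_wpM2l; first by rewrite mulr_ge0 ?exprn_ge0.
  have F0 : 0 < (4 : R) ^+ k by rewrite exprn_gt0.
  rewrite [leRHS](_ : _ = k.+2%:R / (4 * n%:R * 4 ^+ k) + 6 * k.+2%:R ^+ 3 / (4 ^+ k * n%:R ^+ 3)).
    by rewrite lerDl divr_ge0 ?mulr_ge0 ?exprn_ge0.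
  by rewrite [4 ^+ k.+2]exprS [4 ^+ k.+1]exprS; move: (4 ^+ k) F0 => F F0; field; rewrite !gt_eqF.
apply: lerD; last first.
  rewrite big_nat_cond [leRHS]big_nat_cond; apply: ler_sum => -[|[|k]] //= _.
  apply: le_trans (emp_term_diff_le m k n0 abn) _; apply: le_trans (Dge k).
  apply: ler_wpM2l; first by rewrite mulr_ge0 ?exprn_ge0.
  apply: ler_wpM2l => //; rewrite lef_pV2 ?posrE; last 2 first.
  - by rewrite mulr_gt0 ?exprn_gt0 // mulr_gt0.
  - by rewrite mulr_gt0 ?exprn_gt0 // mulr_gt0.
  by apply: ler_wpM2r; [rewrite exprn_ge0|rewrite ler_pM2r // ler_nat].
have m2 : (m - 2 = N.*2.+2)%N by rewrite /m !subSS subn0.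
have T2 := emp_term_diff_le m 0 n0 abn; have D2 := Dge 0%N.
rewrite -/(T 2) in T2; rewrite !expr0 !mulr1 m2 in T2 D2.
set W : R := 2 ^+ N.*2.+2 * n%:R ^+ 2 in T2 D2.
have W4 : 4 * n%:R ^+ 2 <= W.
  apply: ler_wpM2r; first exact: sqr_ge0.
  rewrite -[N.*2.+2]addn2 exprD -[leLHS]mul1r; apply: ler_pM => //.
    by apply: exprn_ege1; lra.
  by rewrite expr2; lra.
have T1 : T 1 = 2 * (b%:R - a%:R) / n%:R.
  rewrite /T /emp_term !expr1n !expr1 !mul1r -!natr1.
  by field; rewrite gt_eqF.
have D1 : 1 <= dev_coef_term n m 1 :> R.
  rewrite dev_coef_termE // expr1n mul1r !expr1 ler_pdivlMr; last by rewrite mulr_gt0 ?exprn_gt0.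
  by rewrite !exprS expr0 !mulr1 mul1r; nra.
have hb : b%:R - a%:R <= n%:R - 1 :> R.
  have : b.+1%:R <= n%:R :> R by rewrite ler_nat; apply: leq_ltn_trans abn; exact: leq_addl.
  by have := ler0n R a; rewrite -natr1; lra.
have h1 : T 1 <= 2 * (n%:R - 1) / n%:R.
  by rewrite T1 ler_pM2r ?invr_gt0 // ler_pM2l.
(* the slack W (2 / (20 n)) of the term k = 2 is at least 2 n / 5 *)
have h2 : 2 * (n%:R - 1) / n%:R <= 1 + W * (2 / (20 * n%:R)).
  rewrite ler_pdivrMr // (_ : (1 + W * (2 / (20 * n%:R))) * n%:R = n%:R + W / 10); last first.
    by field; rewrite gt_eqF.
  by have := sqr_ge0 (n%:R - 5 / 4 : R); rewrite !expr2 in W4 *; lra.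
have e : W * (2 / (4 * n%:R)) = W * (2 / (5 * n%:R)) + W * (2 / (20 * n%:R)).
  by field; rewrite gt_eqF.
rewrite e in D2.
move: T2 D2 h1 h2 D1; move: (W * (2 / (5 * n%:R))) (W * (2 / (20 * n%:R))) (2 * (n%:R - 1) / n%:R) (T 1) (T 2).
move: (dev_coef_term n m 1 : R) (dev_coef_term n m 2 : R) => x1 x2 y1 y2 z t1 t2 *; lra.
Qed.

End EmpWeight.

(** * Failure probability for orders at least four *)

Lemma count_mem2_le (T : eqType) (i j : T) s : i != j ->
  (count_mem i s + count_mem j s <= size s)%N.
Proof.
move=> ij; elim: s => //= x s IH; have [->|xi] := eqVneq x i.
  by rewrite (negbTE ij) add0n -addnA.
by rewrite add0n; case: (x == j) => /=; lia.
Qed.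

Section Model.
Context {R : realType} {I : finType} (w : I -> R).
Hypothesis w_ge0 : forall i, 0 <= w i.
Hypothesis w_sum1 : \sum_i w i = 1.

Definition emp (n m : nat) (s : seq I) : R := \sum_i emp_weight n m (count_mem i s).

Lemma weight_01 i : 0 <= w i <= 1.
Proof.
by rewrite w_ge0 /= -w_sum1 (bigD1 i) //= lerDl; apply: sumr_ge0 => j _.
Qed.

Lemma emp_bounded_diff n N s1 s2 i j : (1 < n)%N -> (size s1 + size s2).+1 = n ->
  emp n N.*2.+4 (s1 ++ i :: s2) - emp n N.*2.+4 (s1 ++ j :: s2) <= dev_coef n N.*2.+4.
Proof.
move=> n1 hn; have [->|ij] := eqVneq i j; first by rewrite subrr dev_coef_ge0 // ltnW.
pose b l := (count_mem l s1 + count_mem l s2)%N.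
have bE k l : count_mem l (s1 ++ k :: s2) = (b l + (k == l))%N.
  by rewrite count_cat /= /b addnAC -addnA.
have ji : j != i by rewrite eq_sym.
rewrite /emp -sumrB (bigD1 i) //= (bigD1 j) //= big1 ?addr0; last first.
  move=> l /andP[li lj]; rewrite !bE [i == l]eq_sym [j == l]eq_sym.
  by rewrite (negbTE li) (negbTE lj) subrr.
rewrite !bE !eqxx (negbTE ij) (negbTE ji) !addn0 !addn1.
apply: emp_weight_diff_le => //; rewrite -hn ltnS /b.
by apply: leq_trans (leq_add (count_mem2_le s1 ij) (count_mem2_le s2 ij)); rewrite addnACA.
Qed.

Lemma count_mem_le n (s : seq I) i : size s = n -> (count_mem i s <= n)%N.
Proof. by move=> <-; exact: count_size. Qed.

Lemma emp_ge0 n m s : size s = n -> 0 <= emp n m s.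
Proof. by move=> hs; apply: sumr_ge0 => i _; apply: emp_weight_ge0; exact: count_mem_le. Qed.

(** Only the term k = M of the empirical sum is kept. *)
Lemma iid_mean_emp_ge n M : (0 < n)%N -> (0 < M)%N ->
  \sum_i M%:R ^+ M / n%:R ^+ M * var_moment (w i) n M <= iid_mean w n (emp n M.*2).
Proof.
move=> n0 M0; have nn : 0 < n%:R :> R by rewrite ltr0n.
rewrite iid_mean_sum; apply: ler_sum => i _.
rewrite /var_moment -bin_meanZ -(iid_mean_count i n _ w_sum1); apply: iid_mean_le => // s hs.
have cn := count_mem_le i hs.
rewrite /emp_weight -muln2 mulnK // big_nat_recr //= -[leLHS]add0r; apply: lerD.
  by apply: sumr_ge0 => k _; exact: emp_term_ge0.
rewrite /emp_term muln2 -addnn addnK -expr_div_n -!exprMn; apply: le_of_eq; congr (_ ^+ M).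
by field; rewrite gt_eqF.
Qed.

Lemma sum_var_le1 : \sum_i w i * (1 - w i) <= 1.
Proof.
rewrite -[leRHS]w_sum1; apply: ler_sum => i _; have /andP[w0 w1] := weight_01 i.
by rewrite ler_piMr //; lra.
Qed.

(** [bin_moment_le_mix] summed over the alphabet; the variances of the
    indicators of the symbols add up to at most 1. *)
Lemma sum_moment_le n M : (1 < n)%N -> (1 < M)%N ->
  iid_mean w n (fun s => \sum_i ((count_mem i s)%:R - n%:R * w i) ^+ M.*2) <=
  n%:R / (n%:R - 1) * Num.max (iid_mean w n (emp n M.*2)) (dev_scale n M.*2).
Proof.
move=> n1 M1; have [a /andP[a0 a1] H] := @bin_moment_le_mix R n M n1 M1.
have n0' : 1 <= n%:R - 1 :> R by rewrite -(natrB _ (ltnW n1)) ler1n subn_gt0.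
have r0 : 0 <= n%:R / (n%:R - 1) :> R by rewrite divr_ge0; lra.
rewrite iid_mean_sum.
apply: le_trans (_ : \sum_i n%:R / (n%:R - 1) * (a * (M%:R ^+ M / n%:R ^+ M * var_moment (w i) n M) +
      (1 - a) * (w i * (1 - w i) * dev_scale n M.*2)) <= _).
  apply: ler_sum => i _.
  by rewrite (iid_mean_count i n (fun c => (c%:R - n%:R * w i) ^+ M.*2)) //; apply: H; exact: weight_01.
rewrite -mulr_sumr; apply: ler_wpM2l => //.
rewrite big_split -!mulr_sumr -mulr_suml /=.
have h1 := iid_mean_emp_ge (ltnW n1) (ltnW M1).
have S0 : 0 <= dev_scale n M.*2 :> R by rewrite mulr_ge0 ?sqrtr_ge0 // dev_coef_ge0 // ltnW.
have h2 := ler_wpM2r S0 sum_var_le1; rewrite mul1r in h2.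
set E := iid_mean w n _ in h1 *; set S : R := dev_scale n _ in h2 *.
have e1 : E <= Num.max E S by rewrite le_max lexx.
have e2 : S <= Num.max E S by rewrite le_max lexx orbT.
have := ler_wpM2l a0 (le_trans h1 e1).
have a10 : 0 <= 1 - a by lra.
have := ler_wpM2l a10 (le_trans h2 e2).
rewrite -!mulr_sumr => hh1 hh2; apply: le_trans (lerD hh2 hh1) _.
by rewrite -mulrDl addrC subrK mul1r.
Qed.

Section Deviation.
Variables (n m : nat) (d1 d2 : R).
Hypothesis n1 : (1 < n)%N.
Hypothesis d1_01 : 0 < d1 < 1.
Hypothesis d2_01 : 0 < d2 < 1.

(** The failure event, written without roots: m is even, so the sign of the
    deviation does not matter. *)
Definition far (s : seq I) : bool :=
  [exists i, d1^-1 * (n%:R / (n%:R - 1)) * (emp n m s + epsilon n m d2) <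
             ((count_mem i s)%:R - n%:R * w i) ^+ m].

Let L : R := ln (1 / d2).

Lemma ln_inv_ge : 1 - d2 <= L.
Proof.
have /andP[h0 h1] := d2_01.
have h := @le_ln1Dx R (d2 - 1); rewrite (_ : 1 + (d2 - 1) = d2) in h; last by ring.
have {}h : ln d2 <= d2 - 1 by apply: h; lra.
by rewrite /L div1r lnV ?posrE //; lra.
Qed.

Lemma ln_inv_gt0 : 0 < L.
Proof. by have := ln_inv_ge; have /andP[] := d2_01; lra. Qed.

Lemma epsilonE : epsilon n m d2 = Num.sqrt L * dev_scale n m.
Proof.
by rewrite /epsilon /dev_scale sqrtrM ?divr_ge0 // mulrA [Num.sqrt L * _]mulrC.
Qed.

Lemma epsilon_ge0 : 0 <= epsilon n m d2.
Proof. by rewrite epsilonE !mulr_ge0 ?sqrtr_ge0 // dev_coef_ge0 // ltnW. Qed.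

End Deviation.

(** If the mean of the empirical sum exceeds the deviation scale, it is the main
    term of the moment bound: up to epsilon it is estimated by the empirical sum
    (McDiarmid), and Markov's inequality applies. Otherwise the moment is at most
    r times the scale, Markov's inequality with epsilon alone gives
    delta1 / sqrt L, and L >= 1 - delta2 makes this at most delta1 + delta2. *)
Lemma far_prob_le_ge4 n N (d1 d2 : R) : (1 < n)%N -> 0 < d1 < 1 -> 0 < d2 < 1 ->
  iid_prob w n (far n N.*2.+4 d1 d2) <= d1 + d2.
Proof.
move=> n1 d1_01 d2_01; have /andP[d10 d11] := d1_01; have /andP[d20 d21] := d2_01.
have [hd|hd] := leP 1 (d1 + d2); first by apply: le_trans hd; exact: iid_prob_le1.
set m := N.*2.+4.
have n0 : 0 < n%:R :> R by rewrite ltr0n ltnW.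
have n0' : 1 <= n%:R - 1 :> R by rewrite -(natrB _ (ltnW n1)) ler1n subn_gt0.
set r : R := n%:R / (n%:R - 1); have r0 : 0 < r by rewrite divr_gt0 //; lra.
set L : R := ln (1 / d2); have L0 : 0 < L by exact: ln_inv_gt0.
have C0 : 0 < dev_coef n m :> R.
  have n0N : (0 < n)%N by exact: ltnW.
  have mh : (m %/ 2 = N.+2)%N by rewrite /m -!doubleS -muln2 mulnK.
  rewrite /dev_coef mh big_ltn // ltr_pwDl //; last first.
    by rewrite big_nat_cond; apply: sumr_ge0 => k /andP[/andP[k0 _] _]; apply: dev_coef_term_ge0 => //; exact: ltnW.
  by rewrite dev_coef_termE // expr1n mul1r !expr1 divr_gt0 ?mulr_gt0 ?exprn_gt0 // addr_gt0 ?mulr_gt0 ?exprn_gt0.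
set E := iid_mean w n (emp n m).
set S : R := dev_scale n m; have S0 : 0 < S by rewrite mulr_gt0 // sqrtr_gt0 divr_gt0.
pose Y s : R := \sum_i ((count_mem i s)%:R - n%:R * w i) ^+ m.
have mE : m = N.*2.+4 by [].
have mD : m = N.+2.*2 by [].
have xm (i : I) s : 0 <= ((count_mem i s)%:R - n%:R * w i : R) ^+ m.
  by rewrite mD -mul2n exprM exprn_ge0 // sqr_ge0.
have Y0 s : size s = n -> 0 <= Y s by move=> _; apply: sumr_ge0 => i _; exact: xm.
have farY s : far n m d1 d2 s -> d1^-1 * r * (emp n m s + epsilon n m d2) < Y s.
  move=> /existsP[i]; move=> /lt_le_trans; apply.
  by rewrite /Y (bigD1 i) //= lerDl; apply: sumr_ge0 => j _; exact: xm.
have hY := sum_moment_le n1 (isT : (1 < N.+2)%N).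
rewrite -/m -/r -/E -/S -/Y in hY.
(* d1^-1 r E is the Markov threshold when E dominates, d1^-1 r sqrt(L) S otherwise *)
have [ES|SE] := leP S E.
  rewrite (max_idPl ES) in hY; have E0 : 0 < E by exact: lt_le_trans ES.
  apply: le_trans (_ : iid_prob w n (fun s => (d1^-1 * r * E <= Y s) || (emp n m s <= E - epsilon n m d2)) <= _).
    apply: iid_prob_le => // s hs /farY h; apply/orP.
    have [|h2] := leP (emp n m s) (E - epsilon n m d2); [by right|left].
    apply: ltW; apply: le_lt_trans h; apply: ler_wpM2l; last by lra.
    by rewrite mulr_ge0 ?invr_ge0 // ltW.
  apply: le_trans (iid_probU w_ge0 _ _ _) _; apply: lerD.
    have := iid_markov w_ge0 (n := n) (A := fun s => d1^-1 * r * E <= Y s) (f := Y) (t := d1^-1 * r * E) Y0 (fun s _ h => h).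
    move=> h; have {}h := le_trans h hY.
    have rE : 0 < r * E by rewrite mulr_gt0.
    rewrite -(ler_pM2l rE) -[leRHS]mulr1 -!mulrA.
    have := ler_wpM2l (ltW d10) h; rewrite !mulrA divff ?gt_eqF // mul1r.
    by move=> h2; apply: (le_trans _ (le_trans h2 _)); apply: le_of_eq; ring.
  have hb s1 s2 i j := @emp_bounded_diff n N s1 s2 i j n1.
  have hm := mcdiarmid w_ge0 w_sum1 C0 (epsilon_ge0 m d2 n1) (ltnW n1) hb.
  apply: le_trans hm _.
  rewrite epsilonE -/L /dev_scale exprMn exprMn !sqr_sqrtr ?divr_ge0 //; last exact: ltW.
  have -> : - (2 * (L * (n%:R / 2 * dev_coef n m ^+ 2)) / (n%:R * dev_coef n m ^+ 2)) = - L :> R.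
    by field; rewrite !gt_eqF.
  by rewrite expRN lnK ?posrE ?divr_gt0 // div1r invrK.
rewrite (max_idPr (ltW SE)) in hY.
set q : R := Num.sqrt L.
have q0 : 0 < q by rewrite sqrtr_gt0.
apply: le_trans (_ : iid_prob w n (fun s => d1^-1 * r * (q * S) <= Y s) <= _).
  apply: iid_prob_le => // s hs /farY h.
  apply: ltW; apply: le_lt_trans h; apply: ler_wpM2l; first by rewrite mulr_ge0 ?invr_ge0 // ltW.
  by rewrite epsilonE lerDr emp_ge0.
have := iid_markov w_ge0 (n := n) (A := fun s => d1^-1 * r * (q * S) <= Y s) (f := Y) (t := d1^-1 * r * (q * S)) Y0 (fun s _ h => h).
move=> h; have {h} := le_trans h hY.
set p := iid_prob _ _ _ => h.
have rS : 0 < r * S by rewrite mulr_gt0.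
have h2 : q * p <= d1.
  rewrite -(ler_pM2l rS); have := ler_wpM2l (ltW d10) h.
  rewrite (_ : d1 * (d1^-1 * r * (q * S) * p) = r * S * (q * p)); last by field; rewrite gt_eqF.
  by rewrite [d1 * _]mulrC.
(* it remains to see that d1 / t <= d1 + d2 for t = sqrt(1 - d2) and d1 < t^2 *)
have u0 : 0 <= 1 - d2 by lra.
set t : R := Num.sqrt (1 - d2).
have t2 : t ^+ 2 = 1 - d2 by rewrite sqr_sqrtr.
have t0 : 0 < t by rewrite sqrtr_gt0; lra.
have tq : t <= q by rewrite ler_wsqrtr // ln_inv_ge.
have p0 : 0 <= p by exact: iid_prob_ge0.
have h3 : t * p <= d1 by apply: le_trans h2; rewrite ler_wpM2r.
have t1 : t <= 1 by rewrite -ler_sqr ?nnegrE ?ltW // t2 expr1n; lra.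
rewrite -(ler_pM2l t0); apply: le_trans h3 _.
rewrite expr2 in t2.
have : 0 <= (1 - t) * (t * t - d1) by rewrite mulr_ge0 //; lra.
have : 0 <= (1 - t) * t by rewrite mulr_ge0 //; lra.
have -> : d2 = 1 - t * t by lra.
by lra.
Qed.

End Model.

(** * The discordance of a sample as a U-statistic *)

Section Tuples.
Context {R : realType} {I : finType} (w : I -> R).
Implicit Types (f : seq I -> R).

(** The recursive expectation as a sum over all samples: a symmetric form, from
    which the invariance under permutations of the draws is read off. *)
Lemma iid_mean_tuple n f :
  iid_mean w n f = \sum_(t : n.-tuple I) (\prod_(j < n) w (tnth t j)) * f t.
Proof.
elim: n f => [|n IH] f.
  rewrite (big_pred1 [tuple]) ?big_ord0 ?mul1r // => t.
  by apply/esym/eqP; exact: tuple0.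
rewrite /= (reindex (fun u : I * n.-tuple I => cons_tuple u.1 u.2)) /=; last first.
  exists (fun t => (thead t, behead_tuple t)) => [[x t] _|t _] /=.
    by congr pair; apply: val_inj.
  by rewrite [RHS]tuple_eta; apply: val_inj.
under eq_bigr do rewrite IH mulr_sumr.
rewrite pair_big /=; apply: eq_bigr => -[x t] _ /=.
rewrite big_ord_recl /= tnth0 -!mulrA; congr (_ * (_ * _)).
by apply: eq_bigr => j _; rewrite tnthS.
Qed.

Definition permt n (s : 'S_n) (t : n.-tuple I) : n.-tuple I := [tuple tnth t (s j) | j < n].

Lemma iid_mean_perm n (s : 'S_n) f :
  iid_mean w n f = \sum_(t : n.-tuple I) (\prod_(j < n) w (tnth t j)) * f (permt s t).
Proof.
have inj : injective (permt s).
  move=> t u /(congr1 (fun v => tnth v)) e; apply: eq_from_tnth => j.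
  by have := congr1 (fun g => g ((s^-1)%g j)) e; rewrite !tnth_mktuple permKV.
rewrite iid_mean_tuple (reindex_inj inj) /=; apply: eq_bigr => t _; congr (_ * _).
rewrite [RHS](reindex_inj (@perm_inj _ s)) /=.
by apply: eq_bigr => j _; rewrite tnth_mktuple.
Qed.

End Tuples.

Section UStatistic.
Context {R : realType} {I : finType} (w : I -> R).
Hypothesis w_ge0 : forall i, 0 <= w i.
Hypothesis w_sum1 : \sum_i w i = 1.
Variable x0 : I.

Local Notation neq x y := (((x != y) : nat)%:R : R).

(** The probability that two independent draws differ. *)
Definition collision_free : R := 1 - \sum_i w i ^+ 2.
Local Notation V := collision_free.

Definition discordance (s : seq I) : R := \sum_(x <- s) \sum_(y <- s) neq x y.

(** Disjoint pairs of draws are independent, unlike those of the discordance. *)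
Definition matching n (s : seq I) : R :=
  \sum_(l < n./2) neq (nth x0 s l.*2) (nth x0 s l.*2.+1).

Lemma pair_mean : \sum_u w u.1 * w u.2 * neq u.1 u.2 = V.
Proof.
rewrite -(pair_bigA _ (fun i j => w i * w j * neq i j)) /=.
rewrite /collision_free -[1 in RHS]w_sum1 -sumrB; apply: eq_bigr => i _.
rewrite (bigD1 i) //= eqxx mulr0 add0r.
rewrite (eq_bigr (fun j => w i * w j)) => [|j ji]; last by rewrite eq_sym ji mulr1.
rewrite -mulr_sumr; have : \sum_j w j = w i + \sum_(j | j != i) w j by rewrite (bigD1 i).
by rewrite w_sum1 => e; rewrite (_ : \sum_(j | j != i) w j = 1 - w i); [ring|rewrite e; ring].
Qed.

(** Each of the n./2 independent pairs is a Bernoulli variable of mean V, to which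
    Hoeffding's lemma applies. *)
Lemma matching_mgf_le n (t : R) :
  iid_mean w n (fun s => expR (t * (matching n s - n./2%:R * V))) <= expR (n./2%:R * (t ^+ 2 / 8)).
Proof.
have [m] := ubnP n; elim: m n => // m IH [|[|n]] /ltnSE nm.
- by rewrite /matching /= big_ord0 !mul0r subrr mulr0.
- rewrite /= -[leRHS](iid_mean_cst w_sum1 1); apply: ler_sum => i _.
  by rewrite /matching /= big_ord0 !mul0r subrr mulr0.
have e i j s : expR (t * (matching n.+2 (i :: j :: s) - n.+2./2%:R * V)) =
    expR (t * (neq i j - V)) * expR (t * (matching n s - n./2%:R * V)).
  rewrite -expRD /matching big_ord_recl /=; congr expR.
  rewrite -[in LHS]natr1; rewrite (eq_bigr (fun l : 'I_n./2 => neq (nth x0 s l.*2) (nth x0 s l.*2.+1))) //.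
  by ring.
apply: le_trans (_ : \sum_i w i * (\sum_j w j * (expR (t * (neq i j - V)) * expR (n./2%:R * (t ^+ 2 / 8)))) <= _).
  apply: ler_sum => i _; apply: ler_wpM2l => //; apply: ler_sum => j _; apply: ler_wpM2l => //.
  rewrite -[leLHS]/(iid_mean w n (fun s => expR (t * (matching n.+2 (i :: j :: s) - n.+2./2%:R * V)))).
  rewrite (iid_mean_ext w (g := fun s => expR (t * (neq i j - V)) * expR (t * (matching n s - n./2%:R * V)))); last first.
    by move=> s _; rewrite -e.
  by rewrite iid_meanZ ler_wpM2l ?expR_ge0 //; apply: IH; exact: leq_trans nm.
rewrite (_ : n.+2./2%:R * _ = t ^+ 2 / 8 + n./2%:R * (t ^+ 2 / 8)); last by rewrite /= -natr1; ring.
rewrite expRD (eq_bigr (fun i => (\sum_j w i * w j * expR (t * (neq i j - V))) * expR (n./2%:R * (t ^+ 2 / 8)))); last first.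
  by move=> i _; rewrite mulr_suml mulr_sumr; apply: eq_bigr => j _; rewrite !mulrA.
rewrite -mulr_suml ler_wpM2r ?expR_ge0 // (pair_bigA _ (fun i j => w i * w j * expR (t * (neq i j - V)))) /=.
have := @hoeffding_mgf_le R _ (fun u : I * I => w u.1 * w u.2) _ _ (fun u => neq u.1 u.2) 1 t ltr01 _.
rewrite pair_mean expr1n mulr1; apply.
- by move=> u; exact: mulr_ge0.
- rewrite -(pair_bigA _ (fun i j => w i * w j)) /= (eq_bigr w) // => i _.
  by rewrite -mulr_sumr w_sum1 mulr1.
by move=> u u'; case: (_ != _); case: (_ != _); rewrite ?mulr1n ?mulr0n; lra.
Qed.

(** The symmetric group acts transitively on ordered pairs of distinct
    elements. *)
Lemma sum_perm_pair n (F : 'I_n -> 'I_n -> R) (a b a' b' : 'I_n) : a != b -> a' != b' ->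
  \sum_(s : 'S_n) F (s a) (s b) = \sum_(s : 'S_n) F (s a') (s b').
Proof.
move=> ab ab'; pose b1 := tperm a a' b.
have b1a : b1 != a' by rewrite /b1 -[X in _ != X](tpermL a a') (inj_eq perm_inj) eq_sym.
pose tau : 'S_n := (tperm a a' * tperm b1 b')%g.
have ta : tau a = a'.
  by rewrite permM tpermL tpermD // eq_sym.
have tb : tau b = b' by rewrite permM -/b1 tpermL.
rewrite (reindex_inj (mulgI tau)) /=.
by apply: eq_bigr => s _; rewrite -ta -tb !permM.
Qed.

Lemma sum_neq_const n (a : 'I_n) (c : R) : \sum_(b < n | b != a) c = (n%:R - 1) * c.
Proof.
have : \sum_(b < n) c = c + \sum_(b < n | b != a) c by rewrite (bigD1 a).
by rewrite sumr_const card_ord -[c *+ n]mulr_natl mulrBl mul1r => ->; rewrite addrAC subrr add0r.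
Qed.

(** Averaged over all orderings of the draws, the matching sees every pair
    equally often. *)
Lemma sum_perm_matching n (t : n.-tuple I) : (1 < n)%N ->
  n%:R * (n%:R - 1) * \sum_(s : 'S_n) matching n (permt s t) =
  n`!%:R * n./2%:R * discordance t.
Proof.
move=> n1.
pose F (a b : 'I_n) : R := neq (tnth t a) (tnth t b).
have FE : discordance t = \sum_a \sum_b F a b.
  by rewrite /discordance big_tuple; apply: eq_bigr => a _; rewrite big_tuple.
have F0 a : F a a = 0 by rewrite /F eqxx.
have n0 : (0 < n)%N by exact: ltnW.
pose a0 : 'I_n := Ordinal n0; pose b0 : 'I_n := Ordinal n1.
have ab0 : a0 != b0 by [].
have hS : n%:R * (n%:R - 1) * \sum_(s : 'S_n) F (s a0) (s b0) = n`!%:R * discordance t.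
  transitivity (\sum_(a < n) \sum_(b < n | b != a) \sum_(s : 'S_n) F (s a) (s b)).
    rewrite -[RHS](_ : \sum_(a < n) \sum_(b < n | b != a) \sum_(s : 'S_n) F (s a0) (s b0) = _); last first.
      by apply: eq_bigr => a _; apply: eq_bigr => b ba; apply: sum_perm_pair => //; rewrite eq_sym.
    rewrite [RHS](eq_bigr (fun=> (n%:R - 1) * \sum_(s : 'S_n) F (s a0) (s b0))); last first.
      by move=> a _; exact: sum_neq_const.
    by rewrite [RHS]sumr_const card_ord -[RHS]mulr_natl mulrA.
  transitivity (\sum_(s : 'S_n) discordance t); last by rewrite sumr_const card_Sn -[LHS]mulr_natl.
  transitivity (\sum_(s : 'S_n) \sum_(a < n) \sum_(b < n | b != a) F (s a) (s b)).
    rewrite [RHS]exchange_big; apply: eq_bigr => a _; rewrite exchange_big; apply: eq_bigr => //.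
  apply: eq_bigr => s _; rewrite FE [RHS](reindex_inj (@perm_inj _ s)) /=.
  apply: eq_bigr => a _; rewrite [RHS](reindex_inj (@perm_inj _ s)) /=.
  by rewrite [RHS](bigD1 a) //= F0 add0r.
rewrite [RHS]mulrAC -hS exchange_big /= (eq_bigr (fun=> \sum_(s : 'S_n) F (s a0) (s b0))); last first.
  move=> l _; have h2 : (l.*2.+1 < n)%N by have := ltn_ord l; have := half_leq (leqnn n); lia.
  have h1 : (l.*2 < n)%N by exact: ltnW.
  rewrite (@sum_perm_pair n F a0 b0 (Ordinal h1) (Ordinal h2)) //; last first.
    by apply/eqP => /(congr1 val) /=; lia.
  apply: eq_bigr => s _; rewrite /F.
  have -> : nth x0 (permt s t) l.*2 = tnth t (s (Ordinal h1)) by rewrite -(tnth_mktuple (fun j => tnth t (s j)) (Ordinal h1)) (tnth_nth x0).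
  have -> : nth x0 (permt s t) l.*2.+1 = tnth t (s (Ordinal h2)) by rewrite -(tnth_mktuple (fun j => tnth t (s j)) (Ordinal h2)) (tnth_nth x0).
  by [].
by rewrite sumr_const card_ord -mulr_natl; ring.
Qed.

Lemma expR_mean_le (T : finType) (g : T -> R) : (0 < #|T|)%N ->
  expR ((\sum_i g i) / #|T|%:R) <= (\sum_i expR (g i)) / #|T|%:R.
Proof.
move=> T0; have T0' : 0 < #|T|%:R :> R by rewrite ltr0n.
set mu := _ / _; rewrite ler_pdivlMr //.
have h i : expR mu * (1 + (g i - mu)) <= expR (g i).
  have -> : expR (g i) = expR mu * expR (g i - mu) by rewrite -expRD addrC subrK.
  rewrite ler_wpM2l ?expR_ge0 //.
  exact: expR_ge1Dx.
apply: le_trans (ler_sum _ (fun i _ => h i)).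
rewrite -mulr_sumr big_split sumrB /= !sumr_const.
have -> : mu *+ #|T| = \sum_i g i by rewrite -mulr_natr /mu divfK ?gt_eqF.
by rewrite subrr addr0.
Qed.

(** Hoeffding's argument for U-statistics: the discordance is an average over
    permutations of sums of independent variables, and Jensen's inequality
    bounds its exponential moment by that of a single matching. *)
Lemma discordance_mgf_le n (t : R) : (1 < n)%N ->
  iid_mean w n (fun s => expR (t * (n./2%:R * (discordance s / (n%:R * (n%:R - 1)) - V)))) <=
  expR (n./2%:R * (t ^+ 2 / 8)).
Proof.
move=> n1; have n0 : 0 < n%:R :> R by rewrite ltr0n ltnW.
have n0' : 1 <= n%:R - 1 :> R by rewrite -(natrB _ (ltnW n1)) ler1n subn_gt0.
apply: le_trans (matching_mgf_le n t).
have S0 : (0 < #|'S_n|)%N by rewrite card_Sn fact_gt0.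
have S0' : 0 < #|'S_n|%:R :> R by rewrite ltr0n.
pose G s := expR (t * (matching n s - n./2%:R * V)).
apply: le_trans (_ : (\sum_(s : 'S_n) iid_mean w n G) / #|'S_n|%:R <= _); last first.
  by rewrite sumr_const -[_ *+ _]mulr_natr mulfK ?gt_eqF.
rewrite (eq_bigr (fun s : 'S_n => \sum_(u : n.-tuple I) (\prod_(j < n) w (tnth u j)) * G (permt s u))); last first.
  by move=> s _; rewrite -iid_mean_perm.
rewrite iid_mean_tuple exchange_big mulr_suml /=; apply: ler_sum => u _.
rewrite -mulr_sumr -mulrA ler_wpM2l ?prodr_ge0 //.
apply: le_trans (expR_mean_le (fun s : 'S_n => t * (matching n (permt s u) - n./2%:R * V)) S0).
apply: le_of_eq; congr expR.
rewrite -mulr_sumr sumrB sumr_const -[_ *+ #|_|]mulr_natr card_Sn.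
have f0 : 0 < n`!%:R :> R by rewrite ltr0n fact_gt0.
have -> : \sum_(s : 'S_n) matching n (permt s u) = n`!%:R * n./2%:R * discordance u / (n%:R * (n%:R - 1)).
  rewrite -(sum_perm_matching u n1) [_ * \sum_(s : 'S_n) _]mulrC mulfK // mulf_neq0 ?gt_eqF //; lra.
by field; rewrite !gt_eqF //; lra.
Qed.

(** The lower tail; the factor n./2 instead of the n / 4 that bounded
    differences would give is essential for m = 2. *)
Lemma discordance_tail n (x : R) : (1 < n)%N -> 0 <= x ->
  iid_prob w n (fun s => discordance s / (n%:R - 1) <= n%:R * V - x) <=
  expR (- (2 * n./2%:R * x ^+ 2 / n%:R ^+ 2)).
Proof.
move=> n1 x_ge0; have n0 : 0 < n%:R :> R by rewrite ltr0n ltnW.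
have n0' : 1 <= n%:R - 1 :> R by rewrite -(natrB _ (ltnW n1)) ler1n subn_gt0.
set t : R := 4 * x / n%:R; have t0 : 0 <= t by rewrite divr_ge0 ?mulr_ge0 // ltW.
have h0 : 0 <= n./2%:R :> R by [].
have := discordance_mgf_le (- t) n1; set g := (fun s => expR _) => hg.
have hA s : size s = n -> discordance s / (n%:R - 1) <= n%:R * V - x ->
    expR (t * (n./2%:R * (x / n%:R))) <= g s.
  move=> _ hs; rewrite /g ler_expR mulNr -mulrN -mulrN; apply: ler_wpM2l => //; apply: ler_wpM2l => //.
  have : discordance s / (n%:R * (n%:R - 1)) <= V - x / n%:R.
    rewrite invfM mulrA mulrAC ler_pdivrMr //; apply: le_trans hs _; apply: le_of_eq.
    by field; rewrite gt_eqF.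
  by lra.
have h := le_trans (iid_markov w_ge0 (fun _ _ => expR_ge0 _) hA) hg.
have -> : - (2 * n./2%:R * x ^+ 2 / n%:R ^+ 2) = n./2%:R * ((- t) ^+ 2 / 8) - t * (n./2%:R * (x / n%:R)).
  by rewrite /t; field; rewrite !gt_eqF.
by rewrite expRD expRN ler_pdivlMr ?expR_gt0 // mulrC.
Qed.

Lemma sum_mem_count (g : I -> R) (s : seq I) : \sum_(x <- s) g x = \sum_i (count_mem i s)%:R * g i.
Proof.
elim: s => [|x s IH]; first by rewrite big_nil big1 // => i _; rewrite mul0r.
rewrite big_cons IH (bigD1 x) //= [RHS](bigD1 x) //= eqxx natrD mulrDl mul1r addrA; congr (_ + _).
by apply: eq_bigr => i ix; rewrite eq_sym (negbTE ix).
Qed.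

Lemma discordanceE (s : seq I) :
  discordance s = (size s)%:R ^+ 2 - \sum_i (count_mem i s)%:R ^+ 2.
Proof.
have e x : \sum_(y <- s) neq x y = (size s)%:R - (count_mem x s)%:R.
  elim: s => [|y s IH] /=; first by rewrite big_nil subrr.
  rewrite big_cons IH -natr1 natrD eq_sym; case: (y == x) => /=; ring.
rewrite /discordance (eq_bigr (fun x => (size s)%:R - (count_mem x s)%:R)) => [|x _]; last exact: e.
rewrite sumrB big_const_seq count_predT iter_addr_0 sum_mem_count -[_ *+ _]mulr_natl -expr2.
by congr (_ - _); apply: eq_bigr => i _; rewrite expr2.
Qed.

End UStatistic.

(** * Low moments of the deviations *)

Section SecondMoments.
Context {R : realType} {I : finType} (w : I -> R).
Hypothesis w_ge0 : forall i, 0 <= w i.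
Hypothesis w_sum1 : \sum_i w i = 1.
Variable n : nat.
Implicit Types (s : seq I).

Local Notation V := (collision_free w).
Local Notation x i s := ((count_mem i s)%:R - n%:R * w i).

(** The deviations enter the case m = 2 only through the sum of their squares
    and through their inner product with w. *)
Definition sqr_dev (s : seq I) : R := \sum_i x i s ^+ 2.
Definition lin_dev (s : seq I) : R := \sum_i w i * x i s.
(** The variance of the mass w y of a random symbol y. *)
Definition mass_var : R := \sum_i w i ^+ 3 - (\sum_i w i ^+ 2) ^+ 2.

Lemma emp2E s : (0 < n)%N -> emp n 2 s = \sum_i (count_mem i s)%:R * (n%:R - (count_mem i s)%:R) / n%:R :> R.
Proof.
move=> n0; have nn : n%:R != 0 :> R by rewrite pnatr_eq0 -lt0n.
apply: eq_bigr => i _; rewrite /emp_weight divnn /= big_nat1 /emp_term expr1n mul1r !expr1.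
by field.
Qed.

Lemma sum_count s : \sum_i (count_mem i s)%:R = (size s)%:R :> R.
Proof.
transitivity (\sum_(y <- s) (1 : R)); last by rewrite big_const_seq count_predT iter_addr_0.
by rewrite sum_mem_count; apply: eq_bigr => i _; rewrite mulr1.
Qed.

Lemma emp2_discordance s : (0 < n)%N -> size s = n -> emp n 2 s = discordance s / n%:R :> R.
Proof.
move=> n0 hs; rewrite emp2E // -mulr_suml discordanceE hs; congr (_ / _).
rewrite (eq_bigr (fun i => n%:R * (count_mem i s)%:R - (count_mem i s)%:R ^+ 2)); last by move=> i _; ring.
by rewrite sumrB -mulr_sumr sum_count hs expr2.
Qed.

(** Substituting c_i = n w_i + x_i in n - sum c_i^2 / n. *)
Lemma emp2_dev s : (0 < n)%N -> size s = n ->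
  emp n 2 s = n%:R * V - 2 * lin_dev s - sqr_dev s / n%:R.
Proof.
move=> n0 hs; have nn : n%:R != 0 :> R by rewrite pnatr_eq0 -lt0n.
rewrite emp2_discordance // discordanceE hs /lin_dev /sqr_dev /collision_free.
rewrite (eq_bigr (fun i => n%:R ^+ 2 * w i ^+ 2 + (2 * n%:R * (w i * x i s) + x i s ^+ 2))); last by move=> i _; ring.
rewrite !big_split /= -!mulr_sumr.
by move: (\sum_i w i ^+ 2) (\sum_i w i * _) (\sum_i _ ^+ 2) => a b c; field.
Qed.

Lemma sum_varE : \sum_i w i * (1 - w i) = V.
Proof.
by rewrite /collision_free -w_sum1 -sumrB; apply: eq_bigr => i _; rewrite w_sum1; ring.
Qed.

Lemma mean_sqr_dev : iid_mean w n sqr_dev = n%:R * V.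
Proof.
rewrite iid_mean_sum -sum_varE mulr_sumr; apply: eq_bigr => i _.
by rewrite (iid_mean_count i n (fun c => (c%:R - n%:R * w i) ^+ 2)) // bin_mean_sqr.
Qed.

Lemma iid_mean_additive (f : I -> R) k : \sum_i w i * f i = 0 ->
  iid_mean w k (fun s => \sum_(y <- s) f y) = 0.
Proof.
move=> f0; elim: k => [|k IH] /=; first by rewrite big_nil.
rewrite (eq_bigr (fun i => w i * f i)) // => i _.
rewrite (iid_mean_ext w (g := fun s => f i + \sum_(y <- s) f y)); last by move=> s _; rewrite big_cons.
by rewrite iid_meanD iid_mean_cst // IH addr0.
Qed.

Lemma iid_mean_additive_sqr (f : I -> R) k : \sum_i w i * f i = 0 ->
  iid_mean w k (fun s => (\sum_(y <- s) f y) ^+ 2) = k%:R * \sum_i w i * f i ^+ 2.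
Proof.
move=> f0; elim: k => [|k IH] /=; first by rewrite big_nil expr0n mul0r.
transitivity (\sum_i (w i * f i ^+ 2 + w i * (k%:R * \sum_i w i * f i ^+ 2))).
  apply: eq_bigr => i _; rewrite -mulrDr; congr (_ * _).
  rewrite (iid_mean_ext w (g := fun s => f i ^+ 2 + (2 * f i * (\sum_(y <- s) f y) + (\sum_(y <- s) f y) ^+ 2))); last first.
    by move=> s _; rewrite big_cons; ring.
  by rewrite !iid_meanD iid_mean_cst // iid_meanZ iid_mean_additive // mulr0 add0r IH.
by rewrite big_split -mulr_suml w_sum1 mul1r -natr1 /=; ring.
Qed.

Lemma lin_devE s : size s = n ->
  lin_dev s = \sum_(y <- s) (w y - \sum_i w i ^+ 2).
Proof.
move=> hs; rewrite sum_mem_count /lin_dev.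
under [RHS]eq_bigr do rewrite mulrBr.
rewrite sumrB -mulr_suml sum_count hs.
under eq_bigr do rewrite mulrBr.
rewrite sumrB; congr (_ - _); first by apply: eq_bigr => i _; rewrite mulrC.
by rewrite mulr_sumr; apply: eq_bigr => i _; ring.
Qed.

Lemma centered_mass : \sum_i w i * (w i - \sum_i w i ^+ 2) = 0.
Proof.
under eq_bigr do rewrite mulrBr.
rewrite sumrB -mulr_suml w_sum1 mul1r; apply/eqP; rewrite subr_eq0; apply/eqP.
by apply: eq_bigr => i _; rewrite expr2.
Qed.

Lemma mean_lin_dev : iid_mean w n lin_dev = 0.
Proof.
by rewrite (iid_mean_ext w lin_devE) iid_mean_additive // centered_mass.
Qed.

Lemma mean_lin_dev_sqr : iid_mean w n (fun s => lin_dev s ^+ 2) = n%:R * mass_var.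
Proof.
rewrite (iid_mean_ext w (g := fun s => (\sum_(y <- s) (w y - \sum_i w i ^+ 2)) ^+ 2)).
  rewrite iid_mean_additive_sqr ?centered_mass //; congr (_ * _).
  rewrite /mass_var; set a := \sum_i w i ^+ 2.
  rewrite (eq_bigr (fun i => w i ^+ 3 - 2 * a * w i ^+ 2 + a ^+ 2 * w i)); last by move=> i _; ring.
  rewrite big_split sumrB -!mulr_sumr -/a w_sum1 /=; ring.
by move=> s hs; rewrite lin_devE.
Qed.

Lemma collision_free_ge0 : 0 <= V.
Proof.
rewrite -sum_varE; apply: sumr_ge0 => i _; have /andP[? ?] := weight_01 w_ge0 w_sum1 i.
by rewrite mulr_ge0 // subr_ge0.
Qed.

(** The difference of the two sides is the sum of the nonnegative terms
    (w_i (1 - w_i))^2 and (sum_i w_i^2)^2 - sum_i w_i^4. *)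
Lemma mass_var_le : 2 * mass_var <= V * (1 - V).
Proof.
rewrite /mass_var /collision_free opprB addrCA subrr addr0.
have h : \sum_i w i ^+ 4 <= (\sum_i w i ^+ 2) ^+ 2.
  rewrite expr2 mulr_suml; apply: ler_sum => i _.
  rewrite (_ : w i ^+ 4 = w i ^+ 2 * w i ^+ 2); last by rewrite -exprD.
  rewrite ler_wpM2l ?sqr_ge0 // (bigD1 i) //= lerDl.
  by apply: sumr_ge0 => j _; exact: sqr_ge0.
have : 0 <= \sum_i (w i ^+ 2 - 2 * w i ^+ 3 + w i ^+ 4).
  apply: sumr_ge0 => i _.
  rewrite (_ : _ + _ = (w i * (1 - w i)) ^+ 2); first exact: sqr_ge0.
  by ring.
rewrite big_split sumrB -mulr_sumr /=.
by move: h; rewrite expr2; lra.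
Qed.

(** Each w_i (1 - w_i) is at most V / 2, since it is also at most the sum of
    the variances of the other symbols. *)
Lemma sum_var_sqr_le : \sum_i (w i * (1 - w i)) ^+ 2 <= V ^+ 2 / 2.
Proof.
rewrite [V ^+ 2]expr2 -[X in X * _ / _]sum_varE mulr_suml mulr_suml; apply: ler_sum => i _.
have w01 := weight_01 w_ge0 w_sum1.
have vi j : 0 <= w j * (1 - w j).
  by have /andP[? ?] := w01 j; rewrite mulr_ge0 // subr_ge0.
rewrite expr2 -[leRHS]mulrA; apply: ler_wpM2l; first exact: vi.
rewrite ler_pdivlMr // -sum_varE (bigD1 i) //= mulrDr mulr1 lerD2l.
have hi : 1 - w i = \sum_(j | j != i) w j.
  by rewrite -w_sum1 (bigD1 i) //= addrAC subrr add0r.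
rewrite {1}hi mulr_sumr; apply: ler_sum => j ji.
have /andP[wj0 wj1] := w01 j.
rewrite mulrC ler_wpM2l //.
have : w i + w j <= 1.
  rewrite -w_sum1 (bigD1 i) //= (bigD1 j) //= addrA lerDl.
  by apply: sumr_ge0.
by lra.
Qed.

(** Exact, since the slightly larger value given by [moment_bound] would not
    leave enough room below. *)
Lemma bin_fourth_moment p : bin_mean p n (fun c => (c%:R - n%:R * p) ^+ 4) =
  n%:R * (p * (1 - p)) * (1 + 3 * (n%:R - 2) * (p * (1 - p))) :> R.
Proof.
case: n => [|k]; first by rewrite /= mul0r subr0 expr0n !mul0r.
under bin_mean_ext do rewrite exprS.
rewrite bin_mean_stein; congr (_ * _).
rewrite (bin_mean_ext p (g := fun c => 3 * (c%:R - k%:R * p) ^+ 2 + (3 * (1 - 2 * p) * (c%:R - k%:R * p) + ((1 - p) ^+ 3 + p ^+ 3)))); last first.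
  by move=> c _; rewrite -!natr1; ring.
rewrite bin_meanD bin_meanZ bin_mean_sqr bin_meanD bin_mean_cst bin_meanZ.
rewrite (_ : bin_mean p k (fun c => c%:R - k%:R * p) = 0); first by rewrite -natr1; ring.
have -> : bin_mean p k (fun c => c%:R - k%:R * p) = bin_mean p k (fun c => (c%:R - k%:R * p) * 1).
  by apply: bin_mean_ext => c _; rewrite mulr1.
case: k => [|k]; first by rewrite /=; ring.
by rewrite bin_mean_stein subrr bin_mean_cst mulr0.
Qed.

Lemma mean_fourth_dev_le : (1 < n)%N ->
  iid_mean w n (fun s => \sum_i x i s ^+ 4) <=
  3 / 2 * (1 - 2 / n%:R) * (n%:R * V) ^+ 2 + n%:R * V.
Proof.
move=> n1; have n0 : 0 < n%:R :> R by rewrite ltr0n ltnW.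
have n2 : 2 <= n%:R :> R by rewrite ler_nat.
rewrite iid_mean_sum.
rewrite (eq_bigr (fun i => n%:R * (w i * (1 - w i)) + 3 * n%:R * (n%:R - 2) * (w i * (1 - w i)) ^+ 2)); last first.
  move=> i _; rewrite (iid_mean_count i n (fun c => (c%:R - n%:R * w i) ^+ 4)) // bin_fourth_moment.
  by ring.
rewrite big_split -!mulr_sumr sum_varE [leLHS]addrC lerD2r.
apply: le_trans (ler_wpM2l _ sum_var_sqr_le) _; first by rewrite !mulr_ge0 // subr_ge0.
by apply: le_of_eq; field; rewrite gt_eqF.
Qed.

End SecondMoments.

(** * Real inequalities for order two *)

Section OneVariable.
Context {R : realType}.
Implicit Types (a c t s : R).

Lemma expRN_tangent_ge c a t : c <= expR (- a) -> 0 <= c -> t <= 1 + a -> c * (1 + a - t) <= expR (- t).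
Proof.
move=> ca c0 ta; have h := expR_ge1Dx (a - t).
have -> : expR (- t) = expR (- a) * expR (a - t) by rewrite -expRD; congr expR; ring.
by apply: ler_pM => //; lra.
Qed.

Lemma expRN_nat_ge k : (367 / 1000) ^+ k <= expR (- k%:R) :> R.
Proof.
have h : 367 / 1000 <= expR (-1) :> R.
  have e1 := @expR1_le R; have y0 := expR_ge0 (-1 : R).
  have e : expR 1 * expR (-1) = 1 :> R by rewrite -expRD subrr expR0.
  by have := ler_wpM2r y0 e1; rewrite e; lra.
have c0 : 0 <= 367 / 1000 :> R by lra.
rewrite -[- _]mulN1r expRM_natr; apply: lerXn2r h; rewrite nnegrE; [exact: c0|exact: expR_ge0].
Qed.

(** The one-variable inequality to which the case m = 2 is reduced, with
    t = sqrt (2 log (1 / delta2)). It holds with a small margin, the smallest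
    being near t = 2.8. On four intervals the exponential is replaced by its
    tangent in t^2 / 2 at the integers 1 to 4, which leaves quartic polynomials
    that dominate their chords; for t > 3.1 the left-hand side is negative. *)
Lemma quartic_ge t : 7 / 10 <= t ->
  7 / 10 - 15 / 100 * t ^+ 2 + 7 / 30 * t <= expR (- (t ^+ 2 / 2)) * (t ^+ 2 / 2 + 1 + 3 * t).
Proof.
move=> t7; have B0 : 0 <= t ^+ 2 / 2 + 1 + 3 * t by have := sqr_ge0 t; lra.
have tt : t ^+ 2 = t * t by rewrite expr2.
have tangent c a : c <= expR (- a) -> 0 <= c -> t ^+ 2 / 2 <= 1 + a ->
   c * (1 + a - t ^+ 2 / 2) * (t ^+ 2 / 2 + 1 + 3 * t) <= expR (- (t ^+ 2 / 2)) * (t ^+ 2 / 2 + 1 + 3 * t).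
  by move=> h1 h2 h3; apply: ler_wpM2r => //; exact: expRN_tangent_ge.
have c1 : 36 / 100 <= expR (- 1) :> R.
  by have h : (367 / 1000) ^+ 1 <= expR (- 1) :> R := expRN_nat_ge 1; rewrite expr1 in h; lra.
have c2 : 13 / 100 <= expR (- 2%:R) :> R.
  apply: (le_trans _ (expRN_nat_ge 2)); rewrite expr2; lra.
have c3 : 49 / 1000 <= expR (- 3%:R) :> R.
  apply: (le_trans _ (expRN_nat_ge 3)); rewrite !exprS expr0; lra.
have c4 : 18 / 1000 <= expR (- 4%:R) :> R.
  apply: (le_trans _ (expRN_nat_ge 4)); rewrite !exprS expr0; lra.
have products t1 t2 : t1 <= t -> t <= t2 ->
    [/\ 0 <= (t - t1) * (t2 - t), 0 <= (t - t1) * (t2 - t) * t, 0 <= (t - t1) * (t2 - t) * t ^+ 2 &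
        0 <= (t - t1) * (t2 - t) * (t - t1)].
  move=> h1 h2; have uv : 0 <= (t - t1) * (t2 - t) by rewrite mulr_ge0 // subr_ge0.
  by split => //; apply: mulr_ge0 => //; rewrite ?sqr_ge0 ?subr_ge0 //; lra.
have sq t2 : 0 <= t2 -> t <= t2 -> t ^+ 2 <= t2 * t2.
  by move=> h1 h2; rewrite expr2; apply: ler_pM => //; lra.
have [h1|h1] := lerP t (175 / 100).
  have [q1 q2 q3 q4] := products _ _ t7 h1.
  have := sq _ _ h1 => /(_ _) s2.
  apply: (le_trans _ (tangent _ _ c1 _ _)); [|lra|have := s2 ltac:(lra); lra].
  by clear c1 c2 c3 c4 tangent products sq s2; rewrite !expr2 in q3 *; lra.
have [h2|h2] := lerP t (225 / 100).
  have [q1 q2 q3 q4] := products _ _ (ltW h1) h2.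
  have := sq _ _ h2 => /(_ _) s2.
  apply: (le_trans _ (tangent _ _ c2 _ _)); [|lra|have := s2 ltac:(lra); lra].
  by clear c1 c2 c3 c4 tangent products sq s2; rewrite !expr2 in q3 *; lra.
have [h3|h3] := lerP t (265 / 100).
  have [q1 q2 q3 q4] := products _ _ (ltW h2) h3.
  have := sq _ _ h3 => /(_ _) s2.
  apply: (le_trans _ (tangent _ _ c3 _ _)); [|lra|have := s2 ltac:(lra); lra].
  by clear c1 c2 c3 c4 tangent products sq s2; rewrite !expr2 in q3 *; lra.
have [h4|h4] := lerP t (31 / 10).
  have [q1 q2 q3 q4] := products _ _ (ltW h3) h4.
  have := sq _ _ h4 => /(_ _) s2.
  apply: (le_trans _ (tangent _ _ c4 _ _)); [|lra|have := s2 ltac:(lra); lra].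
  by clear c1 c2 c3 c4 tangent products sq s2; rewrite !expr2 in q3 *; lra.
have : 0 <= (t - 31 / 10) * t by rewrite mulr_ge0; lra.
clear c1 c2 c3 c4 tangent products sq => q1.
apply: le_trans (_ : 0 <= _); first by rewrite tt; lra.
by rewrite mulr_ge0 ?expR_ge0.
Qed.

End OneVariable.

Section RealInequalities.
Context {R : realType}.

(** The condition of [far2_covariance] for h = sqrt n / (2 (y - g)): dividing by
    sqrt n, the terms in V form the concave quadratic y V - c V^2, at most
    y^2 / (4 c), and the hypothesis on y^2 - 2 y g is what remains. *)
Lemma variance_tradeoff (V Var sn d1 d2 n y g c : R) :
  0 < sn -> n = sn ^+ 2 -> 0 < d1 + d2 < 1 -> 0 <= V -> 2 * Var <= V * (1 - V) ->
  g = (1 - d1) / sn - sn * d2 -> c = y - g -> 0 < c ->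
  2 * (d1 + d2) * (1 - (d1 + d2)) <= y ^+ 2 - 2 * y * g ->
  (1 - d1) * V + n * Var / (sn / (2 * c)) + (d1 + d2) * (1 - (d1 + d2)) * (sn / (2 * c)) <=
  n * d2 * V + sn * y / 2.
Proof.
move=> sn0 -> /andP[D0 D1] V0 hVar gE cE c0 hy.
have e1 : sn ^+ 2 * Var / (sn / (2 * c)) = sn * (c * (2 * Var)) by field; rewrite !gt_eqF.
have h1 := ler_wpM2l (ltW c0) hVar.
have e2 : (1 - d1) * V = sn * (g * V) + sn ^+ 2 * d2 * V by rewrite gE; field; rewrite gt_eqF.
have h2 : y * V - c * V ^+ 2 <= y ^+ 2 / (4 * c).
  rewrite ler_pdivlMr ?mulr_gt0 //.
  by have := sqr_ge0 (y - 2 * c * V); rewrite !expr2; lra.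
have h3 : y ^+ 2 / (4 * c) + (d1 + d2) * (1 - (d1 + d2)) / (2 * c) <= y / 2.
  rewrite (_ : _ + _ = (y ^+ 2 + 2 * (d1 + d2) * (1 - (d1 + d2))) / (4 * c)); last first.
    by field; rewrite gt_eqF.
  rewrite ler_pdivrMr ?mulr_gt0 //.
  by rewrite cE !expr2 in hy *; lra.
have h4 : g * V + c * (2 * Var) + (d1 + d2) * (1 - (d1 + d2)) / (2 * c) <= y / 2.
  apply: le_trans h3; rewrite lerD2r; apply: le_trans h2.
  have -> : y = g + c by rewrite cE; ring.
  by move: h1; rewrite !expr2; lra.
have := ler_wpM2l (ltW sn0) h4.
rewrite e1 e2 (_ : (d1 + d2) * (1 - (d1 + d2)) * (sn / (2 * c)) = sn * ((d1 + d2) * (1 - (d1 + d2)) / (2 * c))); last first.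
  by field; rewrite gt_eqF.
by move: ((d1 + d2) * (1 - (d1 + d2)) / (2 * c)) (2 * Var) => X Y; lra.
Qed.

(** After division by 2 (d1 + d2), the difference of the two sides increases with
    d1 and with sqrt n, and at d1 = 3 / 10 and sqrt n = 3 the inequality is
    [quartic_ge]. *)
Lemma deviation_feasible (d1 d2 t sn : R) :
  3 / 10 <= d1 -> 0 < d2 -> d1 + d2 < 1 -> d2 = expR (- (t ^+ 2 / 2)) -> 7 / 10 <= t -> 3 <= sn ->
  2 * (d1 + d2) * (1 - (d1 + d2)) <=
  ((d1 + d2) * t) ^+ 2 - 2 * ((d1 + d2) * t) * ((1 - d1) / sn - sn * d2).
Proof.
move=> h1 h2 h3 dE t7 sn3.
have hq := quartic_ge t7; rewrite -dE in hq.
set D : R := d1 + d2; have D0 : 0 < D by rewrite /D; lra.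
have hg : (1 - d1) / sn - sn * d2 <= (1 - d1) / 3 - 3 * d2.
  have i1 : (1 - d1) / sn <= (1 - d1) / 3.
    by apply: ler_wpM2l; [lra|rewrite lef_pV2 ?posrE //; lra].
  by have := ler_wpM2r (ltW h2) sn3; lra.
set g : R := _ - sn * d2 in hg *.
have ht : t * g <= t * ((1 - d1) / 3 - 3 * d2) by apply: ler_wpM2l => //; lra.
have hd : 0 <= (d1 - 3 / 10) * (t ^+ 2 / 2 + 1 + t / 3).
  by apply: mulr_ge0; [lra|have := sqr_ge0 t; lra].
have key : 1 - D <= D * t ^+ 2 / 2 - t * g.
  clear dE; clearbody g; rewrite /D; clear D D0; move: hq ht hd; move: (t * g) (t ^+ 2) => tg tt; lra.
have h := ler_wpM2l (ltW D0) key.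
rewrite [leRHS](_ : _ = 2 * (D * (D * t ^+ 2 / 2 - t * g))); last by field.
by move: h; move: (D * (D * t ^+ 2 / 2 - t * g)) => X; lra.
Qed.

(** The two hypotheses say that the fourth-moment bound fails against the
    fluctuation of the empirical sum and against its mean. If d1 were less than
    3 / 10, the first would bound W by 6 n / (n + 28), which contradicts the
    second. The bound L >= 1.1 d1, available once d1 >= 1 / 5, is needed for
    moderate n. *)
Lemma fourth_moment_feasible (n W d1 L : R) (r := n / (n - 1)) : 9 <= n -> 0 < W -> 0 < d1 ->
  d1 <= L -> (2 / 10 <= d1 -> 11 / 10 * d1 <= L) ->
  r / 2 * W ^+ 2 < d1 * (3 / 2 * (1 - 2 / n) * W ^+ 2 + W) ->
  r ^+ 2 * (n * L / 2) < d1 * (3 / 2 * (1 - 2 / n) * W ^+ 2 + W) ->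
  3 / 10 <= d1.
Proof.
move=> n9 W0 d10 dL dL2; have n0 : 0 < n by lra.
have m0 : 0 < n - 1 by lra.
have r1 : 1 + 1 / n <= r.
  rewrite /r ler_pdivlMr // (_ : (1 + 1 / n) * (n - 1) = n - 1 / n); last by field; rewrite gt_eqF.
  by rewrite gerBl divr_ge0 // ltW.
set i : R := 1 / n in r1 *; have i0 : 0 < i by rewrite divr_gt0.
have ni : n * i = 1 by rewrite /i mul1r divff // gt_eqF.
rewrite (_ : 2 / n = 2 * i); last by rewrite /i mul1r.
clearbody r => hA hB; clearbody i.
have hA' : r / 2 * W < d1 * (3 / 2 * (1 - 2 * i) * W + 1).
  rewrite -(ltr_pM2r W0); move: hA; rewrite expr2; lra.
have i9 : i <= 1 / 9.
  have : 9 * i <= n * i by rewrite ler_pM2r. 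
  by rewrite ni; lra.
have r2 : 1 + 2 * i <= r ^+ 2.
  have i1 : 0 <= 1 + i by clear -i0; lra.
  have r0 : 0 <= r by exact: le_trans i1 r1.
  have h : (1 + i) ^+ 2 <= r ^+ 2 by apply: lerXn2r r1; rewrite nnegrE.
  by apply: le_trans h; have := sqr_ge0 i; rewrite !expr2; lra.
have rn : n + 2 <= r ^+ 2 * n.
  by have := ler_wpM2r (ltW n0) r2; move: (r ^+ 2) => rr; lra.
rewrite leNgt; apply/negP => d3.
have Wq : 0 < 3 / 2 * (1 - 2 * i) * W + 1.
  by apply: ltr_wpDl => //; apply: mulr_ge0; [|exact: ltW]; lra.
have WW : 0 < W * W by rewrite mulr_gt0.
have iW : 0 < i * W by rewrite mulr_gt0.
have [d2|d2] := ltP d1 (2 / 10).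
  have a1 : r / 2 * W < 2 / 10 * (3 / 2 * (1 - 2 * i) * W + 1).
    by apply: lt_trans hA' _; rewrite ltr_pM2r.
  have rW : (1 + i) * W <= r * W by rewrite ler_pM2r.
  have W1 : W < 1 by lra.
  have a2 : d1 * (r ^+ 2 * n / 2) <= r ^+ 2 * (n * L / 2).
    rewrite (_ : r ^+ 2 * (n * L / 2) = L * (r ^+ 2 * n / 2)); last by ring.
    by apply: ler_wpM2r => //; lra.
  have a3 : r ^+ 2 * n / 2 < 3 / 2 * (1 - 2 * i) * W ^+ 2 + W.
    by rewrite -(ltr_pM2l d10); exact: le_lt_trans hB.
  have : W * W < 1 by have := ltr_pM (ltW W0) (ltW W0) W1 W1; lra.
  have : 0 < i * (W * W) by rewrite mulr_gt0.
  by move: a3; rewrite [W ^+ 2]expr2; lra.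
have {}dL2 := dL2 d2.
have a1 : r / 2 * W < 3 / 10 * (3 / 2 * (1 - 2 * i) * W + 1).
  by apply: lt_trans hA' _; rewrite ltr_pM2r.
have rW : (1 + i) * W <= r * W by rewrite ler_pM2r.
have hW : W * (1 + 28 * i) < 6 by lra.
have a2 : d1 * (11 / 10 * (r ^+ 2 * n / 2)) <= r ^+ 2 * (n * L / 2).
  rewrite (_ : d1 * _ = 11 / 10 * d1 * (r ^+ 2 * n / 2)); last by ring.
  rewrite (_ : r ^+ 2 * (n * L / 2) = L * (r ^+ 2 * n / 2)); last by ring.
  by apply: ler_wpM2r => //; lra.
have a3 : 11 / 10 * (r ^+ 2 * n / 2) < 3 / 2 * (1 - 2 * i) * W ^+ 2 + W.
  by rewrite -(ltr_pM2l d10); exact: le_lt_trans hB.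
have a4 : 11 / 20 * (n + 2) < 3 / 2 * (1 - 2 * i) * W ^+ 2 + W by lra.
have n28 : 0 < n + 28 by lra.
have hW' : W * (n + 28) <= 6 * n.
  have := ler_wpM2r (ltW n0) (ltW hW); rewrite (_ : W * (1 + 28 * i) * n = W * (n + 28 * (n * i))); last by ring.
  by rewrite ni mulr1.
have b1 : W * (n + 28) * (W * (n + 28)) <= 6 * n * (6 * n).
  by apply: ler_pM => //; rewrite mulr_ge0 ?ltW.
have b2 : W * (n + 28) * (n + 28) <= 6 * n * (n + 28) by rewrite ler_wpM2r // ltW.
have b3 : 11 / 20 * (n + 2) * ((n + 28) * (n + 28)) < 3 / 2 * (1 - 2 * i) * (6 * n * (6 * n)) + 6 * n * (n + 28).
  have q : 0 < (n + 28) * (n + 28) by rewrite mulr_gt0.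
  have a5 : 11 / 20 * (n + 2) * ((n + 28) * (n + 28)) < (3 / 2 * (1 - 2 * i) * W ^+ 2 + W) * ((n + 28) * (n + 28)) by rewrite ltr_pM2r.
  apply: lt_le_trans a5 _.
  rewrite (_ : _ * ((n + 28) * (n + 28)) = 3 / 2 * (1 - 2 * i) * (W * (n + 28) * (W * (n + 28))) + W * (n + 28) * (n + 28)); last by ring.
  by apply: lerD => //; apply: ler_wpM2l => //; lra.
have b4 : 3 / 2 * (1 - 2 * i) * (6 * n * (6 * n)) = 54 * n * n - 108 * n.
  rewrite (_ : _ * (6 * n * (6 * n)) = 54 * n * n - 108 * n * (n * i)); last by field.
  by rewrite ni mulr1.
rewrite b4 in b3.
have : 0 <= (n - 26) ^+ 2 * n by rewrite mulr_ge0 ?sqr_ge0 // ltW.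
have := mulr_gt0 n0 n0; rewrite !expr2 => e1 e2.
by lra.
Qed.

End RealInequalities.

(** * Failure probability for order two *)

Section Two.
Context {R : realType} {I : finType} (w : I -> R).
Hypothesis w_ge0 : forall i, 0 <= w i.
Hypothesis w_sum1 : \sum_i w i = 1.
Variable x0 : I.
Variables (n : nat) (d1 d2 : R).
Hypothesis n1 : (1 < n)%N.
Hypothesis d1_gt0 : 0 < d1.
Hypothesis d2_gt0 : 0 < d2.
Hypothesis d_lt1 : d1 + d2 < 1.

Local Notation x i s := ((count_mem i s)%:R - n%:R * w i).
(** The notions used throughout the case m = 2: L = log (1 / delta2), the mean
    n V of the U-statistic, the factor r = n / (n - 1), the smaller value
    sqrt (n L / 2) of epsilon, and epsilon itself. *)
Definition log_inv_d2 : R := ln (1 / d2).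
Definition mean_ustat : R := n%:R * collision_free w.
Definition ratio : R := n%:R / (n%:R - 1).
Definition eps_low : R := Num.sqrt (n%:R * log_inv_d2 / 2).
Definition eps2 : R := epsilon n 2 d2.

Let d2_01 : 0 < d2 < 1.
Proof. by rewrite d2_gt0 /=; apply: le_lt_trans d_lt1; rewrite lerDr ltW. Qed.

Let n0 : 0 < n%:R :> R.
Proof. by rewrite ltr0n ltnW. Qed.

Let n0' : 1 <= n%:R - 1 :> R.
Proof. by rewrite -(natrB _ (ltnW n1)) ler1n subn_gt0. Qed.

(** Linear arithmetic from the standing facts of the section, which have to be
    put in the goal. *)
Ltac ctx_lra := have := n0; have := n0'; lra.

Let L_gt0 : 0 < log_inv_d2.
Proof. exact: ln_inv_gt0. Qed.

Let expL : expR (- log_inv_d2) = d2.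
Proof. by rewrite expRN lnK ?posrE ?divr_gt0 // div1r invrK. Qed.

Let r_gt0 : 0 < ratio.
Proof. by rewrite divr_gt0 //; ctx_lra. Qed.

Let W_ge0 : 0 <= mean_ustat.
Proof. by rewrite mulr_ge0 ?collision_free_ge0 // ltW. Qed.

Let e0_gt0 : 0 < eps_low.
Proof. by rewrite sqrtr_gt0 divr_gt0 // mulr_gt0. Qed.

Let e0_sqr : eps_low ^+ 2 = n%:R * log_inv_d2 / 2.
Proof. by rewrite sqr_sqrtr // divr_ge0 // mulr_ge0 // ltW. Qed.

Ltac ctx_lra ::= have := n0; have := n0'; have := L_gt0; have := r_gt0; have := W_ge0; have := e0_gt0; have := d1_gt0; have := d2_gt0; have := d_lt1; lra.

Lemma epsilon2E : eps2 = eps_low * (1 + 24 / n%:R ^+ 2).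
Proof.
have -> : eps2 = Num.sqrt (n%:R / 2 * log_inv_d2) * dev_coef n 2 by [].
rewrite /eps_low mulrAC; congr (_ * _).
have -> : dev_coef n 2 = dev_coef_term n 2 1 :> R by rewrite /dev_coef big_nat1.
rewrite dev_coef_termE; [|by []|exact: ltnW].
by rewrite !expr1n !expr1; field; rewrite gt_eqF ?n0.
Qed.

Let eps_ge : eps_low <= eps2.
Proof.
by rewrite epsilon2E ler_peMr ?ltW // ltrDl divr_gt0 // exprn_gt0.
Qed.

(** The unbiased estimator of n V; it is r times the empirical sum. *)
Definition ustat (s : seq I) : R := discordance s / (n%:R - 1).

Lemma ustat_ge0 s : 0 <= ustat s.
Proof.
apply: divr_ge0; last by ctx_lra.
by apply: sumr_ge0 => y _; apply: sumr_ge0 => z _; exact: ler0n.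
Qed.

Lemma far2_exists s : size s = n -> far w n 2 d1 d2 s ->
  exists i, d1^-1 * (ustat s + ratio * eps2) < x i s ^+ 2.
Proof.
move=> hs /existsP[i hi]; exists i; apply: le_lt_trans hi.
rewrite -mulrA (emp2_discordance (ltnW n1) hs) -/ratio; apply: le_of_eq; congr (_ * _); rewrite mulrDr; congr (_ + _).
by rewrite /ustat /ratio; field; rewrite !gt_eqF //; ctx_lra.
Qed.

Lemma far2_sqr_dev s : size s = n -> far w n 2 d1 d2 s ->
  ustat s + ratio * eps2 < d1 * sqr_dev w n s.
Proof.
move=> hs /(far2_exists hs)[i hi]; rewrite -ltr_pdivrMl //; apply: lt_le_trans hi _.
by rewrite /sqr_dev (bigD1 i) //= lerDl; apply: sumr_ge0 => j _; exact: sqr_ge0.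
Qed.

Lemma ustat_tail y : 0 <= y -> log_inv_d2 <= 2 * (n./2)%:R * y ^+ 2 / n%:R ^+ 2 ->
  iid_prob w n (fun s => ustat s <= mean_ustat - y) <= d2.
Proof.
move=> y0 hL; apply: le_trans (discordance_tail w_ge0 w_sum1 x0 n1 y0) _.
by rewrite -expL ler_expR lerN2.
Qed.

(** For n <= 8 the U-statistic exceeds its mean minus r epsilon outside an event
    of probability delta2, thanks to the term 24 / n^2 of epsilon; Markov's
    inequality for the sum of squares concludes. *)
Lemma far2_small_sample : (n < 9)%N -> iid_prob w n (far w n 2 d1 d2) <= d1 + d2.
Proof.
move=> n9.
have re0 : 0 < ratio * eps2 by rewrite mulr_gt0 // (lt_le_trans e0_gt0).
set Z := Num.max mean_ustat (ratio * eps2).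
have Z0 : 0 < Z by rewrite lt_max re0 orbT.
apply: le_trans (_ : iid_prob w n (fun s => (Z <= d1 * sqr_dev w n s) || (ustat s <= mean_ustat - ratio * eps2)) <= _).
  apply: iid_prob_le => // s hs /(far2_sqr_dev hs) h; apply/orP.
  have [|h2] := leP (ustat s) (mean_ustat - ratio * eps2); [by right|left].
  by rewrite /Z ge_max; apply/andP; split; have := ustat_ge0 s; ctx_lra.
apply: le_trans (iid_probU w_ge0 _ _ _) _; apply: lerD.
  have h : Z * iid_prob w n (fun s => Z <= d1 * sqr_dev w n s) <= iid_mean w n (fun s => d1 * sqr_dev w n s).
    apply: iid_markov => // s _; apply: mulr_ge0; first exact: ltW.
    by apply: sumr_ge0 => i _; exact: sqr_ge0.
  rewrite -(ler_pM2l Z0); apply: le_trans h _.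
  rewrite iid_meanZ mean_sqr_dev // -/mean_ustat mulrC ler_wpM2r //; first exact: ltW.
  by rewrite le_max lexx.
apply: ustat_tail; first exact: ltW.
have -> : (ratio * eps2) ^+ 2 = ratio ^+ 2 * (n%:R * log_inv_d2 / 2) * (1 + 24 / n%:R ^+ 2) ^+ 2.
  by rewrite epsilon2E -e0_sqr; move: (1 + 24 / _) => C; ring.
rewrite [leRHS](_ : _ = log_inv_d2 * (n./2%:R * n%:R * (1 + 24 / n%:R ^+ 2) ^+ 2 / (n%:R - 1) ^+ 2)); last first.
  by rewrite /ratio; field; rewrite !gt_eqF //; ctx_lra.
rewrite (ler_peMr (ltW L_gt0)) // ler_pdivlMr ?mul1r; last by rewrite exprn_gt0 //; ctx_lra.
by move: n1 n9; case: n => [|[|[|[|[|[|[|[|[|]]]]]]]]] //= _ _; rewrite !expr2; ctx_lra.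
Qed.

Section LargeSample.
Hypothesis n9 : (9 <= n)%N.

Let n9R : 9 <= n%:R :> R.
Proof. by rewrite ler_nat. Qed.

Ltac ctx_lra ::= have := n9R; have := n0'; have := L_gt0; have := r_gt0; have := W_ge0; have := e0_gt0; have := d1_gt0; have := d2_gt0; have := d_lt1; lra.

Let r1 : 1 <= ratio.
Proof. by rewrite ler_pdivlMr; ctx_lra. Qed.

Let r2 : ratio <= 2.
Proof. by rewrite ler_pdivrMr; ctx_lra. Qed.

Let half_n : n%:R - 1 <= 2 * n./2%:R :> R.
Proof.
rewrite -[X in X%:R - _](odd_double_half n) natrD -mul2n natrM.
by case: (odd n) => /=; ctx_lra.
Qed.

Ltac ctx_lra ::= have := n9R; have := half_n; have := r1; have := r2; have := n0'; have := L_gt0; have := r_gt0; have := W_ge0; have := e0_gt0; have := d1_gt0; have := d2_gt0; have := d_lt1; lra.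

Definition fourth_bound : R := 3 / 2 * (1 - 2 / n%:R) * mean_ustat ^+ 2 + mean_ustat.

(** With probability at least 1 - delta2 the U-statistic plus r epsilon is at
    least Z, and Markov's inequality for the fourth powers bounds the event that
    a squared deviation exceeds Z / delta1. *)
Lemma far2_fourth_moment (Z : R) : Z = Num.max (ratio * eps_low) (mean_ustat - (Num.sqrt (2 * ratio) - ratio) * eps_low) ->
  d1 * fourth_bound <= Z ^+ 2 -> iid_prob w n (far w n 2 d1 d2) <= d1 + d2.
Proof.
move=> ZE hZ.
have Z0 : 0 < Z by rewrite ZE lt_max mulr_gt0.
apply: le_trans (_ : iid_prob w n (fun s => (d1^-1 ^+ 2 * Z ^+ 2 <= \sum_i x i s ^+ 4) ||
   (ustat s <= mean_ustat - Num.sqrt (2 * ratio) * eps_low)) <= _).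
  apply: iid_prob_le => // s hs /(far2_exists hs)[i h]; apply/orP.
  have [|h2] := leP (ustat s) (mean_ustat - Num.sqrt (2 * ratio) * eps_low); [by right|left].
  have h3 : Z <= ustat s + ratio * eps2.
    have : ratio * eps_low <= ratio * eps2 by rewrite ler_pM2l.
    by have := ustat_ge0 s; rewrite ZE ge_max => *; apply/andP; split; ctx_lra.
  have h4 : d1^-1 * Z <= x i s ^+ 2.
    by apply: ltW; apply: le_lt_trans h; rewrite ler_pM2l ?invr_gt0.
  apply: le_trans (_ : x i s ^+ 4 <= _); last first.
    by rewrite (bigD1 i) //= lerDl; apply: sumr_ge0 => j _; rewrite (exprM _ 2 2) sqr_ge0.
  rewrite -exprMn (exprM _ 2 2); apply: lerXn2r h4; rewrite nnegrE ?sqr_ge0 //.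
  by rewrite mulr_ge0 ?invr_ge0 // ltW.
apply: le_trans (iid_probU w_ge0 _ _ _) _; apply: lerD.
  have Z2 : 0 < d1^-1 ^+ 2 * Z ^+ 2 by rewrite mulr_gt0 // exprn_gt0 // invr_gt0.
  have h : d1^-1 ^+ 2 * Z ^+ 2 * iid_prob w n (fun s => d1^-1 ^+ 2 * Z ^+ 2 <= \sum_i x i s ^+ 4) <=
      iid_mean w n (fun s => \sum_i x i s ^+ 4).
    apply: iid_markov => // s _.
    by apply: sumr_ge0 => i _; rewrite (exprM _ 2 2) sqr_ge0.
  rewrite -(ler_pM2l Z2); apply: le_trans h _; apply: le_trans (mean_fourth_dev_le w_ge0 w_sum1 n1) _.
  rewrite -/mean_ustat -/fourth_bound (_ : d1^-1 ^+ 2 * Z ^+ 2 * d1 = Z ^+ 2 / d1); last by field; rewrite gt_eqF.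
  by rewrite ler_pdivlMr // mulrC.
apply: ustat_tail; first by rewrite mulr_ge0 ?sqrtr_ge0 // ltW.
rewrite exprMn sqr_sqrtr; last by rewrite mulr_ge0 // ltW.
rewrite e0_sqr [leRHS](_ : _ = log_inv_d2 * (2 * n./2%:R / (n%:R - 1))); last first.
  by rewrite /ratio; field; rewrite !gt_eqF //; ctx_lra.
by rewrite (ler_peMr (ltW L_gt0)) // ler_pdivlMr ?mul1r //; ctx_lra.
Qed.

(** The empirical sum is W - 2 Lam - S / n, so that failure forces a linear
    combination of S and Lam to be large. As 2 (Lam + k) <= (Lam + k)^2 / h + h,
    failure forces the nonnegative quadratic G above den, and a single
    application of Markov's inequality to G suffices. The shift k = D h is the
    one that makes the condition on h smallest. *)
Lemma far2_covariance (h D V : R) : 0 < h -> D = d1 + d2 -> V = collision_free w ->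
  (1 - d1) * V + n%:R * mass_var w / h + D * (1 - D) * h <= n%:R * d2 * V + D * eps_low ->
  iid_prob w n (far w n 2 d1 d2) <= D.
Proof.
move=> h0 eD VE hyp.
have D0 : 0 < D by rewrite eD addr_gt0.
pose k : R := D * h; pose A : R := d1 * (1 - n%:R^-1) + n%:R^-1.
have i0 : 0 < n%:R^-1 :> R by rewrite invr_gt0.
have i1 : n%:R^-1 <= 1 :> R by rewrite invf_le1 // ler1n ltnW.
have A0 : 0 <= A.
  by apply: addr_ge0; [apply: mulr_ge0; [exact: ltW|rewrite subr_ge0]|exact: ltW].
pose G s := A * sqr_dev w n s + h^-1 * (lin_dev w n s + k) ^+ 2.
pose den : R := mean_ustat + eps_low - h + 2 * k.
have EG : iid_mean w n G = A * mean_ustat + h^-1 * (n%:R * mass_var w + k ^+ 2).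
  rewrite iid_meanD !iid_meanZ mean_sqr_dev // -/mean_ustat; congr (_ + _ * _).
  rewrite (iid_mean_ext w (g := fun s => lin_dev w n s ^+ 2 + (2 * k * lin_dev w n s + k ^+ 2))); last by move=> s _; ring.
  by rewrite !iid_meanD iid_meanZ mean_lin_dev // mean_lin_dev_sqr // iid_mean_cst // mulr0 add0r.
have eW : mean_ustat = n%:R * V by rewrite VE.
have hEG : iid_mean w n G <= D * den.
  rewrite EG.
  have -> : A * mean_ustat = d1 * mean_ustat + (1 - d1) * V.
    by rewrite /A /mean_ustat -VE; field; rewrite gt_eqF.
  have -> : h^-1 * (n%:R * mass_var w + k ^+ 2) = n%:R * mass_var w / h + D ^+ 2 * h.
    by rewrite /k; field; rewrite gt_eqF.
  rewrite /den /k; move: hyp; rewrite eW.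
  move: (n%:R * mass_var w / h) => X; rewrite !expr2 => hyp.
  have -> : d1 = D - d2 by rewrite eD; ring.
  move: hyp; have -> : 1 - d1 = 1 - (D - d2) by rewrite eD; ring.
  by lra.
have G0 s : size s = n -> 0 <= G s.
  move=> _; apply: addr_ge0; apply: mulr_ge0 => //; rewrite ?sqr_ge0 ?invr_ge0 //; last exact: ltW.
  by apply: sumr_ge0 => i _; exact: sqr_ge0.
have den0 : 0 < den.
  rewrite -(pmulr_rgt0 _ D0); apply: lt_le_trans hEG; rewrite EG.
  have hv : 0 <= n%:R * mass_var w.
    rewrite -mean_lin_dev_sqr //; apply: iid_mean_ge0 => // s _; exact: sqr_ge0.
  have k0 : 0 < k ^+ 2 by rewrite exprn_gt0 // mulr_gt0.
  apply: ltr_wpDl; first exact: mulr_ge0.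
  by rewrite mulr_gt0 ?invr_gt0 //; ctx_lra.
apply: le_trans (_ : iid_prob w n (fun s => den <= G s) <= _).
  apply: iid_prob_le => // s hs /existsP[i].
  rewrite (emp2_dev w (ltnW n1) hs) -VE => hi.
  have h1 : n%:R * V - 2 * lin_dev w n s - sqr_dev w n s / n%:R + eps2 < d1 * (1 - n%:R^-1) * sqr_dev w n s.
    have xs : x i s ^+ 2 <= sqr_dev w n s.
      by rewrite /sqr_dev (bigD1 i) //= lerDl; apply: sumr_ge0 => j _; exact: sqr_ge0.
    have := lt_le_trans hi xs.
    have q0 : 0 < d1 * (1 - n%:R^-1).
      by rewrite mulr_gt0 // subr_gt0 invf_lt1 // ltr1n.
    rewrite -(ltr_pM2l q0); set B := _ + epsilon _ _ _.
    rewrite (_ : d1 * (1 - n%:R^-1) * (d1^-1 * (n%:R / (n%:R - 1)) * B) = B) //.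
    by field; rewrite !gt_eqF //; ctx_lra.
  have h2 : 2 * (lin_dev w n s + k) <= h^-1 * (lin_dev w n s + k) ^+ 2 + h.
    have e : h^-1 * (lin_dev w n s + k) ^+ 2 + h - 2 * (lin_dev w n s + k) = h^-1 * (lin_dev w n s + k - h) ^+ 2.
      by field; rewrite gt_eqF.
    by rewrite -subr_ge0 e mulr_ge0 ?sqr_ge0 // invr_ge0 ltW.
  rewrite /den /G /A.
  move: h1 h2 eps_ge; rewrite -eW.
  move: (h^-1 * (lin_dev w n s + k) ^+ 2) (sqr_dev w n s) (lin_dev w n s) => X Y Z' h1 h2 h3.
  by ctx_lra.
have := iid_markov w_ge0 (A := fun s => den <= G s) (f := G) (t := den) G0 (fun s _ h => h) => hm.
rewrite -(ler_pM2l den0); apply: le_trans hm (le_trans hEG _).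
by rewrite mulrC.
Qed.

(** Either the fourth moment is small enough, or delta1 >= 3 / 10 and the
    quadratic of [far2_covariance] is. *)
Lemma far2_large_sample : iid_prob w n (far w n 2 d1 d2) <= d1 + d2.
Proof.
set Z : R := Num.max (ratio * eps_low) (mean_ustat - (Num.sqrt (2 * ratio) - ratio) * eps_low).
have [hZ|hZ] := leP (d1 * fourth_bound) (Z ^+ 2); first exact: (@far2_fourth_moment Z).
have Zr : ratio * eps_low <= Z by rewrite le_max lexx.
have re : 0 < ratio * eps_low by rewrite mulr_gt0.
have hB : ratio ^+ 2 * (n%:R * log_inv_d2 / 2) < d1 * fourth_bound.
  by apply: le_lt_trans hZ; rewrite -e0_sqr -exprMn; apply: lerXn2r; rewrite // nnegrE ltW // (lt_le_trans re).
have W0 : 0 < mean_ustat.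
  rewrite lt_neqAle W_ge0 andbT; apply/eqP => W0; move: hB; rewrite /fourth_bound -W0 expr0n /= mulr0 addr0 mulr0.
  by rewrite ltNge mulr_ge0 ?sqr_ge0 // divr_ge0 // mulr_ge0 // ltW.
(* Z >= W sqrt(r / 2), as Z is at least any convex combination of its two arguments *)
set q : R := Num.sqrt (2 * ratio).
have q2 : q ^+ 2 = 2 * ratio by rewrite sqr_sqrtr // mulr_ge0 // ltW.
have q0 : 0 < q by rewrite sqrtr_gt0 mulr_gt0.
have qr : ratio <= q.
  rewrite -ler_sqr ?nnegrE ?(ltW r_gt0) ?(ltW q0) // q2 expr2.
  by apply: ler_wpM2r; first exact: ltW.
have hA : ratio / 2 * mean_ustat ^+ 2 < d1 * fourth_bound.
  apply: le_lt_trans hZ.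
  have zq : ratio * mean_ustat <= q * Z.
    have z1 : mean_ustat - (q - ratio) * eps_low <= Z by rewrite le_max lexx orbT.
    have := ler_wpM2l (ltW r_gt0) z1.
    have qr0 : 0 <= q - ratio by rewrite subr_ge0.
    have := ler_wpM2l qr0 Zr.
    by ctx_lra.
  have rW : 0 <= ratio * mean_ustat by rewrite mulr_ge0 // ltW.
  have : (ratio * mean_ustat) ^+ 2 <= (q * Z) ^+ 2 by apply: lerXn2r; rewrite // nnegrE (le_trans rW).
  have -> : (q * Z) ^+ 2 = 2 * ratio * Z ^+ 2 by rewrite -q2; ring.
  have -> : (ratio * mean_ustat) ^+ 2 = ratio ^+ 2 * mean_ustat ^+ 2 by ring.
  move=> H.
  have rr : 0 < 2 * ratio by rewrite mulr_gt0.
  have e : 2 * ratio * (ratio / 2 * mean_ustat ^+ 2) = ratio ^+ 2 * mean_ustat ^+ 2 by field.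
  by rewrite -(ler_pM2l rr) e.
have dL : d1 <= log_inv_d2.
  by apply: le_trans (ln_inv_ge d2_01); rewrite lerBrDr ltW.
have dL2 : 2 / 10 <= d1 -> 11 / 10 * d1 <= log_inv_d2.
  move=> h; rewrite -ler_expR -[expR log_inv_d2]invrK -expRN expL.
  have h1 : d2 <= expR (- (11 / 10 * d1)).
    have y0 : 0 <= 11 / 10 * d1 by ctx_lra.
    apply: le_trans (expRN_ge_taylor3 y0).
    have c1 : 0 <= (d1 - 2 / 10) * (1 - d1) by apply: mulr_ge0; ctx_lra.
    have c2 := mulr_ge0 (ltW d1_gt0) c1.
    have c3 := mulr_gt0 d1_gt0 d1_gt0; have c4 := mulr_gt0 d1_gt0 c3.
    by rewrite !exprS expr0; ctx_lra.
  by rewrite -[leLHS]invrK -expRN lef_pV2 ?posrE ?expR_gt0 //.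
have d3 := fourth_moment_feasible n9R W0 d1_gt0 dL dL2 hA hB.
set sn : R := Num.sqrt n%:R.
have sn2 : n%:R = sn ^+ 2 by rewrite sqr_sqrtr // ltW.
have sn0 : 0 < sn by rewrite sqrtr_gt0.
have sn3 : 3 <= sn.
  have c3 : 0 <= 3 :> R by [].
  by rewrite -ler_sqr ?nnegrE ?(ltW sn0) // -sn2 expr2; ctx_lra.
set t : R := Num.sqrt (2 * log_inv_d2).
have t2 : t ^+ 2 = 2 * log_inv_d2 by rewrite sqr_sqrtr // mulr_ge0 // ltW.
have t0 : 0 < t by rewrite sqrtr_gt0 mulr_gt0.
have t7 : 7 / 10 <= t.
  rewrite -ler_sqr ?nnegrE ?(ltW t0) // t2 expr2.
  by ctx_lra.
have d2t : d2 = expR (- (t ^+ 2 / 2)).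
  by rewrite t2 -expL; congr (expR (- _)); field.
set D : R := d1 + d2; have D0 : 0 < D by rewrite /D; ctx_lra.
set y : R := D * t; set g : R := (1 - d1) / sn - sn * d2.
have hy : 2 * D * (1 - D) <= y ^+ 2 - 2 * y * g by exact: deviation_feasible.
have y0 : 0 < y by rewrite mulr_gt0.
have c0 : 0 < y - g.
  have : 0 < 2 * D * (1 - D) by rewrite !mulr_gt0 // /D; ctx_lra.
  move=> h; have : 0 < y * (y - 2 * g) by move: hy h; rewrite expr2; ctx_lra.
  by rewrite pmulr_rgt0 // => hh; have := y0; ctx_lra.
apply: (@far2_covariance (sn / (2 * (y - g))) D (collision_free w)) => //; first by rewrite divr_gt0 // mulr_gt0.
have De0 : D * eps_low = sn * y / 2.
  have -> : eps_low = sn * t / 2.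
    apply/eqP; rewrite -(@eqrXn2 _ 2) //; [|exact: ltW|by rewrite divr_ge0 // mulr_ge0 // ltW].
    by rewrite e0_sqr !exprMn -sn2 t2 expr2; apply/eqP; field.
  by rewrite /y; field.
rewrite De0; apply: variance_tradeoff; rewrite ?collision_free_ge0 ?mass_var_le //.
by rewrite D0 /=; exact: d_lt1.
Qed.

End LargeSample.

End Two.

Lemma far_prob_le_2 (R : realType) (I : finType) (w : I -> R) (x0 : I) n (d1 d2 : R) :
  (forall i, 0 <= w i) -> \sum_i w i = 1 -> (1 < n)%N -> 0 < d1 < 1 -> 0 < d2 < 1 ->
  iid_prob w n (far w n 2 d1 d2) <= d1 + d2.
Proof.
move=> w0 w1 n1 /andP[d10 d11] /andP[d20 d21].
have [hd|hd] := leP 1 (d1 + d2); first by apply: le_trans hd; exact: iid_prob_le1.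
have [n9|n9] := ltnP n 9; first exact: far2_small_sample.
exact: far2_large_sample.
Qed.

(** * Truncation of a countable alphabet *)

Lemma far_prob_le (R : realType) (I : finType) (w : I -> R) (x0 : I) n m (d1 d2 : R) :
  (forall i, 0 <= w i) -> \sum_i w i = 1 -> (1 < n)%N -> 0 < d1 < 1 -> 0 < d2 < 1 ->
  (0 < m)%N -> ~~ odd m ->
  iid_prob w n (far w n m d1 d2) <= d1 + d2.
Proof.
move=> w0 w1 n1 h1 h2 m0 mo.
have mE : m = m./2.*2 by rewrite -[LHS]odd_double_half (negbTE mo).
case: (m./2) mE m0 => [|[|N]] -> //= _; first exact: far_prob_le_2.
exact: far_prob_le_ge4.
Qed.

Section Truncation.
Context {R : realType} (p : nat -> R).
Hypothesis hp : prob_dist p.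
Variable K : nat.

(** All symbols from K on are merged into the last symbol of a finite
    alphabet. *)
Definition tail : R := 1 - \sum_(i < K) p i.

Definition trunc_weight (j : 'I_K.+1) : R := if (j < K)%N then p j else tail.

Lemma partial_sum_le1 k : \sum_(i < k) p i <= 1.
Proof.
have [p0 cp] := hp.
have nd : nondecreasing_seq (series p).
  apply/nondecreasing_seqP => i; rewrite /series /= big_nat_recr //= lerDl; exact: p0.
have := nondecreasing_cvgn_le nd (cvgP _ cp) k; rewrite (cvg_lim _ cp) //.
by rewrite /series /= big_mkord.
Qed.

Lemma tail_ge0 : 0 <= tail.
Proof. by rewrite subr_ge0 partial_sum_le1. Qed.

Lemma trunc_weight_ge0 j : 0 <= trunc_weight j.
Proof. by rewrite /trunc_weight; case: ifP => _; [have [p0 _] := hp; exact: p0|exact: tail_ge0]. Qed.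

Lemma trunc_weight_sum1 : \sum_j trunc_weight j = 1.
Proof.
rewrite big_ord_recr /= {2}/trunc_weight ltnn (eq_bigr (fun i : 'I_K => p i)).
  by rewrite /tail addrC subrK.
by move=> i _; rewrite /trunc_weight /= ltn_ord.
Qed.

Lemma mass_le_tail i : (K <= i)%N -> p i <= tail.
Proof.
move=> Ki; rewrite /tail lerBrDr; apply: le_trans (partial_sum_le1 i.+1).
have [p0 _] := hp.
rewrite big_ord_recr /= [leLHS]addrC lerD2r -!(big_mkord xpredT p).
by rewrite (@big_cat_nat _ _ _ K 0 i) //= lerDl; apply: sumr_ge0 => j _; exact: p0.
Qed.

(** Samples that avoid the merged symbol are samples from the original
    alphabet, with the same probability. *)
Definition typical n m d1 d2 (s : seq 'I_K.+1) : bool :=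
  ~~ far trunc_weight n m d1 d2 s && (count_mem ord_max s == 0)%N.

Lemma iid_mean_count_id n (i : 'I_K.+1) :
  iid_mean trunc_weight n (fun s => (count_mem i s)%:R) = n%:R * trunc_weight i.
Proof.
rewrite (iid_mean_count i n (fun c => c%:R : R) trunc_weight_sum1).
case: n => [|n]; first by rewrite /= mul0r.
rewrite (bin_mean_ext _ (g := fun c => c%:R * 1)); last by move=> c _; rewrite mulr1.
by rewrite bin_mean_count_mul bin_mean_cst mulr1.
Qed.

(** The merged symbol appears with probability at most its expected count. *)
Lemma typical_prob_ge n m d1 d2 : (1 < n)%N -> 0 < d1 < 1 -> 0 < d2 < 1 -> (0 < m)%N -> ~~ odd m ->
  1 - d1 - d2 - n%:R * tail <= iid_prob trunc_weight n (typical n m d1 d2).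
Proof.
move=> n1 h1 h2 m0 mo.
have hf := far_prob_le ord0 trunc_weight_ge0 trunc_weight_sum1 n1 h1 h2 m0 mo.
have ht : iid_mean trunc_weight n (fun s => (count_mem ord_max s)%:R) = n%:R * tail.
  by rewrite iid_mean_count_id /trunc_weight /= ltnn.
suff h : 1 <= iid_prob trunc_weight n (typical n m d1 d2) +
    (iid_prob trunc_weight n (far trunc_weight n m d1 d2) +
     iid_mean trunc_weight n (fun s => (count_mem ord_max s)%:R)) by lra.
rewrite -!iid_meanD -[leLHS](iid_mean_cst trunc_weight_sum1 n).
apply: iid_mean_le => [|s _]; first exact: trunc_weight_ge0.
rewrite /typical; case: (far _ _ _ _ _ s) => /=; first by rewrite add0r lerDl.
case: eqP => [->|] /=; first by rewrite !addr0.
by move=> /eqP; rewrite -lt0n add0r add0r ler1n.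
Qed.

End Truncation.

Section Decoding.
Context {R : realType} (p : nat -> R).
Hypothesis hp : prob_dist p.
Variables (K n m : nat) (d1 d2 : R).
Hypothesis n1 : (1 < n)%N.
Hypothesis m0 : (0 < m)%N.
Hypothesis mo : ~~ odd m.
Hypothesis d1_01 : 0 < d1 < 1.
Hypothesis d2_01 : 0 < d2 < 1.
Variables (t : n.-tuple 'I_K.+1) (x : 'I_n -> nat).
Hypothesis xt : forall j, x j = tnth t j.
Hypothesis tt : typical p n m d1 d2 t.

Lemma appearances_count (i : 'I_K.+1) : appearances x i = count_mem i t.
Proof.
rewrite -sum1_count big_tuple /appearances -sum1_card.
rewrite [LHS]big_mkcond [RHS]big_mkcond /=; apply: eq_bigr => j _.
by rewrite inE xt.
Qed.

Let no_overflow : count_mem ord_max t = 0%N.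
Proof. by have /andP[_ /eqP] := tt. Qed.

Lemma appearances_overflow i : (K <= i)%N -> appearances x i = 0%N.
Proof.
move=> Ki; apply/eqP; rewrite -leqn0 -no_overflow -appearances_count.
rewrite /appearances; apply/subset_leq_card/fintype.subsetP => j; rewrite !inE => /eqP ji.
by move: Ki; rewrite -ji xt => h; rewrite eqn_leq -ltnS ltn_ord.
Qed.

Let q := mle R x.

(** Symbols that do not appear contribute nothing, so the series is a finite
    sum. *)
Lemma moment_sumE : moment_sum n m q = emp n m t.
Proof.
pose f i : R := emp_weight n m (appearances x i).
have fE : (fun i => \sum_(1 <= k < (m %/ 2).+1)
      k%:R ^+ (m - k) * n%:R ^+ k * (q i * (1 - q i)) ^+ k) = f by [].
have f0 i : (K <= i)%N -> f i = 0.
  move=> Ki; rewrite /f appearances_overflow // /emp_weight big_nat_cond big1 // => k.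
  by rewrite andbT => /andP[k0 _]; rewrite /emp_term !mul0r expr0n gtn_eqF // mulr0.
have sf N : (K <= N)%N -> series f N = \sum_(i < K) f i.
  move=> KN; rewrite /series /= -(big_mkord xpredT f) (@big_cat_nat _ _ _ K) //=.
  rewrite [X in _ + X]big_nat_cond [X in _ + X]big1 ?addr0 // => i.
  by rewrite andbT => /andP[Ki _]; exact: f0.
have -> : moment_sum n m q = limn (series f) by [].
have -> : limn (series f) = \sum_(i < K) f i.
  apply/cvg_lim => //; apply: cvg_near_cst.
  by exists K => // N /= KN; exact: sf.
rewrite /emp big_ord_recr /= no_overflow.
have -> : emp_weight n m 0 = 0 :> R by rewrite -(f0 K) // /f appearances_overflow.
by rewrite addr0; apply: eq_bigr => i _; rewrite /f -appearances_count.
Qed.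

(** A symbol i >= K does not appear, and its mass is at most the mass of the
    merged symbol, whose deviation is controlled because the merged symbol does
    not appear either. *)
Lemma typical_linf_dist_le : linf_dist p q <=
  n%:R^-1 * ((1 / d1) * (n%:R / (n%:R - 1)) * (moment_sum n m q + epsilon n m d2)) `^ (m%:R^-1).
Proof.
have n0 : 0 < n%:R :> R by rewrite ltr0n ltnW.
have mR : 0 < m%:R :> R by rewrite ltr0n.
set B : R := _ * (_ + _).
have hB (c : nat) (z : R) : (c%:R - n%:R * z) ^+ m <= B -> `|z - c%:R / n%:R| <= n%:R^-1 * B `^ m%:R^-1.
  move=> h; have -> : `|z - c%:R / n%:R| = n%:R^-1 * `|c%:R - n%:R * z|.
    have e : c%:R / n%:R - z = n%:R^-1 * (c%:R - n%:R * z) by field; rewrite gt_eqF.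
    by rewrite distrC e normrM ger0_norm // invr_ge0 ltW.
  rewrite ler_pM2l ?invr_gt0 //.
  have a0 := normr_ge0 (c%:R - n%:R * z).
  have am : `|c%:R - n%:R * z| ^+ m = (c%:R - n%:R * z) ^+ m.
    by rewrite -normrX ger0_norm // exprn_even_ge0.
  have -> : `|c%:R - n%:R * z| = (`|c%:R - n%:R * z| ^+ m) `^ m%:R^-1.
    by rewrite -powR_mulrn // -powRrM divff ?gt_eqF // powRr1.
  apply: ge0_ler_powR; rewrite ?nnegrE ?exprn_ge0 ?invr_ge0 ?(ltW mR) //.
    by apply: le_trans h; rewrite -am exprn_ge0.
  by rewrite am.
have hfar (i : 'I_K.+1) : ((count_mem i t)%:R - n%:R * trunc_weight p i) ^+ m <= B.
  rewrite /B div1r moment_sumE leNgt; apply/negP => h.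
  by have /andP[/negP + _] := tt; apply; apply/existsP; exists i.
apply: ge_sup; first by exists (`|p 0%N - q 0%N|); exists 0%N.
move=> _ [i _ <-]; apply: hB.
have [iK|Ki] := ltnP i K.
  have iK1 : (i < K.+1)%N by exact: leqW.
  have := hfar (Ordinal iK1); rewrite -appearances_count /trunc_weight /= iK.
  by [].
apply: le_trans (hfar ord_max).
rewrite appearances_overflow // no_overflow /trunc_weight /= ltnn !sub0r.
rewrite -[leLHS](@ger0_norm _ (_ ^+ m)) ?exprn_even_ge0 // -[leRHS](@ger0_norm _ (_ ^+ m)) ?exprn_even_ge0 //.
rewrite !normrX !normrN; apply: lerXn2r; rewrite ?nnegrE ?normr_ge0 //.
have [p0 _] := hp.
rewrite !ger0_norm ?mulr_ge0 ?tail_ge0 ?(ltW n0) //.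
by rewrite ler_pM2l // mass_le_tail.
Qed.

End Decoding.

(** * Samples as random variables *)

Section Sampling.
Context (R : realType) (p : nat -> R) (n : nat)
  (d : measure_display) (T : measurableType d) (P : probability T R)
  (X : 'I_n -> {RV P >-> nat}).
Hypothesis hX : iid_sample P p X.

Definition sample (w : T) : n.-tuple nat := [tuple X j w | j < n].

Lemma measurable_sample_eq u : measurable [set w | sample w = u].
Proof.
have -> : [set w | sample w = u] = \bigcap_(j in [set` [set: 'I_n]]%SET) (X j @^-1` [set tnth u j]).
  apply/seteqP; split => [w /= <- j _ /=|w h /=]; first by rewrite tnth_mktuple.
  by apply: eq_from_tnth => j; rewrite tnth_mktuple; apply: h; rewrite /= finset.in_setT.
apply: fin_bigcap_measurable => [|j _]; first exact: finite_finset.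
by rewrite -[X in measurable X]setTI; apply: measurable_funP.
Qed.

Lemma prob_sample_eq u : P [set w | sample w = u] = (\prod_(j < n) p (tnth u j))%:E.
Proof.
have [hd hi] := hX.
have -> : [set w | sample w = u] = \bigcap_(j in [set` [set: 'I_n]]%SET) (X j @^-1` [set tnth u j]).
  apply/seteqP; split => [w /= <- j _ /=|w h /=]; first by rewrite tnth_mktuple.
  by apply: eq_from_tnth => j; rewrite tnth_mktuple; apply: h; rewrite /= finset.in_setT.
rewrite (hi [set: 'I_n]%SET (fun j => [set tnth u j])) //.
rewrite -prodEFin; apply: eq_big => [j|j _]; first by rewrite finset.in_setT.
exact: hd.
Qed.

Lemma measurable_sample_in (A : set (n.-tuple nat)) : measurable [set w | A (sample w)].
Proof.
have -> : [set w | A (sample w)] =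
   \bigcup_k [set w | if unpickle k is Some u then A u /\ sample w = u else False].
  apply/seteqP; split => [w /= Aw|w /= [k _]] /=.
    by exists (pickle (sample w)) => //=; rewrite pickleK.
  by case: (unpickle k) => // u [Au ->].
apply: bigcupT_measurable => k; case: (unpickle k) => [u|]; last first.
  by rewrite (_ : [set _ | False] = set0) //; apply/seteqP; split.
have [Au|nAu] := pselect (A u).
  by rewrite (_ : mkset _ = [set w | sample w = u]); [exact: measurable_sample_eq|apply/seteqP; split => w /=; tauto].
by rewrite (_ : mkset _ = set0) //; apply/seteqP; split => w /=; tauto.
Qed.

(** Finite sets of samples are enough: the truncated alphabets exhaust the
    original one up to a vanishing probability. *)
Lemma prob_sample_in_seq (r : seq (n.-tuple nat)) : uniq r ->
  P [set w | sample w \in r] = (\sum_(u <- r) \prod_(j < n) p (tnth u j))%:E.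
Proof.
elim: r => [_|u r IH /= /andP[ur hr]].
  by rewrite big_nil (_ : mkset _ = set0) ?measure0 //; apply/seteqP; split.
rewrite big_cons EFinD -IH // -prob_sample_eq -measureU; last 3 first.
- exact: measurable_sample_eq.
- exact: (measurable_sample_in [set v | v \in r]).
- by apply/seteqP; split => // w /= [-> ]; rewrite (negbTE ur).
congr (P _); apply/seteqP; split => w /=; rewrite inE.
  by case/orP => [/eqP|]; [left|right].
by case=> [->|->]; rewrite ?eqxx ?orbT.
Qed.

End Sampling.

Theorem theorem2 (R : realType) (p : nat -> R) (hp : prob_dist p)
    (n : nat) (hn : (2 <= n)%N)
    (d : measure_display) (T : measurableType d) (P : probability T R)
    (X : 'I_n -> {RV P >-> nat}) (hX : iid_sample P p X)
    (delta1 delta2 : R)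
    (hd1 : 0 < delta1 < 1) (hd2 : 0 < delta2 < 1)
    (m : nat) (hm0 : (0 < m)%N) (hm : ~~ odd m) :
  ((1 - delta1 - delta2)%:E <=
    P [set w |
        let phat := mle R (fun j : 'I_n => X j w) in
        linf_dist p phat <=
          n%:R^-1 *
          ((1 / delta1) * (n%:R / (n%:R - 1)) *
           (moment_sum n m phat + epsilon n m delta2)) `^ (m%:R^-1)]%R)%E.
Proof.
set G := [set w | _].
pose A := [set u : n.-tuple nat | let phat := mle R (tnth u) in
        linf_dist p phat <=
          n%:R^-1 *
          ((1 / delta1) * (n%:R / (n%:R - 1)) *
           (moment_sum n m phat + epsilon n m delta2)) `^ (m%:R^-1)].
have GE : G = [set w | A (sample X w)].
  rewrite /G /A; apply: eq_set => w /=.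
  by rewrite (_ : (fun j => X j w) = tnth (sample X w)) //; apply/funext => j; rewrite tnth_mktuple.
have mG : measurable G by rewrite GE; exact: measurable_sample_in.
have hK K : ((1 - delta1 - delta2 - n%:R * tail p K)%:E <= P G)%E.
  pose good := [seq t : n.-tuple 'I_K.+1 <- enum {: n.-tuple 'I_K.+1} | typical p n m delta1 delta2 t].
  pose dec (t : n.-tuple 'I_K.+1) : n.-tuple nat := [tuple val (tnth t j) | j < n].
  have dec_inj : injective dec.
    move=> t u /(congr1 (fun v => tnth v)) e; apply: eq_from_tnth => j; apply: val_inj.
    by have := congr1 (fun g => g j) e; rewrite !tnth_mktuple.
  have ur : uniq (map dec good) by rewrite (map_inj_uniq dec_inj); apply: filter_uniq; exact: enum_uniq.
  apply: le_trans (_ : (P [set w | sample X w \in map dec good] <= _)%E); last first.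
    apply: le_measure.
    - by rewrite inE; exact: (measurable_sample_in X [set v | v \in map dec good]).
    - by rewrite inE; exact: mG.
    move=> w /= /mapP[t]; rewrite mem_filter => /andP[ht _] e.
    have xt j : tnth (sample X w) j = tnth t j :> nat by rewrite e tnth_mktuple.
    by rewrite GE; exact: (typical_linf_dist_le hp hn hm0 hm xt ht).
  rewrite (prob_sample_in_seq hX ur) lee_fin.
  apply: le_trans (typical_prob_ge hp K hn hd1 hd2 hm0 hm) _.
  rewrite /iid_prob iid_mean_tuple big_map big_filter big_enum_cond /=.
  rewrite (bigID (fun t : n.-tuple 'I_K.+1 => typical p n m delta1 delta2 t)) /= [X in _ + X]big1 ?addr0; last first.
    by move=> t /negbTE ->; rewrite mulr0.
  apply: ler_sum => t ht; rewrite ht mulr1; apply: le_of_eq; apply: eq_bigr => j _.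
  rewrite tnth_mktuple /trunc_weight; case: ifP => [_|jK]; first reflexivity.
  (* a typical sample has no merged symbol *)
  have : tnth t j = ord_max.
    apply: val_inj; apply/eqP; rewrite /= eqn_leq -ltnS ltn_ord /=.
    by move: jK => /negbT; rewrite -leqNgt.
  move=> tj; have /andP[_ ] := ht; rewrite -leqn0 leqNgt -has_count => /negP[].
  by apply/hasP; exists (tnth t j); [exact: mem_tnth|rewrite /= tj].
have [p0 cp] := hp.
have Pfin : P G \is a fin_num by exact: fin_num_measure.
rewrite -(fineK Pfin) lee_fin.
have ct : (fun K => 1 - delta1 - delta2 - n%:R * tail p K) @ \oo --> (1 - delta1 - delta2 : R).
  have e : 1 - delta1 - delta2 = 1 - delta1 - delta2 - n%:R * (1 - 1) :> R by rewrite subrr mulr0 subr0.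
  rewrite [X in _ --> X]e.
  apply: cvgB; first exact: cvg_cst.
  apply: cvgM; first exact: cvg_cst.
  apply: cvgB; first exact: cvg_cst.
  by under eq_fun do rewrite -(big_mkord xpredT p).
apply: (@ler_cvg_to _ _ _ _ (fun K => 1 - delta1 - delta2 - n%:R * tail p K) (fun=> fine (P G)) _ _ ct (cvg_cst _)).
by near=> K; rewrite -lee_fin fineK.
Unshelve. all: by end_near.
Qed.
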